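(* Let $p\geq 5$ be prime. Then there exists a $p$-integral modular form $f_{p+1} \in \mathrm{M}_{p+1}$ such that $$E_2 E_{p-1} \equiv f_{p+1} + p\, E_{p+1}^p \pmod{p^2},$$ or equivalently (with the same $f_{p+1}$) $$E_2\equiv E_{p-1}^{p-1}\, f_{p+1} + p\, E_{p+1}^{p} \pmod{p^2}.$$
   Context: For even $w\ge 2$, let $B_w$ be the $w$-th Bernoulli number, $\sigma_{w-1}(n)=\sum_{d\mid n} d^{w-1}$, and define (as a formal power series in $q$) $E_w := 1-\frac{2w}{B_w}\sum_{n\ge 1}\sigma_{w-1}(n)q^n$ (in particular $E_2 = 1-24\sum_{n\ge1}\sigma_1(n)q^n$, which is not a modular form). For even $w$, $\mathrm{M}_w$ denotes the space of modular forms of weight $w$ on $\mathrm{SL}_2(\mathbb{Z})$ with rational Fourier coefficients, each form being identified with its Fourier expansion in $\mathbb{Q}[[q]]$. Let $\mathbb{Z}_{(p)}$ be the ring of $p$-integral rational numbers; a modular form is $p$-integral if all its Fourier coefficients lie in $\mathbb{Z}_{(p)}$. The congruence $\sum a(n)q^n\equiv\sum b(n)q^n \pmod{p^m}$ means $a(n)\equiv b(n)\pmod{p^m}$ for all $n$ (i.e. $a(n)-b(n)\in p^m\mathbb{Z}_{(p)}$). *)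

(* Defs.v *)
From mathcomp Require Import all_boot all_order all_algebra.
From mathcomp Require Import complex.
From mathcomp Require Import all_classical all_reals all_analysis.

Set Implicit Arguments.
Unset Strict Implicit.
Unset Printing Implicit Defensive.

Import Order.TTheory GRing.Theory Num.Theory.
Import numFieldNormedType.Exports.

Local Open Scope ring_scope.
Local Open Scope classical_set_scope.

(* A series in Q[[q]] is its sequence of coefficients.  The product is the
   Cauchy product; the library's ring structure on functions [nat -> rat] is
   pointwise and is not the one used here. *)
Definition qseries := nat -> rat.

Definition qone : qseries := fun n => (n == 0%N)%:R.
Definition qadd (f g : qseries) : qseries := fun n => f n + g n.
Definition qscale (c : rat) (f : qseries) : qseries := fun n => c * f n.
Definition qmul (f g : qseries) : qseries :=
  fun n => \sum_(i < n.+1) f i * g (n - i)%N.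
Definition qpow (f : qseries) (k : nat) : qseries := iter k (qmul f) qone.

(* [bernoulli_seq n] is B_0, ..., B_{n-1}, computed from the recurrence
   \sum_(k <= m) 'C(m.+1, k) B_k = [m = 0]  (so B_1 = - 1/2). *)
Fixpoint bernoulli_seq (n : nat) : seq rat :=
  if n is m.+1 then
    let s := bernoulli_seq m in
    rcons s (((m == 0%N)%:R - \sum_(k < m) 'C(m.+1, k)%:R * s`_k) / m.+1%:R)
  else [::].

Definition bernoulli (n : nat) : rat := (bernoulli_seq n.+1)`_n.

Definition sigma (k n : nat) : nat := (\sum_(d <- divisors n) d ^ k)%N.

Definition eisenstein (w : nat) : qseries := fun n =>
  if n == 0%N then 1
  else - ((2 * w)%N%:R / bernoulli w) * (sigma w.-1 n)%:R.

(* Membership in the local ring Z_(p). *)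
Definition p_integral (p : nat) (x : rat) : bool := ~~ (p %| `|denq x|)%N.

Definition qp_integral (p : nat) (f : qseries) : Prop :=
  forall n, p_integral p (f n).

Definition qcongr (p m : nat) (f g : qseries) : Prop :=
  forall n, exists2 c : rat, p_integral p c & f n - g n = p%:R ^+ m * c.

(* The complex numbers, packaged as a field so that the topology and the
   normed module structure of a numeric field over itself are found on them. *)
Definition C (R : realType) : numClosedFieldType := R[i].

Section ModularForms.
Variable R : realType.
Implicit Types (f : C R -> C R) (z : C R) (w : nat) (a : qseries).

Definition Cexp z : C R :=
  (expR (complex.Re z) * cos (complex.Im z)
    +i* (expR (complex.Re z) * sin (complex.Im z)))%C.

Definition qparam z : C R := Cexp (2 * (pi : R)%:C%C * 'i%C * z).

Definition upper_half z : Prop := 0 < complex.Im z.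

Definition automorphy (g : 'M[int]_2) z : C R :=
  (g 1 0)%:~R * z + (g 1 1)%:~R.

Definition moebius (g : 'M[int]_2) z : C R :=
  ((g 0 0)%:~R * z + (g 0 1)%:~R) / automorphy g z.

(* Only the values on the upper half-plane matter.  [derivable f z 1] is
   complex differentiability, since the scalars are [C R].  For a holomorphic
   weakly modular function, holomorphy at the cusp is boundedness as
   Im z -> +oo. *)
Record modular_form w f : Prop := ModularForm {
  modular_holomorphic : forall z, upper_half z -> derivable f z 1;
  modular_transform : forall g : 'M[int]_2, \det g = 1 ->
    forall z, upper_half z -> f (moebius g z) = automorphy g z ^+ w * f z;
  modular_cusp : exists M Y : R, forall z,
    upper_half z -> Y <= complex.Im z -> `|f z| <= M%:C%C
}.

Definition fourier_expansion f a : Prop := forall z, upper_half z ->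
  series (fun n => ratr (a n) * qparam z ^+ n) @ \oo --> f z.

(* M_w, each form being identified with its Fourier expansion in Q[[q]]. *)
Definition Mspace w a : Prop :=
  exists2 f, modular_form w f & fourier_expansion f a.

End ModularForms.

(* Main.v *)
(* Put G_k = - B_k / (2k) + sum sigma_(k-1)(n) q^n and D = q d/dq.

   Modularity.  Liouville's identity, obtained by pairing the solutions of
   a x + b y = n through (a, b, x, y) |-> (a - b, b, x, x + y), expresses
   G_(m+2) through D G_m + 2 m G_2 G_m and products of lower G_k.  Once G_2 is
   known to transform as a quasimodular form under z |-> -1/z, which follows
   from the cotangent expansion and an interchange of two conditionally
   convergent sums, all the G_k with k >= 4 transform as modular forms of
   weight k, and Euclid's algorithm extends the law from -1/z to SL_2(Z).

   Congruence.  The form is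
     f = E_2 E_(p-1) - 12 / (p - 1) D E_(p-1) - p E_(p+1),
   modular because its first two terms make up a Serre derivative.  As
   p B_(p-1) = -1 mod p, the term 12 / (p - 1) D E_(p-1) is
   24 p sum n sigma_(p-2)(n) q^n mod p^2.  By Fermat n sigma_(p-2)(n) is mod p
   the sum of the n / d with p not dividing d, that is
   sigma_1(n) - sigma_1(n / p); so this term is p (E_2(q^p) - E_2) mod p^2, and
   E_2(q^p) = E_2^p = E_(p+1)^p mod p, since B_(p+1) = 1/12 mod p.

   The two congruences are equivalent since E_(p-1) = 1 mod p and hence
   E_(p-1)^p = 1 mod p^2. *)

Require Import Defs.
From HB Require Import structures.
From mathcomp Require Import all_boot all_order all_algebra.
From mathcomp Require Import complex.
From mathcomp Require Import all_classical all_reals all_analysis.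
From mathcomp Require Import ring lra zify.

Set Implicit Arguments.
Unset Strict Implicit.
Unset Printing Implicit Defensive.

Import Order.TTheory GRing.Theory Num.Theory.
Import numFieldNormedType.Exports.

Local Open Scope ring_scope.
Local Open Scope classical_set_scope.

(** * Power series and Bernoulli numbers *)

(** Lattice sums are evaluated in weight 2 only; the higher weights come from identities between
    divisor sums, which requires no zeta value beyond zeta(2) and keeps all coefficients rational.
    The obstacle in weight 2 is that the double sum of (m z + n)^-2 converges only conditionally.
    Each x^-2 is therefore corrected by 1/(x - 1/2) - 1/(x + 1/2) = 1/(x^2 - 1/4), which leaves
    O(x^-4). With the inner sum over n the correction contributes 0; with the inner sum over m it
    telescopes to boundary cotangents whose limit at infinity is not 0, and this limit is the
    anomaly 2 pi i / z. The cotangent expansion itself is the limit of the iterated duplication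
    formula, justified by Tannery's theorem. The factor 12/(p - 1) in f is forced: the Serre
    derivative in weight w is D + 2 w G_2, and multiplying it by -12/(p - 1) for w = p - 1 turns 2 w
    G_2 into -24 G_2 = E_2. The term -p E_(p+1) stands in for -p E_2, which is not modular; since it
    already carries a factor p, a congruence mod p between the two is enough. *)

(* [qseries] with the Cauchy product [qmul] as its ring structure *)
Definition fps : Type := qseries.

HB.instance Definition _ := gen_eqMixin fps.
HB.instance Definition _ := gen_choiceMixin fps.

Section FpsRing.
Implicit Types f g h : fps.

Definition fps_opp f : fps := fun n => - f n.

Lemma fps_addA : associative (qadd : fps -> fps -> fps).
Proof. by move=> f g h; apply/funext => n; exact: addrA. Qed.

Lemma fps_addC : commutative (qadd : fps -> fps -> fps).
Proof. by move=> f g; apply/funext => n; exact: addrC. Qed.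

Lemma fps_add0 : left_id ((fun _ => 0) : fps) qadd.
Proof. by move=> f; apply/funext => n; exact: add0r. Qed.

Lemma fps_addN : left_inverse ((fun _ => 0) : fps) fps_opp qadd.
Proof. by move=> f; apply/funext => n; exact: addNr. Qed.

HB.instance Definition _ := GRing.isZmodule.Build fps fps_addA fps_addC fps_add0 fps_addN.

Definition trunc N f : {poly rat} := \poly_(i < N) f i.

Lemma coef_trunc N f n : (n < N)%N -> (trunc N f)`_n = f n.
Proof. by move=> nN; rewrite coef_poly nN. Qed.

(** A coefficient of a product depends only on truncations of the factors, so the ring laws are
    inherited from polynomials. *)
Lemma qmul_trunc N f g n : (n < N)%N -> qmul f g n = (trunc N f * trunc N g)`_n.
Proof.
move=> nN; rewrite coefM; apply: eq_bigr => i _.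
rewrite !coef_trunc// ?(leq_ltn_trans _ nN)// ?leq_subr//.
by rewrite -ltnS.
Qed.

Lemma fps_mulA : associative (qmul : fps -> fps -> fps).
Proof.
move=> f g h; apply/funext => n.
transitivity ((trunc n.+1 f * (trunc n.+1 g * trunc n.+1 h))`_n).
  rewrite coefM; apply: eq_bigr => i _; rewrite coef_trunc//.
  by rewrite (@qmul_trunc n.+1)// ltnS leq_subr.
rewrite mulrA coefM; apply: eq_bigr => i _.
by rewrite coef_trunc ?ltnS ?leq_subr// (@qmul_trunc n.+1).
Qed.

Lemma fps_mulC : commutative (qmul : fps -> fps -> fps).
Proof.
by move=> f g; apply/funext => n; rewrite !(@qmul_trunc n.+1)// mulrC.
Qed.

Lemma fps_mul1 : left_id (qone : fps) qmul.
Proof.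
move=> f; apply/funext => n; rewrite /qmul big_ord_recl subn0 mul1r big1 ?addr0//.
by move=> i _; rewrite /qone /= mul0r.
Qed.

Lemma fps_mulDl : left_distributive (qmul : fps -> fps -> fps) qadd.
Proof.
move=> f g h; apply/funext => n; rewrite /qmul /qadd -big_split.
by apply: eq_bigr => i _; rewrite mulrDl.
Qed.

Lemma fps_oner_neq0 : (qone : fps) != 0.
Proof. by apply/eqP => /(congr1 (fun f : fps => f 0%N)). Qed.

HB.instance Definition _ := GRing.Zmodule_isComNzRing.Build fps
  fps_mulA fps_mulC fps_mul1 fps_mulDl fps_oner_neq0.

Lemma fpsE f g n : (f + g) n = f n + g n. Proof. by []. Qed.
Lemma fpsN f n : (- f) n = - f n. Proof. by []. Qed.
Lemma fpsM f g n : (f * g) n = \sum_(i < n.+1) f i * g (n - i)%N. Proof. by []. Qed.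
Lemma fps1 n : (1 : fps) n = (n == 0%N)%:R. Proof. by []. Qed.
Lemma fps_sum (I : Type) (r : seq I) (P : pred I) (F : I -> fps) n :
  (\sum_(i <- r | P i) F i) n = \sum_(i <- r | P i) F i n.
Proof. by elim/big_rec2: _ => [//|i y x _ <-]. Qed.

Definition fpsC (c : rat) : fps := fun n => if n == 0%N then c else 0.

Lemma fpsCM c f n : (fpsC c * f) n = c * f n.
Proof.
rewrite fpsM big_ord_recl subn0 big1 ?addr0// => i _.
by rewrite /fpsC /= mul0r.
Qed.

Lemma qscaleE c f : qscale c f = fpsC c * f.
Proof. by apply/funext => n; rewrite fpsCM. Qed.

Lemma qpowE f k : qpow f k = f ^+ k :> fps.
Proof. by elim: k => [//|k IH]; rewrite exprS -IH. Qed.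

Definition fpsX : fps := fun n => (n == 1%N)%:R.

Lemma fpsXM f n : (fpsX * f) n = if n is m.+1 then f m else 0.
Proof.
case: n => [|n]; first by rewrite fpsM big_ord1 mul0r.
rewrite fpsM !big_ord_recl mul0r add0r mul1r subn1 big1 ?addr0// => i _.
by rewrite mul0r.
Qed.

Lemma fpsXI f g : fpsX * f = fpsX * g -> f = g.
Proof.
move=> h; apply/funext => n.
by have := congr1 (fun u : fps => u n.+1) h; rewrite !fpsXM.
Qed.

Definition qD f : fps := fun n => n%:R * f n.

Lemma qD_mul f g : qD (f * g) = qD f * g + f * qD g.
Proof.
apply/funext => n; rewrite /qD fpsE !fpsM mulr_sumr -big_split.
apply: eq_bigr => i _; have /subnKC {1}<- : (i <= n)%N by rewrite -ltnS.
by rewrite natrD mulrDl mulrA mulrCA.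
Qed.

(** Substitution of -x for x, used to read off the parity of the Bernoulli numbers. *)
Definition fps_flip f : fps := fun n => (-1) ^+ n * f n.

Lemma fps_flipM f g : fps_flip (f * g) = fps_flip f * fps_flip g.
Proof.
apply/funext => n; rewrite /fps_flip !fpsM mulr_sumr.
apply: eq_bigr => i _; have /subnKC {1}<- : (i <= n)%N by rewrite -ltnS.
by rewrite exprD; ring.
Qed.

End FpsRing.

(** * Bernoulli numbers through their generating function *)

Section Bernoulli.

Lemma size_bernoulli_seq n : size (bernoulli_seq n) = n.
Proof. by elim: n => //= n IH; rewrite size_rcons IH. Qed.

Lemma nth_bernoulli_seq n k : (k < n)%N -> (bernoulli_seq n)`_k = bernoulli k.
Proof.
elim: n => // n IH; rewrite ltnS leq_eqVlt => /orP[/eqP -> //|kn].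
by rewrite /= nth_rcons size_bernoulli_seq kn IH.
Qed.

Lemma bernoulliE m : bernoulli m =
  ((m == 0%N)%:R - \sum_(k < m) 'C(m.+1, k)%:R * bernoulli k) / m.+1%:R.
Proof.
rewrite {1}/bernoulli /= nth_rcons size_bernoulli_seq ltnn eqxx.
by congr ((_ - _) / _); apply: eq_bigr => k _; rewrite nth_bernoulli_seq.
Qed.

Lemma bernoulli_rec m :
  \sum_(k < m.+1) 'C(m.+1, k)%:R * bernoulli k = (m == 0%N)%:R.
Proof.
rewrite big_ord_recr /= binSn [X in _ + _ * X]bernoulliE.
by rewrite mulrC divfK ?pnatr_eq0// addrC subrK.
Qed.

Lemma bernoulli0 : bernoulli 0 = 1.
Proof. by rewrite bernoulliE big_ord0 subr0 divr1. Qed.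

Lemma bernoulli1 : bernoulli 1 = - (1/2).
Proof. by rewrite bernoulliE big_ord1 bernoulli0 bin0 sub0r mulr1 mulNr. Qed.

Lemma bernoulli2 : bernoulli 2 = 1/6.
Proof. by rewrite bernoulliE !big_ord_recr big_ord0 /= bernoulli0 bernoulli1; apply/eqP. Qed.

(* exponential generating functions: of the Bernoulli numbers, of exp, and
   (exp x - 1) / x, which is inverse to the first one *)
Definition egfB : fps := fun n => bernoulli n / n`!%:R.
Definition egfE : fps := fun n => n`!%:R^-1.
Definition egfU : fps := fun n => (n.+1)`!%:R^-1.

Lemma factr_neq0 n : n`!%:R != 0 :> rat.
Proof. by rewrite pnatr_eq0 -lt0n fact_gt0. Qed.

Lemma binr_fact n k : (k <= n)%N ->
  'C(n, k)%:R = n`!%:R / (k`!%:R * (n - k)`!%:R) :> rat.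
Proof.
by move=> kn; rewrite -(bin_fact kn) !natrM mulfK// mulf_neq0// factr_neq0.
Qed.

Lemma egfBU : egfB * egfU = 1.
Proof.
apply/funext => m; rewrite fpsM fps1 -bernoulli_rec.
have [->|m0] := eqVneq m 0%N.
  by rewrite !big_ord1 /egfB /egfU bin0 bernoulli0 divr1 mul1r.
transitivity ((m.+1)`!%:R^-1 * \sum_(k < m.+1) 'C(m.+1, k)%:R * bernoulli k).
  rewrite mulr_sumr; apply: eq_bigr => k _; have km : (k <= m)%N by rewrite -ltnS.
  rewrite binr_fact ?(leq_trans km)// subSn// /egfB /egfU.
  by field; rewrite !factr_neq0.
by rewrite bernoulli_rec (negPf m0) mulr0.
Qed.

Lemma egfE_U : egfE = 1 + fpsX * egfU.
Proof.
apply/funext => n; rewrite fpsE fps1 fpsXM /egfE /egfU.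
by case: n => [|n]; rewrite ?invr1 ?addr0 ?add0r.
Qed.

Lemma egfE_flip : egfE * fps_flip egfE = 1.
Proof.
apply/funext => n; rewrite fpsM fps1.
transitivity (n`!%:R^-1 * (1 - 1) ^+ n : rat).
  rewrite exprBn mulr_sumr (reindex_inj rev_ord_inj) /=.
  apply: eq_bigr => k _; have kn : (k <= n)%N by rewrite -ltnS.
  rewrite subSS subKn// /egfE /fps_flip !expr1n !mulr1 -[X in _ = _ * X]mulr_natr binr_fact//.
  by field; rewrite !factr_neq0.
by rewrite subrr expr0n; case: n => [|n] /=; rewrite ?invr1 ?mulr1 ?mulr0.
Qed.

(** For B(x) = x/(exp x - 1) one has B(-x) = B(x) exp x, and exp x = 1 + x U(x) with B U = 1. Every
    odd coefficient of B beyond the first therefore vanishes. *)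
Lemma egfB_flip : fps_flip egfB = egfB + fpsX.
Proof.
have flipX : fps_flip fpsX = - fpsX.
  by apply/funext => -[|[|n]]; rewrite /fps_flip /fpsX fpsN ?mulr0 ?oppr0.
have flipD f g : fps_flip (f + g) = fps_flip f + fps_flip g.
  by apply/funext => n; rewrite /fps_flip !fpsE mulrDr.
have flip1 : fps_flip 1 = 1.
  by apply/funext => -[|n]; rewrite /fps_flip !fps1 ?mulr0.
have eU : egfE * fps_flip egfU = egfU.
  apply: fpsXI; have := egfE_flip; rewrite {2}egfE_U flipD flip1 fps_flipM flipX.
  rewrite {1}egfE_U => h; apply/eqP; rewrite -subr_eq0; apply/eqP.
  have -> : fpsX * (egfE * fps_flip egfU) - fpsX * egfU =
    1 - (1 + fpsX * egfU) * (1 + - fpsX * fps_flip egfU).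
    by rewrite egfE_U; ring.
  by rewrite h subrr.
have BU : fps_flip egfB * fps_flip egfU = 1 by rewrite -fps_flipM egfBU.
have -> : fps_flip egfB = egfB * (egfE * fps_flip egfU) * fps_flip egfB.
  by rewrite eU egfBU mul1r.
have -> : egfB * (egfE * fps_flip egfU) * fps_flip egfB =
  egfB * egfE * (fps_flip egfB * fps_flip egfU) by ring.
rewrite BU mulr1 egfE_U mulrDr mulr1 mulrCA egfBU.
by rewrite mulr1.
Qed.

Lemma bernoulli_odd n : odd n -> (2 < n)%N -> bernoulli n = 0.
Proof.
move=> on n2; have := congr1 (fun f : fps => f n) egfB_flip.
rewrite /fps_flip fpsE /fpsX gtn_eqF ?(ltn_trans _ n2)// addr0 -signr_odd on.
rewrite expr1 mulN1r => /eqP; rewrite eqNr mulf_eq0 invr_eq0 (negPf (factr_neq0 _)) orbF.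
by move/eqP.
Qed.

(* the differential equation of x / (exp x - 1) *)
Lemma egfB_square : egfB * egfB = egfB - fpsX * egfB - qD egfB.
Proof.
have thX f : qD (fpsX * f) = fpsX * f + fpsX * qD f.
  rewrite qD_mul; congr (_ * _ + _); apply/funext => -[|[|n]];
  by rewrite /qD /fpsX ?mulr0 ?mulr1.
have thU : qD egfU = 1 + fpsX * egfU - egfU.
  apply: fpsXI; have h : qD egfE = fpsX * egfE.
    apply/funext => -[|n]; rewrite fpsXM /qD ?mul0r// /egfE factS natrM invfM.
    by rewrite mulrA divff ?mul1r// pnatr_eq0.
  have th1 : qD (1 + fpsX * egfU) = qD (fpsX * egfU).
    by apply/funext => -[|n]; rewrite /qD fpsE fps1 ?mul0r// add0r.
  rewrite egfE_U th1 thX in h.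
  by rewrite mulrBr -h addrC addKr.
(* [qD] is applied to B U = 1, and the result is multiplied by B to eliminate U. *)
have := congr1 qD egfBU; rewrite qD_mul thU.
have -> : qD 1 = 0 by apply/funext => -[|n]; rewrite /qD fps1 ?mul0r ?mulr0.
move=> h; have : egfB * (qD egfB * egfU + egfB * (1 + fpsX * egfU - egfU)) = 0.
  by rewrite h mulr0.
have -> : egfB * (qD egfB * egfU + egfB * (1 + fpsX * egfU - egfU)) =
  qD egfB * (egfB * egfU) + egfB * egfB
  + egfB * (egfB * egfU) * fpsX - egfB * (egfB * egfU) by ring.
rewrite egfBU => h2.
have -> : egfB * egfB = (qD egfB * 1 + egfB * egfB + egfB * 1 * fpsX - egfB * 1)
   + egfB - fpsX * egfB - qD egfB by ring.
by rewrite h2 add0r.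
Qed.

(** Euler's quadratic relation: the coefficient of x^k in the differential equation, times k!. It
    settles the constant terms in the convolution of Eisenstein series. *)
Lemma bernoulli_euler k : (0 < k)%N ->
  \sum_(j < k.+1) 'C(k, j)%:R * (bernoulli j * bernoulli (k - j)) =
  (1 - k%:R) * bernoulli k - k%:R * bernoulli k.-1.
Proof.
case: k => // k _.
have := congr1 (fun f : fps => (k.+1)`!%:R * f k.+1) egfB_square.
rewrite /= fpsM mulr_sumr !fpsE !fpsN fpsXM /qD => h.
transitivity (\sum_(i < k.+2) (k.+1)`!%:R * (egfB i * egfB (k.+1 - i)%N)).
  apply: eq_bigr => i _; rewrite binr_fact ?/egfB; last by rewrite -ltnS.
  by field; rewrite !factr_neq0.
rewrite h /egfB factS natrM /=.
have k0 : k.+1%:R != 0 :> rat by rewrite pnatr_eq0.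
move: (k.+1%:R : rat) k0 (k`!%:R : rat) (factr_neq0 k) => x x0 f f0.
by field; rewrite x0 f0.
Qed.

Lemma bin_trinomial n i l : (i + l <= n)%N ->
  'C(n, i)%:R * 'C(n - i, l)%:R = 'C(n, l)%:R * 'C(n - l, i)%:R :> rat.
Proof.
move=> h; rewrite !binr_fact; try lia.
rewrite (subnAC n l i); field.
by rewrite !factr_neq0.
Qed.

(** Induction on d: the increment of the right side is expanded in powers d^l, and the trinomial
    identity turns the coefficient of d^l into the Bernoulli recurrence of order m - l, which is 0
    unless l = m. *)
Lemma faulhaber m d :
  \sum_(0 <= v < d) v%:R ^+ m =
  m.+1%:R^-1 * \sum_(i < m.+1) 'C(m.+1, i)%:R * bernoulli i * d%:R ^+ (m.+1 - i).
Proof.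
elim: d => [|d IH].
  rewrite big_geq// big1 ?mulr0// => i _; rewrite expr0n subn_eq0.
  by rewrite leqNgt ltn_ord mulr0.
rewrite big_nat_recr//= {}IH.
have m0 : m.+1%:R != 0 :> rat by rewrite pnatr_eq0.
apply: (mulfI m0); rewrite mulrDr !mulVKf//.
apply/eqP; rewrite eq_sym addrC -subr_eq -sumrB; apply/eqP.
have step (i : 'I_m.+1) : 'C(m.+1, i)%:R * bernoulli i * d.+1%:R ^+ (m.+1 - i)
    - 'C(m.+1, i)%:R * bernoulli i * d%:R ^+ (m.+1 - i)
  = \sum_(l < m.+1) d%:R ^+ l * 'C(m.+1, l)%:R *
      (if (i < m.+1 - l)%N then 'C(m.+1 - l, i)%:R * bernoulli i else 0) :> rat.
  have pow n : d.+1%:R ^+ n - d%:R ^+ n = \sum_(l < n) 'C(n, l)%:R * d%:R ^+ l :> rat.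
    rewrite -natr1 (addrC d%:R) exprDn big_ord_recr /= binn mulr1n subnn mul1r.
    rewrite addrK; apply: eq_bigr => l _.
    by rewrite expr1n mul1r mulr_natl.
  rewrite -mulrBr pow mulr_sumr.
  rewrite (big_ord_widen m.+1 (fun l => 'C(m.+1, i)%:R * bernoulli i *
     ('C(m.+1 - i, l)%:R * d%:R ^+ l))) ?leq_subr// big_mkcond /=.
  apply: eq_bigr => l _; have -> : (i < m.+1 - l)%N = (l < m.+1 - i)%N by lia.
  case: ifP => h; last by rewrite mulr0.
  have tri : 'C(m.+1, i)%:R * 'C(m.+1 - i, l)%:R =
     'C(m.+1, l)%:R * 'C(m.+1 - l, i)%:R :> rat by apply: bin_trinomial; lia.
  transitivity ('C(m.+1, i)%:R * 'C(m.+1 - i, l)%:R * (bernoulli i * d%:R ^+ l)); first by ring.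
  by rewrite tri; ring.
rewrite (eq_bigr _ (fun i _ => step i)) exchange_big /=.
have inner l : (l <= m)%N -> \sum_(i < m.+1) (if (i < m.+1 - l)%N then
    'C(m.+1 - l, i)%:R * bernoulli i else 0) = (m == l)%:R :> rat.
  move=> lm; rewrite -big_mkcond /= subSn//.
  have h : (m - l < m.+1)%N by rewrite ltnS leq_subr.
  rewrite -(big_ord_widen _ (fun i => 'C((m - l).+1, i)%:R * bernoulli i) h).
  by rewrite bernoulli_rec subn_eq0 eqn_leq lm andbT.
rewrite big_ord_recr /= big1 ?add0r => [|l _].
  by rewrite -mulr_sumr inner// eqxx mulr1 binSn mulrC.
by rewrite -mulr_sumr inner ?(ltnW (ltn_ord l))// gtn_eqF ?mulr0.
Qed.

End Bernoulli.

(** * Liouville's identity and the convolution of Eisenstein series *)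

Lemma perm_divisors_compl n : (0 < n)%N ->
  perm_eq [seq (n %/ d)%N | d <- divisors n] (divisors n).
Proof.
move=> n0; apply: uniq_perm; [|exact: divisors_uniq|].
  rewrite map_inj_in_uniq ?divisors_uniq// => d e.
  rewrite -!dvdn_divisors// => dn en h.
  have d0 : (0 < d)%N := dvdn_gt0 n0 dn; have e0 : (0 < e)%N := dvdn_gt0 n0 en.
  have c0 : (0 < n %/ e)%N by rewrite divn_gt0// dvdn_leq.
  by apply/eqP; rewrite -(eqn_pmul2l c0) divnK// -h divnK.
move=> e; apply/mapP/idP => [[d]|]; rewrite -!dvdn_divisors//.
  by move=> dn ->; exact: dvdn_div.
move=> en; exists (n %/ e)%N; first by rewrite -dvdn_divisors// dvdn_div.
by rewrite divnA// mulKn.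
Qed.

Lemma sum_divisors_compl (V : nmodType) (F : nat -> V) n : (0 < n)%N ->
  \sum_(d <- divisors n) F (n %/ d)%N = \sum_(d <- divisors n) F d.
Proof.
by move=> n0; rewrite -[RHS](perm_big _ (perm_divisors_compl n0)) big_map.
Qed.

(** Trades the list of divisors for a range, so that divisor sums can be interchanged with sums over
    bounded indices. *)
Lemma sum_divisorsE (V : nmodType) (F : nat -> V) n N : (0 < n)%N -> (n <= N)%N ->
  \sum_(0 <= m < N.+1 | (0 < m)%N && (m %| n)%N) F m = \sum_(d <- divisors n) F d.
Proof.
move=> n0 nN; rewrite -big_filter; apply: perm_big; apply: uniq_perm.
- by rewrite filter_uniq// iota_uniq.
- exact: divisors_uniq.
move=> d; rewrite mem_filter -dvdn_divisors// mem_index_iota.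
apply/idP/idP => [/andP[/andP[]]//|dn].
by rewrite dn (dvdn_gt0 n0 dn) ltnS /= (leq_trans (dvdn_leq n0 dn)).
Qed.

(* the Eisenstein series normalised so that the coefficient of q is 1 *)
Definition gser (k : nat) : qseries := fun n =>
  if n == 0%N then - bernoulli k / (2 * k)%N%:R else (sigma k.-1 n)%:R.

Lemma sigma_le k n : (0 < n)%N -> (sigma k n <= n ^ k.+1)%N.
Proof.
move=> n0; rewrite /sigma expnS.
apply: (@leq_trans (\sum_(d <- divisors n) n ^ k)%N).
  rewrite big_seq [leqRHS]big_seq; apply: leq_sum => d.
  by rewrite -dvdn_divisors// => /(dvdn_leq n0) dn; case: (k) => // j; rewrite leq_exp2r.
rewrite -(sum_divisorsE (fun=> n ^ k)%N n0 (leqnn n)) big_mkcond big_nat_recl//=.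
apply: (@leq_trans (\sum_(0 <= m < n) n ^ k)%N).
  by apply: leq_sum => m _; case: ifP.
by rewrite sum_nat_const_nat subn0.
Qed.

Section Liouville.
Variable n : nat.
Local Notation T := (('I_n.+1 * 'I_n.+1) * ('I_n.+1 * 'I_n.+1))%type.
Implicit Types u : T.

Local Notation pa u := (u.1.1 : nat).
Local Notation pb u := (u.1.2 : nat).
Local Notation px u := (u.2.1 : nat).
Local Notation py u := (u.2.2 : nat).

(* the solutions of a x + b y = n in positive integers, as ((a, b), (x, y)) *)
Definition solution u : bool :=
  [&& (0 < pa u)%N, (0 < pb u)%N, (0 < px u)%N, (0 < py u)%N
    & (pa u * px u + pb u * py u == n)%N].

Lemma val_inord m : (inord m : 'I_n.+1) = (if (m < n.+1)%N then m else 0%N) :> nat.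
Proof. by rewrite /inord val_insubd. Qed.

Lemma solution_swap (F : nat -> nat -> nat -> nat -> rat) (P : nat -> nat -> nat -> nat -> bool) :
  \sum_(u : T | solution u && P (pa u) (pb u) (px u) (py u)) F (pa u) (pb u) (px u) (py u) =
  \sum_(u : T | solution u && P (pb u) (pa u) (py u) (px u)) F (pb u) (pa u) (py u) (px u).
Proof.
pose h u : T := ((u.1.2, u.1.1), (u.2.2, u.2.1)).
rewrite (reindex_onto h h) /=; last by case=> [[a b] [x y]].
apply: eq_bigl => -[[a b] [x y]]; rewrite /h /= eqxx andbT; congr andb.
rewrite /solution /= [(b * y + a * x)%N]addnC.
by case: (0 < a)%N; case: (0 < b)%N; case: (0 < x)%N; case: (0 < y)%N.
Qed.

(* the bijection (a, b, x, y) |-> (a - b, b, x, x + y) *)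
Lemma solution_shear (F : nat -> nat -> nat -> nat -> rat) :
  \sum_(u : T | solution u && (pb u < pa u)%N) F (pa u) (pb u) (px u) (py u) =
  \sum_(u : T | solution u && (px u < py u)%N)
    F (pa u + pb u)%N (pb u) (px u) (py u - px u)%N.
Proof.
pose h u : T := ((inord (pa u + pb u), u.1.2), (u.2.1, inord (py u - px u))).
pose h' u : T := ((inord (pa u - pb u), u.1.2), (u.2.1, inord (px u + py u))).
have valE (i j : 'I_n.+1) : (i == j) = (nat_of_ord i == j) by [].
rewrite (reindex_onto h h') /=; last first.
  case=> [[a b] [x y]]; rewrite /solution /= => /andP[/and5P[a0 b0 x0 y0 /eqP e] ba].
  rewrite /h /h' /=; have := ltn_ord a; have := ltn_ord b; have := ltn_ord x.
  move=> hx hb ha.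
  (* The image stays in the finite type: with b < a, x + y <= b (x + y) <= a x + b y = n. *)
  have h1 : (x + y < n.+1)%N.
    have l1 : (b * x <= a * x)%N by rewrite leq_mul2r (ltnW ba) orbT.
    have l2 : (x + y <= b * (x + y))%N by rewrite leq_pmull.
    by rewrite mulnDr in l2; lia.
  congr (_, _); congr (_, _); apply: ord_inj; rewrite !val_inord.
    by rewrite (leq_ltn_trans (leq_subr _ _) ha) subnK ?(ltnW ba)// ha.
  by rewrite h1 addKn ltn_ord.
apply: eq_big => -[[a b] [x y]] /=.
  rewrite /solution /h /h' /= !xpair_eqE !eqxx !andbT /= !valE !val_inord.
  have := ltn_ord a; have := ltn_ord b; have := ltn_ord x; have := ltn_ord y.
  move=> hy hx hb ha.
  have -> : (y - x < n.+1)%N by lia.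
  apply/idP/idP.
    case: ifP => h1; last by [].
    rewrite addnK ha eqxx /=.
    case/andP => /andP[/and5P[_ b0 x0 yx /eqP e] ba] /eqP.
    have xy : (x < y)%N by lia.
    rewrite subnKC ?(ltnW xy)// hy => _.
    apply/andP; split=> //; apply/and5P; split=> //; try lia.
  case/andP => /and5P[a0 b0 x0 y0 /eqP e] xy.
  have l1 : (a <= a * x)%N by rewrite leq_pmulr.
  have l2 : (b <= b * y)%N by rewrite leq_pmulr.
  have l3 : (b * x <= b * y)%N by rewrite leq_mul2l (ltnW xy) orbT.
  have h1 : (a + b < n.+1)%N by lia.
  rewrite h1 addnK ha eqxx /= subnKC ?(ltnW xy)// hy eqxx andbT.
  rewrite mulnBr mulnDl; lia.
case/andP => /andP[/and5P[]]; rewrite /h /= !val_inord; case: ifP => // _ _ _ _ _ _ _ _.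
by rewrite ifT// (leq_ltn_trans (leq_subr _ _)).
Qed.

Lemma solution_split (F : T -> rat) (p q : T -> nat) :
  \sum_(u : T | solution u) F u =
  \sum_(u : T | solution u && (p u < q u)%N) F u
  + \sum_(u : T | solution u && (p u == q u)) F u
  + \sum_(u : T | solution u && (q u < p u)%N) F u.
Proof.
rewrite (bigID (fun u => p u < q u)%N) /= -addrA; congr (_ + _).
rewrite (bigID (fun u => p u == q u)%N) /=; congr (_ + _); apply: eq_bigl => u;
  rewrite -andbA; congr andb; lia.
Qed.

(** Let S1 and S2 be the sums of f(a) over x < y and over b < a. The shear turns the sum of f(|a -
    b|) into 2 S1, the terms a = b vanishing with f(0), and the sum of f(a + b) into 2 S2 plus the
    diagonal x = y. Splitting the sum of f(a) once by x against y and once by a against b computes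
    S1 - S2: the parts y < x and a < b agree because the shear preserves b. *)
Lemma liouville_quadruples (f : nat -> rat) : f 0%N = 0 ->
  \sum_(u : T | solution u) (f ((pa u - pb u) + (pb u - pa u))%N - f (pa u + pb u)%N) =
  (\sum_(u : T | solution u && (pa u == pb u)) f (pa u)
   - \sum_(u : T | solution u && (px u == py u)) f (pa u)) *+ 2
  - \sum_(u : T | solution u && (px u == py u)) f (pa u + pb u)%N.
Proof.
move=> f0; rewrite sumrB.
pose S1 := \sum_(u : T | solution u && (px u < py u)%N) f (pa u).
pose S2 := \sum_(u : T | solution u && (pb u < pa u)%N) f (pa u).
have e1 : \sum_(u : T | solution u) f ((pa u - pb u) + (pb u - pa u))%N = S1 *+ 2.
  rewrite (solution_split _ (fun u => pa u) (fun u => pb u)) addrAC.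
  rewrite [X in _ + X]big1 ?addr0; last by move=> u /andP[_ /eqP ->]; rewrite subnn.
  rewrite (solution_swap (fun a b _ _ => f ((a - b) + (b - a))%N) (fun a b _ _ => (a < b)%N)).
  have -> : \sum_(u : T | solution u && (pb u < pa u)%N) f ((pb u - pa u) + (pa u - pb u))%N = S1.
    rewrite (solution_shear (fun a b _ _ => f ((b - a) + (a - b))%N)).
    by apply: eq_bigr => u _; congr f; lia.
  have -> : \sum_(u : T | solution u && (pb u < pa u)%N) f ((pa u - pb u) + (pb u - pa u))%N = S1.
    rewrite (solution_shear (fun a b _ _ => f ((a - b) + (b - a))%N)).
    by apply: eq_bigr => u _; congr f; lia.
  by rewrite mulr2n.
have e2 : \sum_(u : T | solution u) f (pa u + pb u)%N =
    S2 *+ 2 + \sum_(u : T | solution u && (px u == py u)) f (pa u + pb u)%N.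
  rewrite (solution_split _ (fun u => px u) (fun u => py u)) addrAC; congr (_ + _).
  rewrite (solution_swap (fun a b _ _ => f (a + b)%N) (fun _ _ x y => (y < x)%N)).
  have h : \sum_(u : T | solution u && (px u < py u)%N) f (pa u + pb u)%N = S2.
    by rewrite /S2 (solution_shear (fun a b _ _ => f a)).
  have h' : \sum_(u : T | solution u && (px u < py u)%N) f (pb u + pa u)%N = S2.
    by rewrite -h; apply: eq_bigr => u _; rewrite addnC.
  by rewrite h h' mulr2n.
have e3 : S1 - S2 = \sum_(u : T | solution u && (pa u == pb u)) f (pa u)
   - \sum_(u : T | solution u && (px u == py u)) f (pa u).
  have h1 := solution_split (fun u => f (pa u)) (fun u => px u) (fun u => py u).
  have h2 := solution_split (fun u => f (pa u)) (fun u => pb u) (fun u => pa u).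
  have h3 : \sum_(u : T | solution u && (py u < px u)%N) f (pa u) =
     \sum_(u : T | solution u && (pa u < pb u)%N) f (pa u).
    rewrite (solution_swap (fun a _ _ _ => f a) (fun _ _ x y => (y < x)%N)).
    rewrite (solution_swap (fun a _ _ _ => f a) (fun a b _ _ => (a < b)%N)).
    by rewrite (solution_shear (fun _ b _ _ => f b)).
  have h4 : \sum_(u : T | solution u && (pb u == pa u)) f (pa u) =
     \sum_(u : T | solution u && (pa u == pb u)) f (pa u).
    by apply: eq_bigl => u; rewrite eq_sym.
  rewrite h1 h3 -/S1 h4 -/S2 in h2.
  move: h2; set A := \sum_(u : T | _) _; set B := \sum_(u : T | _) _.
  set D := \sum_(u : T | _ && (_ == _)) _ => h2.
  lra.
transitivity (S1 *+ 2 - (S2 *+ 2 +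
    \sum_(u : T | solution u && (px u == py u)) f (pa u + pb u)%N)).
  by congr (_ - _).
by rewrite -e3; ring.
Qed.

Lemma solution_transpose (F : nat -> nat -> nat -> nat -> rat)
    (P : nat -> nat -> nat -> nat -> bool) :
  \sum_(u : T | solution u && P (pa u) (pb u) (px u) (py u)) F (pa u) (pb u) (px u) (py u) =
  \sum_(u : T | solution u && P (px u) (py u) (pa u) (pb u)) F (px u) (py u) (pa u) (pb u).
Proof.
pose h u : T := (u.2, u.1).
rewrite (reindex_onto h h) /=; last by case=> [[a b] [x y]].
apply: eq_bigl => -[[a b] [x y]]; rewrite /h /= eqxx andbT; congr andb.
rewrite /solution /= (mulnC x a) (mulnC y b).
by case: (0 < a)%N; case: (0 < b)%N; case: (0 < x)%N; case: (0 < y)%N.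
Qed.

(** On x = y the equation reads (a + b) x = n: d = a + b is a divisor of n, and v = a runs over 1,
    ..., d - 1. *)
Lemma solution_diag (H : nat -> nat -> nat -> rat) : (0 < n)%N ->
  \sum_(u : T | solution u && (px u == py u)) H (pa u) (pb u) (px u) =
  \sum_(d <- divisors n) \sum_(1 <= v < d) H v (d - v)%N (n %/ d)%N.
Proof.
move=> n0.
rewrite -(sum_divisors_compl _ n0) -(sum_divisorsE _ n0 (leqnn n)) big_mkord.
transitivity (\sum_(x < n.+1) \sum_(a < n.+1) \sum_(b < n.+1)
    (if [&& (0 < a)%N, (0 < b)%N, (0 < x)%N & (a * x + b * x == n)%N]
     then H a b x else 0)).
  rewrite big_mkcond /=.
  rewrite -(pair_bigA _ (fun p q : 'I_n.+1 * 'I_n.+1 =>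
    if solution (p, q) && (px (p, q) == py (p, q)) then H (pa (p, q)) (pb (p, q)) (px (p, q)) else 0)) /=.
  rewrite -(pair_bigA _ (fun a b : 'I_n.+1 => \sum_(q : 'I_n.+1 * 'I_n.+1)
    if solution ((a, b), q) && (q.1 == q.2 :> nat) then H a b q.1 else 0)) /=.
  rewrite [RHS]exchange_big /=; apply: eq_bigr => a _.
  rewrite [RHS]exchange_big /=; apply: eq_bigr => b _.
  rewrite -(pair_bigA _ (fun x y : 'I_n.+1 =>
    if solution ((a, b), (x, y)) && (x == y :> nat) then H a b x else 0)) /=.
  apply: eq_bigr => x _; rewrite -big_mkcond /=.
  pose P (y : nat) := [&& (0 < a)%N, (0 < b)%N, (0 < x)%N & (a * x + b * y == n)%N].
  rewrite (eq_bigl (fun y : 'I_n.+1 => P y && (y == x :> nat))).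
    by rewrite (big_ord1_cond_eq _ (fun=> H a b x)) ltn_ord.
  move=> y; rewrite /solution /P /= (eq_sym (y : nat)).
  case: (@eqP _ (x : nat) (y : nat)) => [<-|_]; last by rewrite !andbF.
  by case: (0 < a)%N; case: (0 < b)%N; case: (0 < x)%N.
rewrite [RHS]big_mkcond /=; apply: eq_bigr => x _.
case: ifP => [/andP[x0 xn]|hx]; last first.
  rewrite big1 // => a _; rewrite big1 // => b _; case: ifP => // /and4P[_ _ x0 /eqP e].
  have xn : (x %| n)%N by rewrite -[X in (_ %| X)%N]e -mulnDl dvdn_mull.
  by rewrite x0 xn in hx.
have dx : (n %/ (n %/ x))%N = x by rewrite divnA// mulKn.
rewrite dx; set d := (n %/ x)%N; have dn : (d * x = n)%N by rewrite divnK.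
have dN : (d <= n.+1)%N by rewrite (leq_trans (leq_div _ _)).
rewrite big_geq_mkord (big_ord_widen_cond _ _ (fun v => H v (d - v)%N x) dN) [RHS]big_mkcond /=.
apply: eq_bigr => a _; rewrite -big_mkcond /=.
rewrite (eq_bigl (fun b : 'I_n.+1 => ((0 < a)%N && (0 < b)%N) && (b == (d - a)%N :> nat))).
  rewrite (big_ord1_cond_eq _ (fun b => H a b x) (fun b => (0 < a)%N && (0 < b)%N)).
  rewrite (leq_ltn_trans (leq_subr _ _)) /=; last by rewrite ltnS leq_div.
  by rewrite subn_gt0.
move=> b; rewrite x0 /= -mulnDl -[X in _ == X]dn eqn_pmul2r//.
by case: (0 < a)%N => //=; case: posnP => //= b0; lia.
Qed.

(** The value 0 at 0 makes a convolution over 0 <= m <= n count positive solutions only; the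
    constant terms of the [gser] are restored later. *)
Definition divsum (f : nat -> rat) (m : nat) : rat :=
  if m == 0%N then 0 else \sum_(d <- divisors m) f d.

Lemma divsum_pairs f m : (m <= n)%N ->
  divsum f m = \sum_(p : 'I_n.+1 * 'I_n.+1 |
    [&& (0 < p.1)%N, (0 < p.2)%N & (p.1 * p.2 == m)%N]) f p.1.
Proof.
move=> mn; rewrite /divsum [RHS]big_mkcond /=.
rewrite -(pair_bigA _ (fun a x : 'I_n.+1 =>
   if [&& (0 < a)%N, (0 < x)%N & (a * x == m)%N] then f a else 0)) /=.
case: posnP => [->|m0].
  rewrite big1 // => a _; rewrite big1 // => x _.
  by case: ifP => // /and3P[a0 x0]; rewrite muln_eq0 -!leqn0 leqNgt a0 leqNgt x0.
rewrite -(sum_divisorsE _ m0 mn) big_mkord big_mkcond /=; apply: eq_bigr => a _.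
rewrite -big_mkcond /=; case: ifP => [/andP[a0 am]|h].
  rewrite (eq_bigl (fun x : 'I_n.+1 => (0 < x)%N && (x == (m %/ a)%N :> nat))).
    rewrite (big_ord1_cond_eq _ (fun=> f a) (fun x => 0 < x)%N).
    by rewrite ltnS (leq_trans (leq_div _ _) mn) divn_gt0// dvdn_leq.
  move=> x; rewrite a0 /=; congr andb.
  by rewrite -[in LHS](divnK am) mulnC eqn_pmul2r.
rewrite big1 // => x /and3P[a0 x0 /eqP e].
by move: h; rewrite a0 -e dvdn_mulr.
Qed.

(** The solutions are grouped by m = a x, so that b y = n - m. *)
Lemma solution_conv (f g : nat -> rat) :
  \sum_(u : T | solution u) f (pa u) * g (pb u) =
  \sum_(m < n.+1) divsum f m * divsum g (n - m).
Proof.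
rewrite (partition_big (fun u => inord (pa u * px u) : 'I_n.+1) xpredT) //=.
apply: eq_bigr => m _; have mn : (m <= n)%N by rewrite -ltnS.
rewrite (divsum_pairs _ mn) (divsum_pairs _ (leq_subr m n)).
rewrite big_distrlr /= pair_big /=.
pose h u : T := ((u.1.1, u.2.1), (u.1.2, u.2.2)).
rewrite (reindex_onto h h) /=; last by case=> [[a b] [x y]].
apply: eq_bigl => -[[a x] [b y]]; rewrite /h /= eqxx andbT.
have valE (i j : 'I_n.+1) : (i == j) = (nat_of_ord i == j) by [].
rewrite /solution /= valE val_inord.
case: (posnP a) => [->|a0]; rewrite ?andbF//=.
case: (posnP b) => [->|b0]; rewrite ?andbF//=.
case: (posnP x) => [->|x0]; rewrite ?andbF//=.
case: (posnP y) => [->|y0]; rewrite ?andbF//=.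
by case: ifP => h1; lia.
Qed.

End Liouville.

(** * From divisor sums to a quadratic relation between Eisenstein series *)

Section Convolution.

Lemma natr_exp_absdiff (m a b : nat) : ~~ odd m ->
  ((a - b) + (b - a))%N%:R ^+ m = (a%:R - b%:R) ^+ m :> rat.
Proof.
move=> em; have sq (x : rat) : x ^+ m = (x ^+ 2) ^+ m./2.
  by rewrite -exprM mul2n -[in LHS](odd_double_half m) (negPf em).
rewrite sq [RHS]sq; congr (_ ^+ _); case: (leqP a b) => ab.
  have -> : (a - b)%N = 0%N by lia.
  by rewrite add0n natrB// -sqrrN opprB.
have -> : (b - a)%N = 0%N by lia.
by rewrite addn0 natrB// ltnW.
Qed.

(** Only odd i survive, so that both weights i + 1 and m - i + 1 in the convolution are even. *)
Lemma even_binomial_diff m (x y : rat) : ~~ odd m ->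
  (x - y) ^+ m - (x + y) ^+ m =
  - 2 * \sum_(i < m.+1 | odd i) 'C(m, i)%:R * (x ^+ (m - i) * y ^+ i).
Proof.
move=> em; rewrite exprBn exprDn -sumrB mulr_sumr [RHS]big_mkcond /=.
apply: eq_bigr => i _; rewrite -mulrnBl -mulr_natl -signr_odd.
by case: (odd i); rewrite ?expr0 ?expr1; ring.
Qed.

Lemma sigma_natr k n : (sigma k n)%:R = \sum_(d <- divisors n) d%:R ^+ k :> rat.
Proof. by rewrite /sigma natr_sum; apply: eq_bigr => d _; rewrite natrX. Qed.

Definition powr_nat (k : nat) : nat -> rat := fun d => d%:R ^+ k.

Lemma divsumE k n : divsum (powr_nat k) n = (if n == 0%N then 0 else (sigma k n)%:R).
Proof. by rewrite /divsum sigma_natr. Qed.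

Lemma bernoulli_sum_odd m (F : nat -> rat) : ~~ odd m -> (0 < m)%N ->
  \sum_(i < m.+1) bernoulli i * F i =
  F 0%N - F 1%N / 2 + \sum_(i < m.+1 | odd i) bernoulli i.+1 * F i.+1.
Proof.
case: m => // p em _.
have -> : \sum_(i < p.+2 | odd i) bernoulli i.+1 * F i.+1 =
    \sum_(i < p) if odd i.+1 then bernoulli i.+2 * F i.+2 else 0.
  have op : odd p by move: em; rewrite /= negbK.
  by rewrite big_mkcond big_ord_recr /= op addr0 big_ord_recl /= add0r.
rewrite 2!big_ord_recl /= bernoulli0 bernoulli1 mul1r mulNr mul1r addrA.
rewrite [2^-1 * _]mulrC; congr (_ + _); apply: eq_bigr => i _.
rewrite -[bump 0 (bump 0 i)]/i.+2; case: ifP => // oi.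
by move: oi; case: (i : nat) => // j /= oj; rewrite bernoulli_odd ?mul0r//= oj.
Qed.

(** Liouville's identity for f(d) = d^m. Expanding (a - b)^m - (a + b)^m produces the convolutions;
    the diagonal a = b gives n sigma_(m-1)(n) - sigma_m(n); the diagonal x = y gives power sums over
    v < d, and Faulhaber's formula brings in the Bernoulli numbers. *)
Lemma sigma_convolution m n : ~~ odd m -> (0 < m)%N -> (0 < n)%N ->
  \sum_(i < m.+1 | odd i) 'C(m, i)%:R *
    \sum_(t < n.+1) divsum (powr_nat (m - i)) t * divsum (powr_nat i) (n - t) =
  - (n%:R * (sigma m.-1 n)%:R) + (m + 3)%N%:R / (2 * m.+1%:R) * (sigma m.+1 n)%:R
  + m.+1%:R^-1 * \sum_(i < m.+1 | odd i) 'C(m.+1, i.+1)%:R * bernoulli i.+1 * (sigma (m - i) n)%:R :> rat.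
Proof.
move=> em m0 n0.
have m1 : m.+1%:R != 0 :> rat by rewrite pnatr_eq0.
have L := @liouville_quadruples n (powr_nat m).
rewrite {1}/powr_nat expr0n (gtn_eqF m0) in L; have {L} := L erefl.
set lhs := \sum_(u | _) _.
have -> : lhs = - 2 * \sum_(i < m.+1 | odd i) 'C(m, i)%:R *
    \sum_(t < n.+1) divsum (powr_nat (m - i)) t * divsum (powr_nat i) (n - t).
  transitivity (- 2 * \sum_(i < m.+1 | odd i) 'C(m, i)%:R *
     \sum_(u | solution u) powr_nat (m - i) (u.1.1 : 'I_n.+1) * powr_nat i (u.1.2 : 'I_n.+1)).
    rewrite mulr_sumr; under eq_bigr do rewrite mulr_sumr mulr_sumr.
    rewrite exchange_big /=; apply: eq_bigr => u _.
    rewrite /powr_nat natr_exp_absdiff// natrD even_binomial_diff// mulr_sumr.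
    by [].
  by congr (_ * _); apply: eq_bigr => i _; rewrite solution_conv.
have -> : \sum_(u | solution u && ((u.1.1 : 'I_n.+1) == (u.1.2 : 'I_n.+1) :> nat)) powr_nat m (u.1.1 : 'I_n.+1)
   = \sum_(d <- divisors n) ((n %/ d)%N%:R - 1) * d%:R ^+ m.
  rewrite (@solution_transpose n (fun a _ _ _ => powr_nat m a) (fun a b _ _ => a == b)).
  rewrite (@solution_diag n (fun _ _ x => powr_nat m x))//.
  rewrite -[RHS](sum_divisors_compl _ n0) big_seq [RHS]big_seq; apply: eq_bigr => d.
  rewrite -dvdn_divisors// => dn; have d0 := dvdn_gt0 n0 dn.
  by rewrite sumr_const_nat -[LHS]mulr_natl natrB// divnA// mulKn.
have -> : \sum_(u | solution u && ((u.2.1 : 'I_n.+1) == (u.2.2 : 'I_n.+1) :> nat)) powr_nat m (u.1.1 : 'I_n.+1)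
   = \sum_(d <- divisors n) \sum_(1 <= v < d) v%:R ^+ m.
  by rewrite (@solution_diag n (fun a _ _ => powr_nat m a)).
have -> : \sum_(u | solution u && ((u.2.1 : 'I_n.+1) == (u.2.2 : 'I_n.+1) :> nat))
     powr_nat m ((u.1.1 : 'I_n.+1) + (u.1.2 : 'I_n.+1))%N
   = \sum_(d <- divisors n) (d%:R - 1) * d%:R ^+ m.
  rewrite (@solution_diag n (fun a b _ => powr_nat m (a + b)%N))//.
  rewrite big_seq [RHS]big_seq; apply: eq_bigr => d.
  rewrite -dvdn_divisors// => dn; have d0 := dvdn_gt0 n0 dn.
  rewrite (eq_big_nat _ _ (F2 := fun=> d%:R ^+ m)).
    by rewrite sumr_const_nat -[LHS]mulr_natl natrB.
  by move=> v /andP[_ vd]; rewrite /powr_nat subnKC// ltnW.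
set Sc := \sum_(i < m.+1 | odd i) _ => h.
have -> : Sc = - (1/2) * (- 2 * Sc) by field.
rewrite h {h}.
have fa d : \sum_(1 <= v < d.+1) v%:R ^+ m =
   d.+1%:R ^+ m.+1 / m.+1%:R - d.+1%:R ^+ m / 2 +
   m.+1%:R^-1 * \sum_(i < m.+1 | odd i) 'C(m.+1, i.+1)%:R * bernoulli i.+1 * d.+1%:R ^+ (m - i) :> rat.
  have := faulhaber m d.+1; rewrite big_ltn// expr0n (gtn_eqF m0) add0r.
  rewrite -[0.+1]/1%N => ->.
  rewrite (eq_bigr (fun i : 'I_m.+1 => bernoulli i * ('C(m.+1, i)%:R * d.+1%:R ^+ (m.+1 - i)))); last first.
    by move=> i _; ring.
  rewrite (bernoulli_sum_odd (fun i => 'C(m.+1, i)%:R * d.+1%:R ^+ (m.+1 - i)) em m0).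
  rewrite bin0 bin1 subn0 subn1 mulrDr /=; congr (_ + _); first by field.
  by congr (_ * _); apply: eq_bigr => i _; rewrite subSS; ring.
have eA : \sum_(d <- divisors n) ((n %/ d)%N%:R - 1) * d%:R ^+ m =
    n%:R * (sigma m.-1 n)%:R - (sigma m n)%:R :> rat.
  rewrite !sigma_natr mulr_sumr -sumrB big_seq [RHS]big_seq; apply: eq_bigr => d.
  rewrite -dvdn_divisors// => dn; rewrite mulrBl mul1r; congr (_ - _).
  by rewrite -[in RHS](divnK dn) natrM -mulrA -exprS prednK.
have eC : \sum_(d <- divisors n) (d%:R - 1) * d%:R ^+ m =
    (sigma m.+1 n)%:R - (sigma m n)%:R :> rat.
  rewrite !sigma_natr -sumrB; apply: eq_bigr => d _.
  by rewrite mulrBl mul1r -exprS.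
have eB : \sum_(d <- divisors n) \sum_(1 <= v < d) v%:R ^+ m =
    (sigma m.+1 n)%:R / m.+1%:R - (sigma m n)%:R / 2 +
    m.+1%:R^-1 * \sum_(i < m.+1 | odd i) 'C(m.+1, i.+1)%:R * bernoulli i.+1 * (sigma (m - i) n)%:R :> rat.
  rewrite !sigma_natr !mulr_suml -sumrB.
  under [X in _ = _ + _ * X]eq_bigr do rewrite sigma_natr mulr_sumr.
  rewrite exchange_big /= mulr_sumr -big_split big_seq [RHS]big_seq /=.
  apply: eq_bigr => d; rewrite -dvdn_divisors// => dn.
  by have := dvdn_gt0 n0 dn; case: (d) => // e _; rewrite fa.
rewrite eA eB eC natrD -(natr1 m).
rewrite -(natr1 m) in m1.
by field; rewrite m1.
Qed.

(** Euler's relation of order m + 2: the end terms contribute 2 B_(m+2), and B_(m+1) = 0 since m + 1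
    is odd and at least 3. *)
Lemma bernoulli_convolution m : ~~ odd m -> (0 < m)%N ->
  \sum_(i < m.+1 | odd i) 'C(m.+2, i.+1)%:R * (bernoulli i.+1 * bernoulli (m - i).+1) =
  - ((m + 3)%N%:R * bernoulli m.+2).
Proof.
move=> em m0; have em2 : ~~ odd m.+2 by rewrite /= negbK.
have := bernoulli_euler (ltn0Sn m.+1).
rewrite (eq_bigr (fun j : 'I_m.+3 => bernoulli j * ('C(m.+2, j)%:R * bernoulli (m.+2 - j)))); last first.
  by move=> j _; ring.
rewrite (bernoulli_sum_odd (fun j => 'C(m.+2, j)%:R * bernoulli (m.+2 - j)) em2)//.
rewrite subn0 subn1 /= (@bernoulli_odd m.+1)//; last by lia.
rewrite big_mkcond 2!big_ord_recr /= negbK em (negPf em) subnn binn bernoulli0 bin0 => h.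
rewrite big_mkcond /= (eq_bigr (fun i : 'I_m.+1 => if odd i then
  bernoulli i.+1 * ('C(m.+2, i.+1)%:R * bernoulli (m.+2 - i.+1)) else 0)); last first.
  move=> i _; have im : (i <= m)%N by rewrite -ltnS.
  by rewrite subSS (subSn im); case: ifP => // _; ring.
move: h; set S := \sum_(_ < _) _; rewrite natrD -[m.+2]addn2 natrD => h.
by move: h; move: (bernoulli _) (m%:R) => b y h; lra.
Qed.

Lemma gser_split k : gser k.+1 =
  (divsum (powr_nat k) : fps) + fpsC (- bernoulli k.+1 / (2 * k.+1)%N%:R).
Proof.
apply/funext => n; rewrite fpsE /gser /fpsC divsumE.
by case: eqP; rewrite ?add0r ?addr0.
Qed.

(** For n > 0 the products with the constant terms -B_k/(2k) cancel the Bernoulli sum of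
    [sigma_convolution] exactly; for n = 0 the claim is Euler's relation. *)
Lemma eisenstein_convolution m n : ~~ odd m -> (0 < m)%N ->
  \sum_(i < m.+1 | odd i) 'C(m, i)%:R * qmul (gser (m - i).+1) (gser i.+1) n =
  - (n%:R * gser m n) + (m + 3)%N%:R / (2 * m.+1%:R) * gser m.+2 n.
Proof.
move=> em m0; have m1 : m.+1%:R != 0 :> rat by rewrite pnatr_eq0.
have m2 : m.+2%:R != 0 :> rat by rewrite pnatr_eq0.
have [->|] := posnP n.
  rewrite mul0r oppr0 add0r /gser /=.
  transitivity ((4 * (m.+1%:R * m.+2%:R))^-1 *
    \sum_(i < m.+1 | odd i) 'C(m.+2, i.+1)%:R * (bernoulli i.+1 * bernoulli (m - i).+1)).
    rewrite mulr_sumr; apply: eq_bigr => i _; have im : (i <= m)%N by rewrite -ltnS.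
    rewrite /qmul big_ord1 /= /gser /= !natrM.
    have i1 : i.+1%:R != 0 :> rat by rewrite pnatr_eq0.
    have mi1 : (m - i).+1%:R != 0 :> rat by rewrite pnatr_eq0.
    have -> : 'C(m, i)%:R = 'C(m.+2, i.+1)%:R * (i.+1%:R * (m - i).+1%:R) / (m.+1%:R * m.+2%:R) :> rat.
      rewrite !binr_fact ?subSS; try lia.
      rewrite subSn// !factS !natrM.
      move: (factr_neq0 i) (factr_neq0 (m - i)) (factr_neq0 m) m1 m2 i1 mi1.
      move: (i`!%:R) ((m - i)`!%:R) (m`!%:R) (m.+2%:R) (m.+1%:R) (i.+1%:R) ((m - i).+1%:R).
      by move=> x1 x2 x3 x4 x5 x6 x7 *; field; do ?[apply/andP; split].
    move: m1 m2 i1 mi1; move: (m.+2%:R) (m.+1%:R) (i.+1%:R) ((m - i).+1%:R).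
    by move=> x4 x5 x6 x7 *; field; do ?[apply/andP; split].
  rewrite bernoulli_convolution// natrM.
  move: m1 m2; move: (m.+2%:R) (m.+1%:R) => x y *.
  by field; do ?[apply/andP; split].
move=> n0.
pose c k : rat := - bernoulli k.+1 / (2 * k.+1)%N%:R.
have nn : (n == 0%N) = false by rewrite gtn_eqF.
have qm i : qmul (gser (m - i).+1) (gser i.+1) n =
    \sum_(t < n.+1) divsum (powr_nat (m - i)) t * divsum (powr_nat i) (n - t)
    + (c (m - i)%N * (sigma i n)%:R + c i * (sigma (m - i) n)%:R).
  rewrite !gser_split -/(c _) -/(c i).
  set f : fps := divsum _; set g : fps := divsum _.
  have -> : qmul (f + fpsC (c (m - i)%N) : fps) (g + fpsC (c i) : fps) =
      f * g + (fpsC (c (m - i)%N) * (g + fpsC (c i)) + fpsC (c i) * f) :> fps.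
    by rewrite -[LHS]/((f + fpsC (c (m - i)%N)) * (g + fpsC (c i)) : fps); ring.
  rewrite fpsE [in LHS]fpsE !fpsCM fpsE /fpsC nn addr0 /f /g !divsumE nn.
  by [].
under eq_bigr do rewrite qm mulrDr mulrDr.
rewrite big_split /= sigma_convolution// big_split /=.
(* The contributions of the two constant terms are exchanged by i -> m - i, which preserves odd i as
   m is even. *)
have -> : \sum_(i < m.+1 | odd i) 'C(m, i)%:R * (c (m - i)%N * (sigma i n)%:R) =
    \sum_(i < m.+1 | odd i) 'C(m, i)%:R * (c i * (sigma (m - i) n)%:R).
  rewrite (reindex_inj rev_ord_inj) /=; apply: eq_big => i; have im : (i <= m)%N by rewrite -ltnS.
    by rewrite subSS oddB// (negPf em).
  by move=> _; rewrite subSS bin_sub// subKn.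
rewrite -big_split /=.
have -> : \sum_(i < m.+1 | odd i) ('C(m, i)%:R * (c i * (sigma (m - i) n)%:R) +
       'C(m, i)%:R * (c i * (sigma (m - i) n)%:R)) =
   - (m.+1%:R^-1 * \sum_(i < m.+1 | odd i) 'C(m.+1, i.+1)%:R * bernoulli i.+1 * (sigma (m - i) n)%:R).
  rewrite mulr_sumr -sumrN; apply: eq_bigr => i _.
  have i1 : i.+1%:R != 0 :> rat by rewrite pnatr_eq0.
  have -> : 'C(m.+1, i.+1)%:R = m.+1%:R * 'C(m, i)%:R / i.+1%:R :> rat.
    by rewrite -natrM mul_bin_diag natrM mulrC mulKf.
  rewrite /c natrM; move: i1 m1; move: (m.+1%:R) (i.+1%:R) => x y *.
  by field; do ?[apply/andP; split].
by rewrite /gser nn /= addrK.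
Qed.

End Convolution.

(** * Complex limits and the exponential *)

Section ComplexLimits.
Variable R : realType.
Local Notation K := (C R).
Local Notation nm := (@ComplexField.Normc.normc R).
Implicit Types (z w : K) (u v : nat -> K).

Lemma normCE z : `|z| = (nm z)%:C%C.
Proof. by []. Qed.

Lemma nm_ge0 z : 0 <= nm z.
Proof. by case: z => a b /=; exact: sqrtr_ge0. Qed.

Lemma nmD z w : nm (z + w) <= nm z + nm w.
Proof. exact: le_normcD. Qed.

Lemma nmN z : nm (- z) = nm z.
Proof. exact: normcN. Qed.

Lemma nmM z w : nm (z * w) = nm z * nm w.
Proof. exact: ComplexField.Normc.normcM. Qed.

Lemma nmV z : nm z^-1 = (nm z)^-1.
Proof. exact: ComplexField.Normc.normcV. Qed.

Lemma nm0 : nm 0 = 0.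
Proof. exact: ComplexField.Normc.normc0. Qed.

Lemma nm1 : nm 1 = 1.
Proof. exact: ComplexField.Normc.normc1. Qed.

Lemma nm_eq0 z : (nm z == 0) = (z == 0).
Proof.
by apply/eqP/eqP => [/ComplexField.Normc.eq0_normc//|->]; rewrite nm0.
Qed.

Lemma nm_gt0 z : (0 < nm z) = (z != 0).
Proof. by rewrite lt_def nm_ge0 nm_eq0 andbT. Qed.

Lemma nmX z n : nm (z ^+ n) = nm z ^+ n.
Proof. by elim: n => [|n IH]; rewrite ?expr0 ?nm1// !exprS nmM IH. Qed.

(* [real_complex R] retyped, so that it lands in the field [C R] *)
Definition toC (x : R) : K := x%:C%C.

Lemma toC_is_zmod_morphism : zmod_morphism toC.
Proof. exact: (rmorphB (real_complex R)). Qed.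

Lemma toC_is_monoid_morphism : monoid_morphism toC.
Proof. by split; [exact: (rmorph1 (real_complex R))|exact: (rmorphM (real_complex R))]. Qed.

HB.instance Definition _ := GRing.isZmodMorphism.Build R K toC toC_is_zmod_morphism.
HB.instance Definition _ := GRing.isMonoidMorphism.Build R K toC toC_is_monoid_morphism.

Lemma nmR (x : R) : nm (toC x) = `|x|.
Proof. by rewrite /= expr0n addr0 sqrtr_sqr. Qed.

Lemma nm_nat n : nm n%:R = n%:R.
Proof.
by rewrite -(rmorph_nat toC n) nmR ger0_norm.
Qed.

Lemma nm_sum (I : Type) (r : seq I) (P : pred I) (F : I -> K) :
  nm (\sum_(i <- r | P i) F i) <= \sum_(i <- r | P i) nm (F i).
Proof.
elim/big_rec2: _ => [|i y x _ h]; first by rewrite nm0.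
by rewrite (le_trans (nmD _ _))// lerD2l.
Qed.

Lemma nm_leD z w : nm z - nm w <= nm (z + w).
Proof.
by have := nmD (z + w) (- w); rewrite addrK nmN lerBlDr.
Qed.

Lemma ReCD z w : complex.Re (z + w) = complex.Re z + complex.Re w.
Proof. by case: z w => a b [c d]. Qed.

Lemma ImCD z w : complex.Im (z + w) = complex.Im z + complex.Im w.
Proof. by case: z w => a b [c d]. Qed.

Lemma ReCM z w : complex.Re (z * w) =
  complex.Re z * complex.Re w - complex.Im z * complex.Im w.
Proof. by case: z w => a b [c d]. Qed.

Lemma ImCM z w : complex.Im (z * w) =
  complex.Re z * complex.Im w + complex.Im z * complex.Re w.
Proof. by case: z w => a b [c d]. Qed.

Lemma ReCN z : complex.Re (- z) = - complex.Re z.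
Proof. by case: z. Qed.

Lemma ImCN z : complex.Im (- z) = - complex.Im z.
Proof. by case: z. Qed.

Lemma Re_le_nm z : `|complex.Re z| <= nm z.
Proof.
case: z => a b /=; rewrite -sqrtr_sqr ler_wsqrtr// lerDl; exact: sqr_ge0.
Qed.

Lemma Im_le_nm z : `|complex.Im z| <= nm z.
Proof.
case: z => a b /=; rewrite -sqrtr_sqr ler_wsqrtr// lerDr; exact: sqr_ge0.
Qed.

Lemma nm_le_ReIm z : nm z <= `|complex.Re z| + `|complex.Im z|.
Proof.
have -> : z = toC (complex.Re z) + ('i%C : K) * toC (complex.Im z).
  exact: complexE.
rewrite (le_trans (nmD _ _))// nmM !nmR ReCD ImCD ReCM ImCM /=.
rewrite expr0n expr1n add0r sqrtr1 !(mul1r, mul0r, mulr0, addr0, subr0, add0r).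
by [].
Qed.

Lemma sqr_nm z : nm z ^+ 2 = complex.Re z ^+ 2 + complex.Im z ^+ 2.
Proof. by case: z => a b /=; rewrite sqr_sqrtr// addr_ge0// sqr_ge0. Qed.

(** The norm on [C R] has values in [C R]; this passes to the real modulus, with which all estimates
    below are made. *)
Lemma cvgC_nm u z :
  u @ \oo --> z <-> (fun n => nm (u n - z)) @ \oo --> (0 : R).
Proof.
split.
  move=> /cvgrPdist_lt h; apply/cvgrPdist_lt => e e0.
  have e0' : 0 < (e%:C%C : K) by rewrite ltcR.
  near=> n; rewrite sub0r normrN ger0_norm ?nm_ge0//.
  rewrite -ltcR -normCE distrC; near: n; exact: h.
move=> /cvgrPdist_lt h; apply/cvgrPdist_lt => e e0.
have e0' : 0 < complex.Re e by move: e0; case: (e) => a b; rewrite ltcE => /andP[].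
have -> : e = (complex.Re e)%:C%C.
  by move: e0; case: (e) => a b; rewrite ltcE /= => /andP[/eqP -> _].
near=> n; rewrite distrC normCE ltcR -[ltLHS]ger0_norm ?nm_ge0//.
rewrite -normrN -sub0r; near: n; exact: h.
Unshelve. all: by end_near. Qed.

Lemma cvgC_bound u z (e : nat -> R) : (forall n, nm (u n - z) <= e n) ->
  e @ \oo --> 0 -> u @ \oo --> z.
Proof.
move=> h e0; apply/cvgC_nm.
apply: (@squeeze_cvgr _ _ _ _ (cst 0) e) => //; last exact: cvg_cst.
by near=> n; rewrite nm_ge0 h.
Unshelve. all: by end_near. Qed.

Lemma cvgC_uniq u z w : u @ \oo --> z -> u @ \oo --> w -> z = w.
Proof. by move=> uz uw; exact: cvg_unique uz uw. Qed.

Lemma cvgC_ReIm u (a b : R) :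
  (fun n => complex.Re (u n)) @ \oo --> a ->
  (fun n => complex.Im (u n)) @ \oo --> b ->
  u @ \oo --> ((a +i* b)%C : K).
Proof.
move=> ha hb.
apply: (@cvgC_bound _ _ (fun n => `|complex.Re (u n) - a| + `|complex.Im (u n) - b|)).
  by move=> n; rewrite (le_trans (nm_le_ReIm _))// ReCD ImCD ReCN ImCN.
rewrite -(addr0 0); apply: cvgD; apply/norm_cvg0P;
  [have : (fun n => complex.Re (u n) - a) @ \oo --> a - a by exact: cvgB ha (cvg_cst _)|
   have : (fun n => complex.Im (u n) - b) @ \oo --> b - b by exact: cvgB hb (cvg_cst _)];
  by rewrite subrr.
Qed.

Lemma cvgC_nm_le u z (M : R) : u @ \oo --> z ->
  (\forall n \near \oo, nm (u n) <= M) -> nm z <= M.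
Proof.
move=> /cvgC_nm h hM; apply/ler_addgt0Pr => e e0.
move/cvgrPdist_lt : h => /(_ _ e0) h.
near \oo => n.
have h1 : nm (u n) <= M by near: n.
have h2 : nm (u n - z) <= e.
  rewrite ltW// -[ltLHS]ger0_norm ?nm_ge0// -normrN -sub0r; near: n; exact: h.
have -> : z = u n - (u n - z) by ring.
by rewrite (le_trans (nmD _ _))// nmN lerD.
Unshelve. all: by end_near. Qed.

Lemma Re_sum (I : Type) (r : seq I) (P : pred I) (F : I -> K) :
  complex.Re (\sum_(i <- r | P i) F i) = \sum_(i <- r | P i) complex.Re (F i).
Proof. by elim/big_rec2: _ => [//|i y x _ <-]; rewrite ReCD. Qed.

Lemma Im_sum (I : Type) (r : seq I) (P : pred I) (F : I -> K) :
  complex.Im (\sum_(i <- r | P i) F i) = \sum_(i <- r | P i) complex.Im (F i).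
Proof. by elim/big_rec2: _ => [//|i y x _ <-]; rewrite ImCD. Qed.

(** The majorant is patched by the terms themselves below J. Bounds for the lattice terms w + j are
    available only once j exceeds 2 |w|. *)
Lemma eventually_dom_cvg (a b : nat -> R) (J : nat) :
  (forall j, (J <= j)%N -> `|a j| <= b j) -> cvgn (series b) -> cvgn (series a).
Proof.
move=> h cb.
apply: normed_cvg.
pose b' := (fun j => if (j < J)%N then `|a j| else b j).
apply: (@series_le_cvg _ _ b') => [n|n|n|].
- exact: normr_ge0.
- by rewrite /b'; case: ltnP => // /h; apply: le_trans.
- by rewrite /b'; case: ltnP => // /h.
apply/cvg_ex; exists (series b' J - series b J + limn (series b)).
rewrite -(cvg_shiftn J).
have -> : (fun n => series b' (n + J)%N) =
   (fun n => (series b' J - series b J) + series b (n + J)%N).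
  apply/funext => n; elim: n => [|n IH].
    by rewrite add0n subrK.
  by rewrite addSn !seriesSr IH addrA {2}/b' ltnNge leq_addl.
apply: cvgD; first exact: cvg_cst.
by rewrite (cvg_shiftn J).
Qed.

Lemma abs_cvgC (a : nat -> K) (b : nat -> R) (J : nat) :
  (forall j, (J <= j)%N -> nm (a j) <= b j) -> cvgn (series b) ->
  exists s : K, series a @ \oo --> s.
Proof.
move=> h cb.
have hr : cvgn (series (fun j => complex.Re (a j))).
  apply: (@eventually_dom_cvg _ b J) => // j /h; apply: le_trans.
  exact: Re_le_nm.
have hi : cvgn (series (fun j => complex.Im (a j))).
  apply: (@eventually_dom_cvg _ b J) => // j /h; apply: le_trans.
  exact: Im_le_nm.
exists ((limn (series (fun j => complex.Re (a j))) +i* limn (series (fun j => complex.Im (a j))))%C).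
apply: cvgC_ReIm.
- have -> : (fun n => complex.Re (series a n)) = series (fun j => complex.Re (a j)).
    by apply/funext => n; rewrite /series /= Re_sum.
  exact: hr.
- have -> : (fun n => complex.Im (series a n)) = series (fun j => complex.Im (a j)).
    by apply/funext => n; rewrite /series /= Im_sum.
  exact: hi.
Qed.

Lemma series_shift (V : zmodType) (a : nat -> V) m n :
  series a (m + n)%N = series a m + \sum_(m <= j < m + n) a j.
Proof. by rewrite /series /= (big_cat_nat (n := m))//= leq_addr. Qed.

Lemma series_tail (a : nat -> K) (b : nat -> R) (N : nat) s :
  (forall j, (N <= j)%N -> nm (a j) <= b j) -> cvgn (series b) ->
  series a @ \oo --> s ->
  nm (s - series a N) <= limn (series b) - series b N.
Proof.
move=> h cb hs.
have hs' : (fun n => series a n - series a N) @ \oo --> s - series a N.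
  exact: cvgB hs (cvg_cst _).
have cbN : (fun n => series b n - series b N) @ \oo --> limn (series b) - series b N.
  exact: cvgB cb (cvg_cst _).
have nd n m : (N <= n)%N -> series b n <= series b (n + m)%N.
  move=> Nn; rewrite series_shift lerDl big_nat sumr_ge0// => i /andP[ni _].
  by rewrite (le_trans _ (h _ (leq_trans Nn ni))) ?nm_ge0.
apply: (cvgC_nm_le hs'); near=> n.
have Nn : (N <= n)%N by near: n; exact: nbhs_infty_ge.
rewrite -(subnKC Nn) series_shift [X in X - _]addrC addrK.
rewrite (le_trans (nm_sum _ _ _))//.
apply: (@le_trans _ _ (\sum_(N <= j < N + (n - N)) b j)).
  by rewrite !big_nat ler_sum// => i /andP[ni _]; exact: h.
rewrite -[leLHS](addrK (series b N)) addrC [X in - _ + X]addrC -series_shift addrC.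
rewrite lerD2r; apply: limr_ge => //; near=> m.
have mn : (N + (n - N) <= m)%N by near: m; exact: nbhs_infty_ge.
by rewrite -(subnKC mn) nd// leq_addr.
Unshelve. all: by end_near. Qed.

Lemma cvgC_series (a : nat -> nat -> K) (b : nat -> K) N :
  (forall j, a ^~ j @ \oo --> b j) ->
  (fun r => series (a r) N) @ \oo --> series b N.
Proof.
move=> h; elim: N => [|N IH].
  have E (c : nat -> K) : series c 0%N = 0 by rewrite /series /= big_geq.
  have -> : (fun r => series (a r) 0%N) = cst 0 by apply/funext => r; exact: E.
  rewrite E; exact: cvg_cst.
have -> : (fun r => series (a r) N.+1) = (fun r => series (a r) N + a r N).
  by apply/funext => r; rewrite seriesSr.
rewrite seriesSr; exact: cvgD IH (h N).
Qed.

(* Tannery's theorem, the domination being needed only from some indices on *)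
Lemma tannery (a : nat -> nat -> K) (b : nat -> K) (A : nat -> K)
    (u : nat -> R) (r0 J : nat) :
  (forall j, a ^~ j @ \oo --> b j) ->
  (forall r j, (r0 <= r)%N -> (J <= j)%N -> nm (a r j) <= u j) ->
  cvgn (series u) ->
  (forall r, (r0 <= r)%N -> series (a r) @ \oo --> A r) ->
  exists2 s : K, series b @ \oo --> s & A @ \oo --> s.
Proof.
move=> hab dom cu hA.
have domb j : (J <= j)%N -> nm (b j) <= u j.
  move=> Jj; apply: (cvgC_nm_le (hab j)); near=> r.
  by apply: dom => //; near: r; exact: nbhs_infty_ge.
have [s hs] := abs_cvgC domb cu; exists s => //.
apply/cvgC_nm/cvgrPdist_lt => e e0.
have [N NJ tailN] : exists2 N, (J <= N)%N &
    limn (series u) - series u N < e / 4%:R.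
  have e4 : 0 < e / 4%:R by rewrite divr_gt0.
  move/cvgrPdist_lt : cu => /(_ _ e4) hu; near \oo => N.
  exists N; first by near: N; exact: nbhs_infty_ge.
  apply: le_lt_trans (ler_norm _) _; near: N; exact: hu.
have hfin : (fun r => series (a r) N) @ \oo --> series b N.
  exact: cvgC_series.
have e4 : 0 < e / 4%:R by rewrite divr_gt0.
move/cvgC_nm/cvgrPdist_lt : hfin => /(_ _ e4) hfin.
near=> r.
rewrite sub0r normrN ger0_norm ?nm_ge0//.
have rr0 : (r0 <= r)%N by near: r; exact: nbhs_infty_ge.
have h1 : nm (A r - series (a r) N) <= limn (series u) - series u N.
  apply: (series_tail _ cu (hA _ rr0)) => j Nj; apply: dom => //.
  exact: leq_trans Nj.
have h2 : nm (s - series b N) <= limn (series u) - series u N.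
  apply: (series_tail _ cu hs) => j Nj; apply: domb; exact: leq_trans Nj.
have h3 : nm (series (a r) N - series b N) < e / 4%:R.
  have : `|0 - nm (series (a r) N - series b N)| < e / 4%:R.
    near: r; exact: hfin.
  by rewrite sub0r normrN ger0_norm ?nm_ge0.
(* Two tails, each below e/4 uniformly in r, and a finite part that converges term by term. *)
have -> : A r - s = (A r - series (a r) N) + (series (a r) N - series b N)
   - (s - series b N) by ring.
have := nmD (A r - series (a r) N + (series (a r) N - series b N)) (- (s - series b N)).
have := nmD (A r - series (a r) N) (series (a r) N - series b N).
rewrite nmN; lra.
Unshelve. all: by end_near. Qed.

End ComplexLimits.

(** * Elementary inequalities for exp, sin and cos *)

Section RealEstimates.
Variable R : realType.
Implicit Types x y : R.

(** The inequality exp x >= 1 + x, taken at x and at -x, bounds exp x from both sides. *)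
Lemma expR_quad x : `|x| <= 1/2 -> `|expR x - 1 - x| <= 2 * x ^+ 2.
Proof.
move=> hx; have h1 := expR_ge1Dx x; rewrite ger0_norm; last lra.
have h2 := expR_ge1Dx (- x).
have h0 := expR_gt0 x.
have h3 : expR x * expR (- x) = 1 by rewrite expRxMexpNx_1.
move: hx; rewrite ler_norml => /andP[hx1 hx2].
have h4 : expR x * (1 - x) <= 1 by nra.
nra.
Qed.

Lemma sin_le_id x : `|sin x| <= `|x|.
Proof.
wlog x0 : x / 0 <= x.
  move=> h; case: (leP 0 x) => x0; first exact: h.
  by rewrite -normrN -sinN -(normrN x); apply: h; lra.
have [|c _] := @MVT_segment R sin cos 0 x x0.
- exact/continuous_subspaceT/continuous_sin.
rewrite sin0 !subr0 => ->; rewrite normrM -[leRHS]mul1r ler_wpM2r//.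
exact: cos_max.
Qed.

Lemma cos_quad y : `|cos y - 1| <= y ^+ 2 / 2.
Proof.
have -> : cos y - 1 = - (2 * sin (y / 2) ^+ 2).
  rewrite {1}(_ : y = (y / 2) *+ 2) ?cos_mulr2n ?cos2sin2; first by ring.
  by rewrite -mulr_natr divfK.
rewrite normrN ger0_norm; last by rewrite mulr_ge0// sqr_ge0.
have : `|sin (y/2)| ^+ 2 <= `|y/2| ^+ 2.
  by rewrite lerXn2r ?nnegrE// sin_le_id.
rewrite !real_normK ?num_real//; nra.
Qed.

Lemma sin_cubic y : `|sin y - y| <= `|y| ^+ 3 / 2.
Proof.
wlog y0 : y / 0 <= y.
  move=> h; case: (leP 0 y) => y0; first exact: h.
  rewrite -(normrN y) -(normrN (sin y - y)).
  have -> : - (sin y - y) = sin (- y) - (- y) by rewrite sinN; ring.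
  by apply: h; lra.
have [|c] := @MVT_segment R sin cos 0 y y0.
- exact/continuous_subspaceT/continuous_sin.
rewrite sin0 !subr0 in_itv /= => /andP[c0 cy] ->.
have -> : cos c * y - y = (cos c - 1) * y by ring.
rewrite normrM (ger0_norm y0).
have h := cos_quad c.
have h2 : c ^+ 2 <= y ^+ 2 by rewrite lerXn2r ?nnegrE.
have : `|cos c - 1| * y <= (y^+2/2) * y by rewrite ler_wpM2r//; lra.
rewrite !exprS expr0; lra.
Qed.

(** A weak Jordan inequality: the cubic estimate gives sin t >= t/2 on [0, 1], and on [1, pi/2]
    monotonicity gives sin y >= sin 1 >= 1/2, where y < 2. *)
Lemma sin_lower y : `|y| <= pi / 2 -> `|y| / 4 <= `|sin y|.
Proof.
wlog y0 : y / 0 <= y.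
  move=> h; case: (leP 0 y) => y0; first exact: h.
  by rewrite -(normrN y) -(normrN (sin y)) -sinN; apply: h; lra.
rewrite (ger0_norm y0) => hy.
have key (t : R) : 0 <= t -> t <= 1 -> t / 2 <= sin t.
  move=> t0 t1; have := sin_cubic t; rewrite (ger0_norm t0) ler_norml => /andP[+ _].
  have : t ^+ 3 <= t.
    by rewrite exprS -[leRHS]mulr1 ler_wpM2l// exprn_ile1.
  lra.
have p2 := @pihalf_lt2 R.
case: (leP y 1) => y1.
  by apply: le_trans (ler_norm _); have := key y y0 y1; lra.
apply: le_trans (ler_norm _).
have : sin 1 < sin y.
  by rewrite ltr_sin// in_itv /=; have := @pihalf_ge1 R; lra.
have := key 1 ler01 (lexx _); lra.
Qed.

End RealEstimates.

(** * The complex exponential and the parameter q *)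

Section ComplexExp.
Variable R : realType.
Local Notation K := (C R).
Local Notation nm := (@ComplexField.Normc.normc R).
Local Notation E := (@qparam R).
Definition twopii : K := (0 +i* (2 * pi))%C.
Implicit Types (z w h : K).

Lemma CexpD z w : Cexp (z + w) = Cexp z * Cexp w.
Proof.
rewrite /Cexp ReCD ImCD expRD cosD sinD; apply/eqP; rewrite eq_complex /=.
by apply/andP; split; apply/eqP; ring.
Qed.

Lemma nm_Cexp z : nm (Cexp z) = expR (complex.Re z).
Proof.
rewrite /Cexp /= !exprMn -mulrDr cos2Dsin2 mulr1 sqrtr_sqr.
by rewrite ger0_norm// expR_ge0.
Qed.

(** [Cexp] is assembled from real exp, cos and sin, so its complex differentiability has to come
    from this remainder. *)
Lemma Cexp_quad h : nm h <= 1/2 -> nm (Cexp h - 1 - h) <= 8 * nm h ^+ 2.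
Proof.
move=> hh; have hx := le_trans (Re_le_nm h) hh.
have hy := le_trans (Im_le_nm h) hh.
rewrite sqr_nm (le_trans (nm_le_ReIm _))// !ReCD !ImCD !ReCN !ImCN.
case: h {hh} hx hy => x y /= hx hy; rewrite oppr0 addr0.
have e1 := expR_quad hx; have c1 := cos_quad y; have s1 := sin_cubic y.
have c2 := cos_max y; have s2 := sin_le_id y.
have s3 : `|sin y - y| <= y ^+ 2.
  rewrite (le_trans s1)// -[leRHS]real_normK ?num_real// exprS.
  have := normr_ge0 y; nra.
have -> : expR x * cos y - 1 - x
  = (expR x - 1 - x) * cos y + (1 + x) * (cos y - 1) by ring.
have -> : expR x * sin y - y
  = (expR x - 1 - x) * sin y + x * sin y + (sin y - y) by ring.
have e2 : `|(expR x - 1 - x) * cos y| <= 2 * x ^+ 2.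
  by rewrite normrM -[leRHS]mulr1 ler_pM.
have e3 : `|(1 + x) * (cos y - 1)| <= y ^+ 2.
  rewrite normrM; have : `|1 + x| <= 3/2 by rewrite (le_trans (ler_normD _ _))// normr1; lra.
  have := normr_ge0 (1 + x); have := normr_ge0 (cos y - 1); have := sqr_ge0 y; nra.
have e4 : `|(expR x - 1 - x) * sin y| <= 2 * x ^+ 2.
  by rewrite normrM -[leRHS]mulr1 ler_pM// sin_max.
have e5 : `|x * sin y| <= (x ^+ 2 + y ^+ 2).
  rewrite normrM -(real_normK (num_real x)) -(real_normK (num_real y)).
  apply: (@le_trans _ _ (`|x| * `|y|)); first by rewrite ler_wpM2l.
  have := sqr_ge0 (`|x| - `|y|); have := mulr_ge0 (normr_ge0 x) (normr_ge0 y); nra.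
have := ler_normD ((expR x - 1 - x) * cos y) ((1 + x) * (cos y - 1)).
have := ler_normD ((expR x - 1 - x) * sin y + x * sin y) (sin y - y).
have := ler_normD ((expR x - 1 - x) * sin y) (x * sin y).
have := sqr_ge0 x; have := sqr_ge0 y; lra.
Qed.

Lemma qparamE z : E z = Cexp (twopii * z).
Proof.
rewrite /qparam; congr (Cexp (_ * z)).
by apply/eqP; rewrite eq_complex /=; apply/andP; split; apply/eqP; ring.
Qed.

Lemma Re_twopii z : complex.Re (twopii * z) = - (2 * pi * complex.Im z).
Proof. by rewrite ReCM /=; ring. Qed.

Lemma Im_twopii z : complex.Im (twopii * z) = 2 * pi * complex.Re z.
Proof. by rewrite ImCM /=; ring. Qed.

Lemma nm_twopii : nm twopii = 2 * pi.
Proof.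
by rewrite /= expr0n add0r sqrtr_sqr ger0_norm// mulr_ge0// pi_ge0.
Qed.

Lemma twopii_neq0 : twopii != 0.
Proof. by rewrite -nm_gt0 nm_twopii mulr_gt0// pi_gt0. Qed.

Lemma qparamD z w : E (z + w) = E z * E w.
Proof. by rewrite !qparamE mulrDr CexpD. Qed.

Lemma nm_qparam z : nm (E z) = expR (- (2 * pi * complex.Im z)).
Proof. by rewrite qparamE nm_Cexp Re_twopii. Qed.

Lemma qparam_neq0 z : E z != 0.
Proof. by rewrite -nm_gt0 nm_qparam expR_gt0. Qed.

Lemma qparam0 : E 0 = 1.
Proof. by rewrite qparamE mulr0 /Cexp /= expR0 cos0 sin0 mulr1 mulr0. Qed.

Lemma qparam1 : E 1 = 1.
Proof.
rewrite qparamE /Cexp Re_twopii Im_twopii /= mulr0 oppr0 mulr1 expR0 !mul1r.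
by rewrite (mulr_natl pi 2) cos2pi sin2pi.
Qed.

Lemma qparam_half : E (1/2) = -1.
Proof.
have -> : 1/2 = toC (1/2) :> K by rewrite rmorphM rmorph1 fmorphV rmorph_nat.
rewrite qparamE /Cexp Re_twopii Im_twopii /= mulr0 oppr0 expR0 !mul1r.
have -> : 2 * pi / 2 = pi :> R by field.
by rewrite cospi sinpi; apply/eqP; rewrite eq_complex /= oppr0 !eqxx.
Qed.

Lemma qparam_nat n : E n%:R = 1.
Proof. by elim: n => [|n IH]; rewrite ?qparam0// -addn1 natrD qparamD IH qparam1 mulr1. Qed.

Lemma qparamDn z n : E (z + n%:R) = E z.
Proof. by rewrite qparamD qparam_nat mulr1. Qed.

Lemma qparamBn z n : E (z - n%:R) = E z.
Proof. by rewrite -[in RHS](subrK n%:R z) qparamDn. Qed.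

Lemma qparamMn z n : E (n%:R * z) = E z ^+ n.
Proof.
elim: n => [|n IH]; first by rewrite mul0r qparam0 expr0.
by rewrite -addn1 natrD mulrDl mul1r qparamD IH addn1 exprSr.
Qed.

Lemma qparamN z : E (- z) = (E z)^-1.
Proof.
apply: (mulfI (qparam_neq0 z)); rewrite -qparamD subrr qparam0 divff//.
exact: qparam_neq0.
Qed.

Lemma qparam_quad z h : nm h <= 1/16 ->
  nm (E (z + h) - E z - h * (twopii * E z)) <= nm (E z) * 512 * nm h ^+ 2.
Proof.
move=> hh; have p2 : pi < 4 :> R by have := @pihalf_lt2 R; lra.
have p0 := @pi_gt0 R.
have -> : E (z + h) - E z - h * (twopii * E z)
   = E z * (Cexp (twopii * h) - 1 - twopii * h) by rewrite qparamD (qparamE h); ring.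
rewrite nmM -mulrA ler_wpM2l ?nm_ge0//.
have h1 : nm (twopii * h) = 2 * pi * nm h by rewrite nmM nm_twopii.
have n0 := nm_ge0 h.
rewrite (le_trans (Cexp_quad _))//; first by rewrite h1; nra.
rewrite h1 exprMn mulrA ler_wpM2r ?sqr_ge0//; nra.
Qed.

(** Keeps the denominator of the cotangent away from 0, whatever Im z is. With t = 2 pi Re z, the
    point 1 has distance at least |sin t| from the ray of argument t, which suffices for |Re z| <=
    1/4; beyond, cos t <= 0 and the real part of q - 1 is at most -1. *)
Lemma qparam_lower z : `|complex.Re z| <= 3/4 -> `|complex.Re z| <= nm (E z - 1).
Proof.
move=> hx; have p2 := @pi_ge2 R; have p4 := @pihalf_lt2 R.
have nxN := normr_ge0 (complex.Re z).
rewrite qparamE /Cexp Re_twopii Im_twopii.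
set rho := expR _; have rho0 : 0 < rho := expR_gt0 _.
set x := complex.Re z in hx nxN *; set t := 2 * pi * x.
case: (leP `|x| (1/4)) => x4.
  apply: (@le_trans _ _ `|sin t|).
    apply: le_trans (sin_lower _); rewrite normrM (ger0_norm (x := 2 * pi)); nra.
  rewrite -[leRHS]ger0_norm ?nm_ge0// -ler_sqr ?nnegrE//.
  rewrite !real_normK ?num_real// sqr_nm ReCD ImCD ReCN ImCN /= oppr0 addr0.
  have -> : (rho * cos t - 1) ^+ 2 + (rho * sin t) ^+ 2 =
     (rho - cos t) ^+ 2 + sin t ^+ 2 + (rho ^+ 2 - 1) * (cos t ^+ 2 + sin t ^+ 2 - 1).
    by ring.
  by rewrite cos2Dsin2 subrr mulr0 addr0 lerDr sqr_ge0.
have ct : cos t <= 0.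
  have -> : cos t = cos (2 * pi * `|x|).
    by rewrite -cos_norm normrM (ger0_norm (x := 2 * pi))//; lra.
  rewrite -oppr_ge0 -sinBpihalf; apply: sin_ge0_pi; apply/andP; split; nra.
have rc : rho * cos t <= 0 by rewrite mulr_ge0_le0// ltW.
apply: le_trans (Re_le_nm _); rewrite ReCD ReCN /= (ler0_norm (x := _ - 1)); lra.
Qed.

Lemma qparam_cvg_diff z (h : nat -> K) : h @ \oo --> (0 : K) ->
  (forall n, h n != 0) ->
  (fun n => (E (z + h n) - E z) / h n) @ \oo --> twopii * E z.
Proof.
move=> /cvgC_nm h0 hn0; apply/cvgC_nm.
have {}h0 : (fun n => nm (h n)) @ \oo --> (0 : R).
  by move: h0; under eq_fun do rewrite subr0.
apply: (@squeeze_cvgr _ _ _ _ (cst 0) (fun n => nm (E z) * 512 * nm (h n))).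
- have h16 : (0 : R) < 1/16 by lra.
  near=> n; rewrite nm_ge0 /=.
  have tn : nm (h n) <= 1/16.
    rewrite -[leLHS]ger0_norm ?nm_ge0// -normrN -sub0r ltW//; near: n.
    by move/cvgrPdist_lt : h0 => /(_ _ h16).
  have := @qparam_quad z (h n) tn.
  have -> : E (z + h n) - E z - h n * (twopii * E z) =
    h n * ((E (z + h n) - E z) / h n - twopii * E z).
    by rewrite mulrBr; congr (_ - _); rewrite mulrCA divff// mulr1.
  by rewrite nmM expr2 mulrA [leLHS]mulrC ler_pM2r// nm_gt0.
- exact: cvg_cst.
- rewrite -(mulr0 (nm (E z) * 512)); apply: cvgM; first exact: cvg_cst.
  exact: h0.
Unshelve. all: by end_near. Qed.

Lemma qparam_near1 h : nm h <= 1/16 -> nm (E h - 1) <= 40 * nm h.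
Proof.
move=> hh; have := qparam_quad 0 hh; rewrite add0r qparam0 mulr1 nm1 mul1r => q.
have -> : E h - 1 = h * twopii + (E h - 1 - h * twopii) by ring.
rewrite (le_trans (nmD _ _))// nmM nm_twopii.
have p4 := @pihalf_lt2 R; have n0 := nm_ge0 h; nra.
Qed.

End ComplexExp.

(** * The cotangent expansion *)

Section BilateralSums.
Variable R : realType.
Local Notation K := (C R).
Local Notation nm := (@ComplexField.Normc.normc R).
Local Notation E := (@qparam R).
Implicit Types (z w s : K) (f g : K -> K).

(* the terms of index [j] and [- j] of a sum over all integers of [f (w + j s)] *)
Definition bil s f w (j : nat) : K :=
  if j == 0%N then f w else f (w + j%:R * s) + f (w - j%:R * s).

(** A telescoping stand-in for 1/j^2, positive at j = 0 as well. *)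
Definition inv2 (j : nat) : R := (j.+1%:R * j.+2%:R)^-1.

Lemma inv2_gt0 j : 0 < inv2 j.
Proof. by rewrite invr_gt0 mulr_gt0. Qed.

Lemma cvg_inv2 : cvgn (series inv2).
Proof.
have E n : series inv2 n = 1 - n.+1%:R^-1.
  elim: n => [|n IH]; first by rewrite /series /= big_geq// invr1 subrr.
  have a0 : n.+1%:R != 0 :> R by rewrite pnatr_eq0.
  have : n.+2%:R != 0 :> R by rewrite pnatr_eq0.
  rewrite seriesSr IH /inv2 -(natr1 n.+1) => a1.
  by move: (n.+1%:R) a0 a1 => a a0 a1; field; rewrite a0 a1.
apply: nondecreasing_is_cvgn.
  apply/nondecreasing_seqP => n; rewrite seriesSr lerDl ltW//; exact: inv2_gt0.
exists 1 => _ [n _ <-]; rewrite E lerBlDr lerDl invr_ge0; exact: ler0n.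
Qed.

Lemma inv_sqr_le (j : nat) : (0 < j)%N -> (j%:R ^+ 2)^-1 <= 6 * inv2 j.
Proof.
move=> j0; have j1 : (1 : R) <= j%:R by rewrite ler1n.
rewrite /inv2 -[leLHS]mul1r ler_pdivrMr; last nra.
rewrite mulrAC ler_pdivlMr; last by rewrite mulr_gt0.
by rewrite -(natr1 j.+1) -(natr1 j); nra.
Qed.

Lemma nat_far w (j : nat) : 2 * nm w <= j%:R ->
  (j%:R / 2 <= nm (w + j%:R)) /\ (j%:R / 2 <= nm (w - j%:R)).
Proof.
move=> h; have := nm_leD (j%:R : K) w; have := nm_leD (- (j%:R) : K) (- - w).
by rewrite opprK (addrC _ w) (addrC _ w) !nmN nm_nat; split; lra.
Qed.

(* pi cot(pi w) *)
Definition cotp w : K := twopii R / 2 * ((E w + 1) / (E w - 1)).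

(** The duplication formula of the cotangent. It persists at the poles because the convention 1/0 =
    0 makes both sides 0 there. *)
Lemma cotp_dup w : cotp w = (cotp (w / 2) + cotp ((w + 1) / 2)) / 2.
Proof.
rewrite /cotp (mulrDl w) qparamD.
have -> : E w = E (w / 2) * E (w / 2) by rewrite -qparamD -splitr.
rewrite qparam_half; set a := E _.
have [->|a1] := eqVneq a 1.
  by rewrite !mul1r addNr subrr invr0 !(mulr0, mul0r) addr0 mul0r.
have [->|a1'] := eqVneq a (-1).
  by rewrite mulrNN !mul1r addNr subrr invr0 !(mulr0, mul0r) addr0 mul0r.
have a2 : a - 1 != 0 by rewrite subr_eq0.
have a3 : a + 1 != 0 by rewrite -(opprK 1) subr_eq0.
have -> : a * a - 1 = (a - 1) * (a + 1) by ring.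
have -> : a * -1 - 1 = - (a + 1) by ring.
by field; rewrite a2 a3.
Qed.

Lemma cotpDn w n : cotp (w + n%:R) = cotp w.
Proof. by rewrite /cotp qparamDn. Qed.

Lemma cotpN w : cotp (- w) = - cotp w.
Proof.
rewrite /cotp qparamN -mulrN; congr (_ * _); have := qparam_neq0 w.
move: (E w) => a a0.
have -> : a^-1 + 1 = (a + 1) / a by field.
have -> : a^-1 - 1 = - (a - 1) / a by field.
have [->|a1] := eqVneq a 1.
  by rewrite subrr oppr0 !mul0r invr0 !mulr0 oppr0.
by field; rewrite a0 subr_eq0 a1.
Qed.

Lemma sum_nat_double (V : nmodType) m (F : nat -> V) :
  \sum_(0 <= j < m + m) F j = \sum_(0 <= j < m) (F j + F (m + j)%N).
Proof.
rewrite (big_cat_nat (n := m)) ?leq_addr//= big_split; congr (_ + _).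
by rewrite -{1}(add0n m) big_addn addnK; apply: eq_bigr => j _; rewrite addnC.
Qed.

Lemma cotp_iter r w : cotp w =
  (2 ^+ r)^-1 * \sum_(0 <= j < 2 ^ r) cotp ((w + j%:R) / 2 ^+ r).
Proof.
elim: r => [|r IH].
  by rewrite big_nat1 addr0 expr0 invr1 mulr1 mul1r.
rewrite expnS mul2n -addnn sum_nat_double {}IH exprS invfM -mulrA.
rewrite [RHS]mulrCA; congr (_ * _); rewrite mulr_sumr.
apply: eq_bigr => j _; rewrite cotp_dup mulrC; congr (_ * (cotp _ + cotp _)).
  by rewrite -mulrA; congr (_ * _); rewrite mulrC.
have t0 : 2 ^+ r != 0 :> K by rewrite expf_neq0// pnatr_eq0.
by rewrite natrD natrX; field.
Qed.

(** Period 1 moves the indices m <= j < 2 m to j - 2 m and makes the sum symmetric; the index -m has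
    no partner and is left over. *)
Lemma cotp_fold m w : (0 < m)%N -> let N : K := (m + m)%:R in
  \sum_(0 <= j < m + m) cotp ((w + j%:R) / N) =
  series (bil 1 (fun x => cotp (x / N)) w) m + cotp ((w - m%:R) / N).
Proof.
case: m => // m _ N; have N0 : N != 0 by rewrite pnatr_eq0.
rewrite sum_nat_double big_split/=.
have -> : \sum_(0 <= j < m.+1) cotp ((w + (m.+1 + j)%:R) / N) =
    \sum_(0 <= j < m.+1) cotp ((w - j.+1%:R) / N).
  rewrite big_nat_rev/=; apply: eq_big_nat => j /andP[_ jm].
  rewrite -[RHS](cotpDn _ 1); congr cotp.
  have -> : (m.+1 + (0 + m.+1 - j.+1))%N = (m.+1 + m.+1 - j.+1)%N by lia.
  by rewrite natrB; [rewrite -/N; field|lia].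
rewrite [X in _ + X]big_nat_recr//= addrA; congr (_ + _).
rewrite /series /= !big_nat_recl//= -addrA /bil /= addr0; congr (_ + _).
by rewrite -big_split; apply: eq_bigr => j _; rewrite mulr1.
Qed.

Lemma bil_inv_cvg (f : nat -> K -> K) w :
  (forall x : K, x != 0 -> f ^~ x @ \oo --> x^-1) -> E w != 1 ->
  forall j, (fun r => bil 1 (f r) w j) @ \oo --> bil 1 (fun x => x^-1) w j.
Proof.
move=> hf Ew1; have nz1 n : w + n%:R != 0.
  apply: contraNneq Ew1 => h.
  by rewrite -(qparamDn w n) h qparam0.
have nz2 n : w - n%:R != 0.
  apply: contraNneq Ew1 => h.
  by rewrite -(qparamBn w n) h qparam0.
case=> [|j]; rewrite /bil /=.
  by apply: hf; rewrite -(addr0 w); exact: (nz1 0%N).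
by rewrite mulr1; exact: cvgD (hf _ (nz1 j.+1)) (hf _ (nz2 j.+1)).
Qed.

Lemma cotp_near0 (h : nat -> K) : h @ \oo --> (0 : K) -> (forall n, h n != 0) ->
  (fun n => h n * cotp (h n)) @ \oo --> (1 : K).
Proof.
move=> h0 hn0; have := qparam_cvg_diff (z := 0) h0 hn0.
rewrite qparam0 mulr1; under eq_fun do rewrite add0r.
move=> d.
have e1 : (fun n => E (h n)) @ \oo --> (1 : K).
  have -> : (fun n => E (h n)) = (fun n => h n * ((E (h n) - 1) / h n) + 1).
    by apply/funext => n; rewrite mulrCA divff// mulr1 subrK.
  rewrite -[X in _ --> X](add0r 1) -(mul0r (twopii R)).
  exact: cvgD (cvgM h0 d) (cvg_cst _).
have -> : (1 : K) = twopii R / 2 * ((1 + 1) * (twopii R)^-1).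
  by field; exact: twopii_neq0.
have -> : (fun n => h n * cotp (h n)) =
    (fun n => twopii R / 2 * ((E (h n) + 1) * ((E (h n) - 1) / h n)^-1)).
  apply/funext => n; rewrite /cotp invfM invrK mulrCA; congr (_ * _).
  by rewrite mulrC -mulrA.
have dV : (fun n => ((E (h n) - 1) / h n)^-1) @ \oo --> (twopii R)^-1.
  exact: cvgV (twopii_neq0 R) d.
have l1 : (fun n => E (h n) + 1) @ \oo --> (1 + 1 : K).
  exact: cvgD e1 (cvg_cst _).
exact: cvgM (cvg_cst _) (cvgM l1 dV).
Qed.

Lemma cvg_inv_pow2 z : (fun r => z / (2 ^ r.+1)%:R) @ \oo --> (0 : K).
Proof.
apply: (@cvgC_bound _ _ _ (fun r => nm z * r.+1%:R^-1)).
  move=> r; rewrite subr0 nmM nmV nm_nat ler_wpM2l ?nm_ge0// lef_pV2 ?posrE ?ltr0n ?expn_gt0//.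
  by rewrite ler_nat ltnW// ltn_expl.
rewrite -(mulr0 (nm z)).
exact: cvgM (cvg_cst _) cvg_harmonic.
Qed.

(** The majorant for Tannery's theorem, uniform in N. The sum cot a + cot b has sin(a + b) as
    numerator, and a + b = 2 w / N no longer contains j, so pairing gains the decay 1/j^2. The
    condition 32 |w| <= N puts 2 w / N within 1/16, and j <= N / 2 keeps both real parts within
    3/4. *)
Lemma cotp_pair_bound w (N : R) (j : nat) : 0 < N -> (0 < j)%N ->
  32 * nm w <= N -> 2 * nm w <= j%:R -> j%:R <= N / 2 ->
  nm ((cotp ((w + j%:R) / toC N) + cotp ((w - j%:R) / toC N)) / toC N)
  <= 40 * 64 * nm w / j%:R ^+ 2.
Proof.
move=> N0 j0 hN hj hjN; have n0 := nm_ge0 w.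
have jp : (0 : R) < j%:R by rewrite ltr0n.
have Nn : nm (toC N) = N by rewrite nmR ger0_norm// ltW.
have NC : toC N != 0 by rewrite -nm_gt0 Nn.
set a := (w + j%:R) / toC N; set b := (w - j%:R) / toC N.
have Rx x : complex.Re (x / toC N) = complex.Re x / N.
  have -> : (toC N)^-1 = toC N^-1 by rewrite fmorphV.
  by rewrite ReCM /= mulr0 subr0.
have Ren : complex.Re (j%:R : K) = j%:R.
  by rewrite -(rmorph_nat (@toC R)).
have := Re_le_nm w; rewrite ler_norml => /andP[w1 w2].
have la : j%:R / (2 * N) <= nm (E a - 1).
  have h1 : j%:R / (2 * N) <= complex.Re a.
    rewrite Rx ReCD Ren invfM mulrA ler_pM2r ?invr_gt0//; lra.
  have h2 : complex.Re a <= 3/4.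
    by rewrite Rx ReCD Ren ler_pdivrMr//; lra.
  have h0 : 0 <= j%:R / (2 * N) by rewrite divr_ge0//; lra.
  by rewrite (le_trans h1)// (le_trans (ler_norm _))// qparam_lower// ger0_norm//; lra.
have lb : j%:R / (2 * N) <= nm (E b - 1).
  have h1 : j%:R / (2 * N) <= - complex.Re b.
    rewrite Rx ReCD ReCN Ren -mulNr invfM mulrA ler_pM2r ?invr_gt0//; lra.
  have h2 : - complex.Re b <= 3/4.
    by rewrite Rx ReCD ReCN Ren -mulNr ler_pdivrMr//; lra.
  have h0 : 0 <= j%:R / (2 * N) by rewrite divr_ge0//; lra.
  rewrite (le_trans h1)// (le_trans (ler_norm _))// normrN qparam_lower//.
  by rewrite -normrN ger0_norm//; lra.
have q0 : 0 < j%:R / (2 * N) by rewrite divr_gt0//; lra.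
have Ea : E a - 1 != 0 by rewrite -nm_gt0 (lt_le_trans q0).
have Eb : E b - 1 != 0 by rewrite -nm_gt0 (lt_le_trans q0).
have -> : cotp a + cotp b = twopii R * (E (2 * w / toC N) - 1) / ((E a - 1) * (E b - 1)).
  have -> : 2 * w / toC N = a + b by rewrite /a /b; field.
  by rewrite qparamD /cotp; move: (E a) (E b) Ea Eb => x y hx hy; field; rewrite hx hy.
have hs : nm (2 * w / toC N) = 2 * nm w / N by rewrite !nmM nmV Nn nm_nat.
have l2 : nm (E (2 * w / toC N) - 1) <= 80 * nm w / N.
  have := @qparam_near1 R (2 * w / toC N); rewrite hs => q.
  apply: le_trans (q _) _; last lra.
  by rewrite ler_pdivrMr//; lra.
rewrite !nmM !nmV !nmM nm_twopii Nn.
have p4 := @pihalf_lt2 R.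
have i2 : (nm (E a - 1) * nm (E b - 1))^-1 <= (j%:R / (2 * N) * (j%:R / (2 * N)))^-1.
  have pq := mulr_gt0 q0 q0.
  have pn : 0 < nm (E a - 1) * nm (E b - 1) by rewrite mulr_gt0 ?nm_gt0.
  rewrite lef_pV2 ?posrE//.
  by apply: ler_pM => //; exact: ltW.
apply: (@le_trans _ _ (8 * (80 * nm w / N) * (j%:R / (2 * N) * (j%:R / (2 * N)))^-1 / N)).
  rewrite ler_wpM2r ?invr_ge0 ?(ltW N0)//; apply: ler_pM => //.
  - by rewrite !mulr_ge0 ?nm_ge0 ?pi_ge0.
  - by rewrite invr_ge0 mulr_ge0 ?nm_ge0.
  - by apply: ler_pM; rewrite ?nm_ge0 ?mulr_ge0 ?pi_ge0//; lra.
rewrite le_eqVlt; apply/orP; left; apply/eqP; field.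
by rewrite !gt_eqF.
Qed.

End BilateralSums.

Section Cotangent.
Variable R : realType.
Local Notation K := (C R).
Local Notation nm := (@ComplexField.Normc.normc R).
Local Notation E := (@qparam R).
Implicit Types (z w s : K) (f g : K -> K).

Lemma cvg_qparam0 (h : nat -> K) : h @ \oo --> (0 : K) ->
  (fun n => E (h n)) @ \oo --> (1 : K).
Proof.
move=> /cvgC_nm h0; apply/cvgC_nm.
have {}h0 : (fun n => nm (h n)) @ \oo --> (0 : R).
  by move: h0; under eq_fun do rewrite subr0.
apply: (@squeeze_cvgr _ _ _ _ (cst 0) (fun n => 40 * nm (h n))).
- have h16 : (0 : R) < 1/16 by lra.
  near=> n; rewrite nm_ge0 /=; apply: qparam_near1.
  rewrite -[leLHS]ger0_norm ?nm_ge0// -normrN -sub0r ltW//; near: n.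
  by move/cvgrPdist_lt : h0 => /(_ _ h16).
- exact: cvg_cst.
- rewrite -(mulr0 40); exact: cvgM (cvg_cst _) h0.
Unshelve. all: by end_near. Qed.

Lemma series_finite_support (a : nat -> K) M :
  (forall j, (M <= j)%N -> a j = 0) -> series a @ \oo --> series a M.
Proof.
move=> h; apply/cvgC_nm.
apply: (@cvg_trans _ ((fun _ : nat => (0 : R)) @ \oo)); last exact: cvg_cst.
apply: near_eq_cvg; near=> n.
have Mn : (M <= n)%N by near: n; exact: nbhs_infty_ge.
rewrite -(subnKC Mn) series_shift addrAC subrr add0r big_nat big1 ?nm0//.
by move=> i /andP[/h].
Unshelve. all: by end_near. Qed.

Lemma nat_above (x : R) : exists n : nat, x <= n%:R.
Proof.
eexists; apply: le_trans (ler_norm x) _; apply: ltW.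
exact: (archi_boundP (normr_ge0 x)).
Qed.

(** Tannery's theorem along N = 2^(r+1) in the iterated duplication formula; each term tends to 1/x
    because x pi cot(pi x) tends to 1 at 0. *)
Lemma cot_expansion w : E w != 1 ->
  series (bil 1 (fun x => x^-1) w) @ \oo --> cotp w.
Proof.
move=> Ew1.
pose N r : nat := (2 ^ r.+1)%N.
have N0 r : (N r)%:R != 0 :> K by rewrite pnatr_eq0 expn_eq0.
pose f r (x : K) := cotp (x / (N r)%:R) / (N r)%:R.
(* The cut at N / 2 is the range of the pair bound, and makes the series equal to the folded sum. *)
pose a r j := if (j < 2 ^ r)%N then bil 1 (f r) w j else 0.
have hf (x : K) : x != 0 -> f ^~ x @ \oo --> x^-1.
  move=> x0; have hn0 n : x / (N n)%:R != 0 by rewrite mulf_neq0// invr_neq0.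
  have := cotp_near0 (@cvg_inv_pow2 R x) hn0.
  have -> : f ^~ x = (fun r => x^-1 * (x / (N r)%:R * cotp (x / (N r)%:R))).
    by apply/funext => r; rewrite /f mulrA mulKf// mulrC.
  by move=> h; rewrite -[X in _ --> X]mulr1; exact: cvgM (cvg_cst _) h.
have ha j : a ^~ j @ \oo --> bil 1 (fun x => x^-1) w j.
  apply: (@cvg_trans _ ((fun r => bil 1 (f r) w j) @ \oo)); last first.
    exact: bil_inv_cvg.
  apply: near_eq_cvg; near=> r.
  rewrite /a ifT//; apply: leq_trans (ltn_expl r (ltnSn 1)).
  by rewrite ltnS; near: r; exact: nbhs_infty_ge.
have [n0 hn0] := nat_above (32 * nm w).
have n0' := nm_ge0 w.
have [B B0 hB] : exists2 B : R, 0 <= B & 40 * 64 * nm w = B.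
  by exists (40 * 64 * nm w); rewrite ?mulr_ge0 ?ler0n.
have dom r j : (n0.+1 <= r)%N -> (n0.+1 <= j)%N ->
    nm (a r j) <= B * (6 * @inv2 R j).
  move=> hr hj; rewrite /a; case: ifP => jr; last first.
    by rewrite nm0 !mulr_ge0// ltW// inv2_gt0.
  have j0 : (0 < j)%N by exact: leq_trans hj.
  rewrite /bil -[X in if X then _ else _]negbK -lt0n j0 /= mulr1.
  have hjR : n0%:R <= j%:R :> R by rewrite ler_nat ltnW.
  have hNR : n0%:R <= (N r)%:R :> R.
    rewrite ler_nat; apply: leq_trans (ltnW (ltn_expl _ (ltnSn 1))).
    exact: leq_trans (ltnW hr) (leqnSn _).
  have jN : j%:R <= (N r)%:R / 2 :> R.
    by rewrite ler_pdivlMr// -natrM ler_nat /N expnS mulnC leq_pmul2l// ltnW.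
  have Np : (0 : R) < (N r)%:R by rewrite ltr0n expn_gt0.
  have := @cotp_pair_bound R w (N r)%:R j Np j0.
  rewrite rmorph_nat hB /f -mulrDl => h; apply: le_trans (h _ _ jN) _; [lra|lra|].
  by rewrite ler_wpM2l ?mulr_ge0// inv_sqr_le.
have cu : cvgn (series (fun j => B * (6 * @inv2 R j))).
  have -> : (fun j => B * (6 * @inv2 R j)) = (B * 6) *: @inv2 R.
    by apply/funext => j; rewrite mulrA.
  apply: is_cvg_seriesZ; exact: cvg_inv2.
have hA r : (n0.+1 <= r)%N -> series (a r) @ \oo -->
    cotp w - cotp ((w - (2 ^ r)%:R) / (N r)%:R) / (N r)%:R.
  move=> _.
  have -> : cotp w - cotp ((w - (2 ^ r)%:R) / (N r)%:R) / (N r)%:R = series (a r) (2 ^ r)%N.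
    have := @cotp_iter R r.+1 w; rewrite -natrX -/(N r).
    have -> : N r = (2 ^ r + 2 ^ r)%N by rewrite /N expnS mul2n addnn.
    rewrite cotp_fold ?expn_gt0// => ->.
    rewrite [X in _ * X]addrC mulrDr [X in X + _ - _]mulrC addrAC subrr add0r.
    rewrite /series /= mulr_sumr; apply: eq_big_nat => j /andP[_ jr].
    rewrite /a jr /bil /f; have -> : N r = (2 ^ r + 2 ^ r)%N by rewrite /N expnS mul2n addnn.
    by case: ifP => _; rewrite ?mulrDr ![_^-1 * _]mulrC.
  apply: series_finite_support => j jr; by rewrite /a ltnNge jr.
have [s hs As] := tannery ha dom cu hA.
suff -> : cotp w = s by [].
have h0 := @cvg_inv_pow2 R w; have e1 := cvg_qparam0 h0.
(* The argument of the unpaired term is w / N - 1/2, and the cotangent vanishes at the limit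
   -1/2. *)
have lim0 : (fun r => cotp ((w - (2 ^ r)%:R) / (N r)%:R)) @ \oo --> (0 : K).
  have -> : (fun r => cotp ((w - (2 ^ r)%:R) / (N r)%:R)) =
     (fun r => twopii R / 2 * ((E (w / (N r)%:R) - 1) * (E (w / (N r)%:R) + 1)^-1)).
    apply/funext => r.
    have -> : (w - (2 ^ r)%:R) / (N r)%:R = w / (N r)%:R + 1 / 2 - 1%:R.
      have t0 : 2 ^+ r != 0 :> K by rewrite expf_neq0// pnatr_eq0.
      by rewrite /N expnS natrM natrX; field.
    rewrite /cotp qparamBn qparamD qparam_half mulrN1.
    rewrite -(opprD _ 1) invrN mulrN -mulNr; congr (_ * (_ * _)).
    by rewrite opprD !opprK.
  have -> : (0 : K) = twopii R / 2 * ((1 - 1) * (1 + 1)^-1) by rewrite subrr mul0r mulr0.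
  have l1 : (fun r => E (w / (N r)%:R) - 1) @ \oo --> (1 - 1 : K) by exact: cvgB e1 (cvg_cst _).
  have l2 : (fun r => E (w / (N r)%:R) + 1) @ \oo --> (1 + 1 : K) by exact: cvgD e1 (cvg_cst _).
  have l3 : (fun r => (E (w / (N r)%:R) + 1)^-1) @ \oo --> ((1 + 1)^-1 : K).
    by apply: cvgV l2; rewrite -(natrD _ 1 1) pnatr_eq0.
  exact: cvgM (cvg_cst _) (cvgM l1 l3).
have limV : (fun r => (N r)%:R^-1) @ \oo --> (0 : K).
  by have := @cvg_inv_pow2 R 1; under eq_fun do rewrite mul1r.
apply: cvgC_uniq As; rewrite -[X in _ --> X]subr0 -(mul0r (0 : K)).
exact: cvgB (cvg_cst _) (cvgM lim0 limV).
Unshelve. all: by end_near. Qed.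

End Cotangent.

(** * The expansion of the squared cosecant *)

Section Cosecant.
Variable R : realType.
Local Notation K := (C R).
Local Notation nm := (@ComplexField.Normc.normc R).
Local Notation E := (@qparam R).
Implicit Types (z w s : K) (f g : K -> K).

Lemma nonint_of_qparam w : E w != 1 ->
  (forall n : nat, w + n%:R != 0) /\ (forall n : nat, w - n%:R != 0).
Proof.
move=> Ew1; split=> n; apply: contraNneq Ew1 => h.
  by rewrite -(qparamDn w n) h qparam0.
by rewrite -(qparamBn w n) h qparam0.
Qed.

Lemma qparam_neq1 w : 0 < complex.Im w -> E w != 1.
Proof.
move=> w0; apply/eqP => h; have := nm_qparam w; rewrite h nm1 => /esym/eqP.
by rewrite lt_eqF// expR_lt1 oppr_lt0 !mulr_gt0// pi_gt0.
Qed.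

Lemma qparam_neq1N w : complex.Im w < 0 -> E w != 1.
Proof.
move=> w0; have := @qparam_neq1 (- w); rewrite ImCN oppr_gt0 => /(_ w0).
by rewrite qparamN invr_eq1.
Qed.

Lemma bil_cvg (f : nat -> K -> K) g w :
  (forall x : K, x != 0 -> f ^~ x @ \oo --> g x) -> E w != 1 ->
  forall j, (fun r => bil 1 (f r) w j) @ \oo --> bil 1 g w j.
Proof.
move=> hf /nonint_of_qparam[nz1 nz2].
case=> [|j]; rewrite /bil /=.
  by apply: hf; rewrite -(addr0 w); exact: (nz1 0%N).
by rewrite mulr1; exact: cvgD (hf _ (nz1 j.+1)) (hf _ (nz2 j.+1)).
Qed.

(* (pi / sin(pi w))^2 *)
Definition csc2 w : K := twopii R ^+ 2 * E w / (E w - 1) ^+ 2.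

Lemma csc2N w : csc2 (- w) = csc2 w.
Proof.
rewrite /csc2 qparamN; have := qparam_neq0 w; move: (E w) => a a0.
have [->|a1] := eqVneq a 1; first by rewrite invr1.
have h1 : a - 1 != 0 by rewrite subr_eq0.
have h2 : 1 + -1 * a != 0 by rewrite mulN1r subr_eq0 eq_sym.
by field; rewrite ?a0 ?h1 ?h2.
Qed.

Lemma cvg_mulc (u : nat -> K) (c l : K) : u @ \oo --> l ->
  (fun n => c * u n) @ \oo --> c * l.
Proof. by move=> h; exact: cvgM (cvg_cst _) h. Qed.

Lemma cvg_series_inv2 (B : R) : cvgn (series (fun j => B * @inv2 R j)).
Proof.
have -> : (fun j => B * @inv2 R j) = B *: @inv2 R by [].
by apply: is_cvg_seriesZ; exact: cvg_inv2.
Qed.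

Lemma nmV_le (x : K) (t : R) : 0 < t -> t <= nm x -> nm x^-1 <= t^-1.
Proof. by move=> t0 h; rewrite nmV lef_pV2 ?posrE// (lt_le_trans t0). Qed.

(** The cotangent expansion is differentiated term by term along h_k = i / (k + 1): since Im w >= 0,
    the points w + h_k lie in the open upper half-plane, off the poles. The difference quotient of
    1/x is 1/(x (x + h_k)) up to sign, and Tannery's theorem passes to the limit. *)
Lemma csc2_expansion_ge0 w : 0 <= complex.Im w -> E w != 1 ->
  series (bil 1 (fun x => x^-1 ^+ 2) w) @ \oo --> csc2 w.
Proof.
move=> Iw Ew1.
pose h k : K := toC (k.+1%:R^-1) * 'i%C.
have nmh k : nm (h k) = k.+1%:R^-1.
  by rewrite nmM nmR ger0_norm ?invr_ge0//= expr0n expr1n add0r sqrtr1 mulr1.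
have hn0 k : h k != 0 by rewrite -nm_gt0 nmh invr_gt0.
have h0 : h @ \oo --> (0 : K).
  apply: (@cvgC_bound _ _ _ (fun k => k.+1%:R^-1)) => [k|]; last exact: cvg_harmonic.
  by rewrite subr0 nmh.
have h1 k : nm (h k) <= 1 by rewrite nmh invf_le1// ler1n.
have Ew1' k : E (w + h k) != 1.
  apply: qparam_neq1; rewrite ImCD ImCM /= !(mulr1, mul0r, add0r, addr0).
  by rewrite ltr_wpDl// invr_gt0.
pose f k (x : K) := x^-1 * (x + h k)^-1.
have hf (x : K) : x != 0 -> f ^~ x @ \oo --> x^-1 ^+ 2.
  move=> x0; rewrite expr2; apply: cvg_mulc.
  have hx : (fun k => x + h k) @ \oo --> x.
    rewrite -[X in _ --> X]addr0; exact: cvgD (cvg_cst _) h0.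
  exact: cvgV x0 hx.
have [n0 hn0'] := nat_above (2 * (nm w + 1)).
have w0 := nm_ge0 w.
have dom k j : (0 <= k)%N -> (n0.+1 <= j)%N -> nm (bil 1 (f k) w j) <= 48 * @inv2 R j.
  move=> _ hj; have j0 : (0 < j)%N by exact: leq_trans hj.
  have hjR : n0%:R <= j%:R :> R by rewrite ler_nat ltnW.
  rewrite /bil -[X in if X then _ else _]negbK -lt0n j0 /= mulr1.
  have jp : (0 : R) < j%:R / 2 by rewrite divr_gt0// ltr0n.
  have [a1 a2] : j%:R / 2 <= nm (w + j%:R) /\ j%:R / 2 <= nm (w - j%:R).
    by apply: nat_far; lra.
  have [b1 b2] : j%:R / 2 <= nm (w + h k + j%:R) /\ j%:R / 2 <= nm (w + h k - j%:R).
    by apply: nat_far; have := nmD w (h k); have := h1 k; lra.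
  have key x y : j%:R / 2 <= nm x -> j%:R / 2 <= nm y ->
      nm (x^-1 * y^-1) <= 4 * (j%:R ^+ 2)^-1.
    move=> hx hy; rewrite nmM.
    have -> : 4 * (j%:R ^+ 2)^-1 = (j%:R / 2)^-1 * (j%:R / 2)^-1 :> R.
      by field; rewrite pnatr_eq0 -lt0n.
    by apply: ler_pM; rewrite ?nm_ge0// nmV_le.
  have -> : 48 * @inv2 R j = 8 * (6 * @inv2 R j) by ring.
  apply: (@le_trans _ _ (8 * (j%:R ^+ 2)^-1)); last first.
    by rewrite ler_wpM2l// inv_sqr_le.
  apply: le_trans (nmD _ _) _.
  have := key _ _ a1 b1; have := key _ _ a2 b2.
  by rewrite /f -!(addrAC w (h k)); lra.
have cu := @cvg_series_inv2 48.
have bilE k j : bil 1 (f k) w j =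
    (h k)^-1 * (bil 1 (fun x => x^-1) w j - bil 1 (fun x => x^-1) (w + h k) j).
  have [nz1 nz2] := nonint_of_qparam Ew1.
  have [nz1' nz2'] := nonint_of_qparam (Ew1' k).
  have key x : x != 0 -> x + h k != 0 -> f k x = (h k)^-1 * (x^-1 - (x + h k)^-1).
    move=> x0 xh0; rewrite /f; move: (h k) (hn0 k) xh0 => t t0 xt0.
    by field; rewrite x0 t0 xt0.
  have w0' : w != 0 by have := nz1 0%N; rewrite addr0.
  have wh0 : w + h k != 0 by have := nz1' 0%N; rewrite addr0.
  rewrite /bil mulr1; case: ifP => _; first exact: key.
  have e1 : w + j%:R + h k != 0 by rewrite addrAC.
  have e2 : w - j%:R + h k != 0 by rewrite addrAC.
  rewrite (key _ (nz1 j) e1) (key _ (nz2 j) e2) -mulrDr; congr (_ * _).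
  by rewrite (addrAC w (h k)) (addrAC w (h k) (- _)) opprD addrACA.
have hA k : (0 <= k)%N -> series (bil 1 (f k) w) @ \oo -->
    (h k)^-1 * (cotp w - cotp (w + h k)).
  move=> _.
  have -> : series (bil 1 (f k) w) = (fun n => (h k)^-1 *
     (series (bil 1 (fun x => x^-1) w) n - series (bil 1 (fun x => x^-1) (w + h k)) n)).
    apply/funext => n; rewrite /series /= -sumrB mulr_sumr.
    by apply: eq_bigr => j _; exact: bilE.
  by apply: cvg_mulc; exact: cvgB (cot_expansion Ew1) (cot_expansion (Ew1' k)).
have [s hs As] := tannery (bil_cvg hf Ew1) dom cu hA.
suff <- : s = csc2 w by [].
apply: cvgC_uniq As _.
have d := qparam_cvg_diff (z := w) h0 hn0.
have e1 : (fun k => E (w + h k)) @ \oo --> E w.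
  have -> : (fun k => E (w + h k)) = (fun k => E w * E (h k)).
    by apply/funext => k; rewrite qparamD.
  rewrite -[X in _ --> X]mulr1; apply: cvg_mulc; exact: cvg_qparam0.
have E1 : E w - 1 != 0 by rewrite subr_eq0.
have -> : csc2 w = twopii R / (E w - 1) * ((twopii R * E w) * (E w - 1)^-1).
  by rewrite /csc2; field.
have -> : (fun k => (h k)^-1 * (cotp w - cotp (w + h k))) =
   (fun k => twopii R / (E w - 1) * ((E (w + h k) - E w) / h k * (E (w + h k) - 1)^-1)).
  apply/funext => k; have := Ew1' k; rewrite -subr_eq0 /cotp.
  move: (E w) (E (w + h k)) E1 => a b a1 b1.
  by field; rewrite a1 b1 hn0.
apply: cvg_mulc.
have l1 : (fun k => E (w + h k) - 1) @ \oo --> E w - 1 by exact: cvgB e1 (cvg_cst _).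
exact: cvgM d (cvgV E1 l1).
Qed.

Lemma bil_even f w j : (forall x, f (- x) = f x) -> bil 1 f (- w) j = bil 1 f w j.
Proof.
move=> ef; rewrite /bil; case: ifP => _; first exact: ef.
have -> : - w + j%:R * 1 = - (w - j%:R * 1) by ring.
by rewrite -opprD !ef addrC.
Qed.

Lemma csc2_expansion w : E w != 1 ->
  series (bil 1 (fun x => x^-1 ^+ 2) w) @ \oo --> csc2 w.
Proof.
move=> Ew1; case: (leP 0 (complex.Im w)) => Iw; first exact: csc2_expansion_ge0.
rewrite -csc2N.
have -> : series (bil 1 (fun x => x^-1 ^+ 2) w) = series (bil 1 (fun x => x^-1 ^+ 2) (- w)).
  congr series; apply/funext => j; rewrite bil_even// => x.
  by rewrite invrN sqrrN.
by apply: csc2_expansion_ge0; [rewrite ImCN oppr_ge0 ltW|rewrite qparamN invr_eq1].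
Qed.

End Cosecant.

(** * The transformation law of G_2 *)

Section EisensteinSummation.
Variable R : realType.
Local Notation K := (C R).
Local Notation nm := (@ComplexField.Normc.normc R).
Local Notation E := (@qparam R).
Implicit Types (z w s : K) (f g : K -> K).

Definition invsq : K -> K := fun x => x^-1 ^+ 2.

(** This is pi^2 / 3 = 2 zeta(2), the sum of n^-2 over the nonzero integers; [invsq] skips the index
    0 by itself since 0^-1 = 0. *)
Definition zeta2 : K := - (twopii R ^+ 2) / 12.

Lemma cvg_shift_succ (u : nat -> K) (l : K) : u @ \oo --> l -> (fun n => u n.+1) @ \oo --> l.
Proof. by move=> h; rewrite (cvg_shiftS u). Qed.

Lemma cvg_inv_nat w : (fun N => (w + N%:R)^-1) @ \oo --> (0 : K).
Proof.
have [n0 hn0] := nat_above (2 * nm w).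
rewrite -(cvg_shiftn n0.+1).
apply: (@cvgC_bound _ _ _ (fun k => 2 * k.+1%:R^-1)) => [k|]; last first.
  by rewrite -(mulr0 2); exact: cvgM (cvg_cst _) cvg_harmonic.
rewrite subr0 -[2]invrK -invfM mulrC; apply: nmV_le.
  by rewrite mulr_gt0// invr_gt0.
have hk : n0%:R <= (k + n0.+1)%:R :> R by rewrite ler_nat; lia.
have [+ _] := @nat_far R w (k + n0.+1) (le_trans hn0 hk); apply: le_trans.
by rewrite ler_pM2r ?invr_gt0// ler_nat; lia.
Qed.

Lemma bil_telescope (phi : K -> K) w N :
  series (bil 1 (fun y => phi (y - 1/2) - phi (y + 1/2)) w) N.+1 =
  phi (w - N%:R - 1/2) - phi (w + N%:R + 1/2).
Proof.
elim: N => [|N IH].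
  by rewrite /series /= big_nat1 /bil /= subr0 addr0.
rewrite seriesSr IH /bil /= mulr1 -(natr1 N).
have -> : w + (N%:R + 1) - 1/2 = w + N%:R + 1/2 by field.
have -> : w - (N%:R + 1) + 1/2 = w - N%:R - 1/2 by field.
by ring.
Qed.

Lemma invsq_dom w : exists2 J, (0 < J)%N &
  forall j, (J <= j)%N -> nm (bil 1 invsq w j) <= 48 * @inv2 R j.
Proof.
have [n0 hn0] := nat_above (2 * nm w); exists n0.+1 => // j hj.
have j0 : (0 < j)%N by exact: leq_trans hj.
have hjR : n0%:R <= j%:R :> R by rewrite ler_nat ltnW.
rewrite /bil -[X in if X then _ else _]negbK -lt0n j0 /= mulr1.
have jp : (0 : R) < j%:R / 2 by rewrite divr_gt0// ltr0n.
have [a1 a2] := @nat_far R w j (le_trans hn0 hjR).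
have key x : j%:R / 2 <= nm x -> nm (invsq x) <= 4 * (j%:R ^+ 2)^-1.
  move=> hx; rewrite /invsq nmX.
  have -> : 4 * (j%:R ^+ 2)^-1 = (j%:R / 2)^-1 ^+ 2 :> R.
    by field; rewrite pnatr_eq0 -lt0n.
  by rewrite lerXn2r ?nnegrE ?nm_ge0 ?invr_ge0 ?(ltW jp)// nmV_le.
have -> : 48 * @inv2 R j = 8 * (6 * @inv2 R j) by ring.
apply: (@le_trans _ _ (8 * (j%:R ^+ 2)^-1)); last by rewrite ler_wpM2l// inv_sqr_le.
apply: le_trans (nmD _ _) _.
have := key _ a1; have := key _ a2; lra.
Qed.

Lemma qparam_half_neq1 : E (1/2) != 1.
Proof. by rewrite qparam_half -subr_eq0 -opprD oppr_eq0 -(natrD _ 1 1) pnatr_eq0. Qed.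

(* splitting the sum of 1/n^2 by the parity of n *)
Lemma zeta2_expansion : series (bil 1 invsq 0) @ \oo --> zeta2.
Proof.
have [J J0 dom] := invsq_dom 0.
have [Z hZ] := abs_cvgC dom (@cvg_series_inv2 R 48).
suff -> : zeta2 = Z by exact: hZ.
have h12 := csc2_expansion qparam_half_neq1.
(* Even indices 2 k give k^-2 and odd ones 2 k + 1 give (k + 1/2)^-2. The half-integers k + 1/2 with
   |k| <= n are not symmetric, so -(n + 1/2) is added separately. *)
have parity n : 4 * series (bil 1 invsq 0) (n + n).+2 =
    series (bil 1 invsq 0) n.+1 + series (bil 1 invsq (1/2)) n.+1
    + invsq (1/2 - n.+1%:R).
  elim: n => [|n IH].
    have s0 (c : nat -> K) : series c 0%N = 0 by rewrite /series /= big_geq.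
    rewrite addn0 !seriesSr !s0 /bil /= /invsq.
    by rewrite !(mulr1, add0r, addr0, sub0r) invr0; field.
  rewrite addSn addnS !(seriesSr _ _.+2) !mulrDr IH.
  rewrite [in RHS](seriesSr _ n.+1) [X in _ = _ + X + _](seriesSr _ n.+1).
  rewrite /bil /= /invsq !mulr1 !add0r !invrN !sqrrN.
  have a0 : n.+1%:R != 0 :> K by rewrite pnatr_eq0.
  have e2 : (n + n).+2%:R = 2 * n.+1%:R :> K by rewrite -natrM; congr _%:R; lia.
  have e3 : (n + n).+3%:R = 2 * n.+1%:R + 1 :> K by rewrite -e2 natr1.
  have b0 : 2 * n.+1%:R + 1 != 0 :> K by rewrite -e3 pnatr_eq0.
  have c0 : 1 + - n.+1%:R * 2 != 0 :> K.
    have -> : 1 + - n.+1%:R * 2 = - (n + n).+1%:R :> K.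
      by rewrite -(natr1 n) -addn1 !natrD; ring.
    by rewrite oppr_eq0 pnatr_eq0.
  rewrite e3 e2 -(natr1 n.+1).
  have -> : 1/2 - (n.+1%:R + 1) = - ((2 * n.+1%:R + 1) / 2) :> K by field.
  have -> : 1/2 + n.+1%:R = (2 * n.+1%:R + 1) / 2 :> K by field.
  rewrite invrN sqrrN; move: (n.+1%:R) a0 b0 c0 => a a0 b0 c0.
  by field; rewrite a0 b0 c0.
have l1 : (fun n => 4 * series (bil 1 invsq 0) (n + n).+2) @ \oo --> 4 * Z.
  apply: cvg_mulc; apply: (@cvg_comp _ _ _ (fun n => (n + n).+2) _ \oo) hZ.
  apply/cvgnyPge => A; near=> n.
  have : (A <= n)%N by near: n; exact: nbhs_infty_ge.
  by lia.
have l2 : (fun n => invsq (1/2 - n.+1%:R)) @ \oo --> (0 : K).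
  have -> : (fun n => invsq (1/2 - n.+1%:R)) =
      (fun n => (- (1/2) + n.+1%:R)^-1 * (- (1/2) + n.+1%:R)^-1).
    by apply/funext => n; rewrite /invsq -opprB invrN sqrrN addrC expr2.
  have h := cvg_shift_succ (@cvg_inv_nat (- (1/2))).
  rewrite -[X in _ --> X](mulr0 (0 : K)); exact: (cvgM h h).
have l3 : (fun n => series (bil 1 invsq 0) n.+1 + series (bil 1 invsq (1/2)) n.+1
    + invsq (1/2 - n.+1%:R)) @ \oo --> Z + csc2 (1/2) + 0.
  exact: cvgD (cvgD (cvg_shift_succ hZ) (cvg_shift_succ h12)) l2.
have : 4 * Z = Z + csc2 (1/2) + 0.
  by apply: cvgC_uniq l1 _; move: l3; under eq_fun do rewrite -parity.
rewrite /csc2 qparam_half addr0 => h.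
have h3 : 3 * Z = twopii R ^+ 2 * -1 / (-1 - 1) ^+ 2.
  have -> : 3 * Z = 4 * Z - Z by ring.
  by rewrite h addrAC subrr add0r.
have -> : Z = (3 * Z) / 3 by field.
rewrite h3 /zeta2.
have -> : (-1 - 1) ^+ 2 = 4 :> K by ring.
by field.
Unshelve. all: by end_near. Qed.

(** For w = 0 or w not real: the sum of (w + n)^-2 over all integers n, without the pole. *)
Definition lam w : K := if w == 0 then zeta2 else csc2 w.

Lemma lamN w : lam (- w) = lam w.
Proof. by rewrite /lam oppr_eq0; case: ifP => // _; exact: csc2N. Qed.

Lemma lam_expansion w : w = 0 \/ complex.Im w != 0 ->
  series (bil 1 invsq w) @ \oo --> lam w.
Proof.
rewrite /lam; have [->|w0] := eqVneq w 0; first by move=> _; exact: zeta2_expansion.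
case=> [w00|]; first by rewrite w00 eqxx in w0.
by rewrite neq_lt => /orP[h|h]; apply: csc2_expansion; [exact: qparam_neq1N|exact: qparam_neq1].
Qed.

(** Tannery's theorem on the partial sums over m, dominated by the total of u times v n. The product
    majorant dictates the form of the lattice bound [cc_bound]. *)
Lemma fubini_series (c : nat -> nat -> K) (u v : nat -> R) (Rr S : nat -> K) :
  (forall m n, nm (c m n) <= u m * v n) ->
  (forall m, 0 <= u m) -> (forall n, 0 <= v n) ->
  cvgn (series u) -> cvgn (series v) ->
  (forall m, series (c m) @ \oo --> Rr m) ->
  (forall n, series (c ^~ n) @ \oo --> S n) ->
  exists2 T : K, series Rr @ \oo --> T & series S @ \oo --> T.
Proof.
move=> dom u0 v0 cu cv hR hS.
pose a M n := series (c ^~ n) M.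
have nd : nondecreasing_seq (series u).
  by apply/nondecreasing_seqP => n; rewrite seriesSr lerDl.
have dom' M n : (0 <= M)%N -> (0 <= n)%N -> nm (a M n) <= limn (series u) * v n.
  move=> _ _; rewrite /a /series /= (le_trans (nm_sum _ _ _))//.
  apply: (@le_trans _ _ (\sum_(0 <= m < M) u m * v n)); first by apply: ler_sum.
  rewrite -mulr_suml ler_wpM2r//; exact: (nondecreasing_cvgn_le nd cu).
have cv' : cvgn (series (fun n => limn (series u) * v n)).
  have -> : (fun n => limn (series u) * v n) = limn (series u) *: v by [].
  by apply: is_cvg_seriesZ; exact: cv.
have hA M : (0 <= M)%N -> series (a M) @ \oo --> series Rr M.
  move=> _.
  have -> : series (a M) = (fun N => series (fun m => series (c m) N) M).
    by apply/funext => N; rewrite /series /= /a exchange_big.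
  by apply: (cvgC_series (a := fun N m => series (c m) N)) => j; exact: hR.
have [T hT hR'] := tannery hS dom' cv' hA.
by exists T.
Qed.

(** If |b| >= 2 |a z| the term b dominates; otherwise the imaginary part |a| Im z is comparable with
    |b|. The coefficients are real because shifts by 1/2 occur below. *)
Lemma lattice_lower z : 0 < complex.Im z -> exists2 k : R, 0 < k &
  forall a b : R, k * (`|a| + `|b|) <= nm (toC a * z + toC b).
Proof.
move=> z0; have n0 : 0 < nm z.
  by rewrite nm_gt0; apply: contraTneq z0 => ->; rewrite ltxx.
have ay a b : `|a| * complex.Im z <= nm (toC a * z + toC b).
  apply: le_trans (Im_le_nm _); rewrite ImCD ImCM /= mul0r !addr0.
  by rewrite normrM (gtr0_norm z0).
pose t := Num.min (1/2) (complex.Im z / (2 * nm z)).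
have t0 : 0 < t by rewrite lt_min !divr_gt0// mulr_gt0.
have tb a b : t * `|b| <= nm (toC a * z + toC b).
  have b0 := normr_ge0 b.
  case: (leP (2 * (`|a| * nm z)) `|b|) => h.
    have := nm_leD (toC b) (toC a * z); rewrite nmR nmM nmR (addrC (toC b)) => h'.
    have : t * `|b| <= 1/2 * `|b| by rewrite ler_wpM2r// ge_min lexx.
    lra.
  apply: le_trans (ay a b).
  apply: (@le_trans _ _ (complex.Im z / (2 * nm z) * `|b|)).
    by rewrite ler_wpM2r// ge_min lexx orbT.
  rewrite mulrAC ler_pdivrMr; last by rewrite mulr_gt0.
  by rewrite -mulrA mulrCA ler_wpM2l ?(ltW z0)//; lra.
exists (Num.min (complex.Im z) t / 2).
  by rewrite divr_gt0// lt_min z0 t0.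
move=> a b; have := ay a b; have := tb a b.
set m := Num.min _ _.
have h1 : m * `|a| <= complex.Im z * `|a| by rewrite ler_wpM2r// ge_min lexx.
have h2 : m * `|b| <= t * `|b| by rewrite ler_wpM2r// ge_min lexx orbT.
by lra.
Qed.

End EisensteinSummation.

Arguments invsq {R}.

(** * The telescoping correction *)

Section STransform.
Variable R : realType.
Local Notation K := (C R).
Local Notation nm := (@ComplexField.Normc.normc R).
Local Notation E := (@qparam R).
Implicit Types (w s : K) (f g : K -> K).

(** For f(x) = 1/x this is 1/(x^2 - 1/4): it matches x^-2 to leading order, telescopes over integer
    translates, and has its poles at 1/2 and -1/2, off the lattice. *)
Definition tele f : K -> K := fun x => f (x - 1/2) - f (x + 1/2).

Lemma bilB s f g w j : bil s (fun x => f x - g x) w j = bil s f w j - bil s g w j.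
Proof. by rewrite /bil; case: ifP => // _; ring. Qed.

Lemma series_bilB s f g w (l m : K) :
  series (bil s f w) @ \oo --> l -> series (bil s g w) @ \oo --> m ->
  series (bil s (fun x => f x - g x) w) @ \oo --> l - m.
Proof.
move=> hf hg.
have -> : series (bil s (fun x => f x - g x) w) =
    (fun n => series (bil s f w) n - series (bil s g w) n).
  apply/funext => n; rewrite /series /= -sumrB; apply: eq_bigr => j _.
  exact: bilB.
exact: cvgB hf hg.
Qed.

Lemma bil_swap s t f m n :
  bil s (fun x => bil t f x n) 0 m = bil t (fun y => bil s f y m) 0 n.
Proof.
rewrite /bil; case: (m == 0%N); case: (n == 0%N); rewrite ?add0r//.
rewrite (addrC (m%:R * s) (n%:R * t)) (addrC (m%:R * s) (- (n%:R * t))).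
by rewrite (addrC (- (m%:R * s)) (n%:R * t)) (addrC (- (m%:R * s)) (- (n%:R * t))) addrACA.
Qed.

Lemma bil_dilate s f w j (c : K) h : s != 0 ->
  (forall x, f (s * x) = c * h x) -> bil s f w j = c * bil 1 h (w / s) j.
Proof.
move=> s0 fh; rewrite /bil.
have -> : w = s * (w / s) by rewrite mulrC divfK.
have -> : s * (w / s) / s = w / s by rewrite mulrAC divff// mul1r.
rewrite -(mulrC s) mulr1 -mulrDr -mulrBr !fh.
by case: ifP => // _; rewrite mulrDr.
Qed.

Lemma bil_tele s f w j : bil s (tele f) w j = bil s f (w - 1/2) j - bil s f (w + 1/2) j.
Proof.
rewrite /bil /tele; case: ifP => // _.
rewrite (addrAC w (j%:R * s)) (addrAC w (j%:R * s)).
by rewrite (addrAC w (- (j%:R * s))) (addrAC w (- (j%:R * s))); ring.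
Qed.

Lemma cvg_shift_pred (u : nat -> K) (l : K) :
  (fun n => u n.+1) @ \oo --> l -> u @ \oo --> l.
Proof. by rewrite (cvg_shiftS u). Qed.

(** The boundary terms are reciprocals of w -+ (N + 1/2), so the correction leaves the row sums
    unchanged. *)
Lemma tele_inv_cvg w : series (bil 1 (tele (fun x => x^-1)) w) @ \oo --> (0 : K).
Proof.
apply: cvg_shift_pred.
have -> : (fun N => series (bil 1 (tele (fun x => x^-1)) w) N.+1) =
   (fun N => - ((1/2 - w) + N%:R)^-1 - ((w + 1/2) + N%:R)^-1).
  apply/funext => N; rewrite bil_telescope -invrN; congr (_^-1 - _^-1); ring.
have h1 : (fun N => - ((1/2 - w) + N%:R)^-1) @ \oo --> (- 0 : K).
  exact: cvgN (cvg_inv_nat _).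
have h2 : (fun N => - ((1/2 - w) + N%:R)^-1 - ((w + 1/2) + N%:R)^-1) @ \oo --> (- 0 - 0 : K).
  exact: cvgB h1 (cvg_inv_nat _).
by rewrite oppr0 addr0 in h2.
Qed.

Section FixedPoint.
Variable z : K.
Hypothesis z0 : 0 < complex.Im z.

Let zn0 : z != 0.
Proof. by apply: contraTneq z0 => ->; rewrite ltxx. Qed.

Lemma Im_inv_lt0 : complex.Im z^-1 < 0.
Proof.
case: z z0 => a b /= b0; rewrite oppr_lt0 divr_gt0// ltr_wpDl ?sqr_ge0//.
by rewrite exprn_gt0.
Qed.

Lemma Im_real_div (t : R) : t != 0 -> complex.Im (toC t / z) != 0.
Proof.
move=> t0; rewrite ImCM /= mul0r addr0 mulf_neq0// lt_eqF//; exact: Im_inv_lt0.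
Qed.

(* [x^-2] corrected by a telescoping term: [cc (m z + n)] is absolutely
   summable over the lattice, so the order of summation does not matter *)
Definition cc : K -> K := fun x => invsq x - tele (fun x => x^-1) x.

(** Away from the origin [cc x] is -1/(4 x^2 (x^2 - 1/4)), of order |x|^-4, and (m + n)^-4 is
    bounded by a product of a summable function of m and one of n. *)
Lemma cc_bound : exists2 B : R, 0 < B & forall (m n : nat) (a b : R),
  `|a| = m%:R -> `|b| = n%:R -> nm (cc (toC a * z + toC b)) <= B * (@inv2 R m * @inv2 R n).
Proof.
have [k k0 hk] := lattice_lower z0.
(* 36 comes from (j + 1)(j + 2) <= 6 (m + n)^2 for j = m and j = n; 16 covers the origin, where [cc]
   is 4 and [inv2 0] is 1/2. *)
pose B := 36 * (k ^+ 4)^-1 + 16.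
have B1 : 0 < (k ^+ 4)^-1 by rewrite invr_gt0 exprn_gt0.
exists B; first by rewrite addr_gt0// mulr_gt0.
move=> m n a b ha hb.
have [mn|mn] := posnP (m + n)%N.
  have [m0 n0] : m = 0%N /\ n = 0%N by lia.
  move: ha hb; rewrite {}m0 {}n0 => /eqP; rewrite normr_eq0 => /eqP ->.
  move=> /eqP; rewrite normr_eq0 => /eqP ->.
  rewrite rmorph0 mul0r addr0.
  have -> : cc 0 = 4 by rewrite /cc /invsq /tele invr0; field.
  rewrite nm_nat /inv2 /B; lra.
set s : R := m%:R + n%:R.
have s1 : 1 <= s by rewrite /s -natrD ler1n.
have lx : k * s <= nm (toC a * z + toC b) by have := hk a b; rewrite ha hb.
(* A shift by 1/2 loses at most half of m + n: nothing is lost in m, and n - 1/2 >= n / 2 as soon as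
   n >= 1. *)
have half (e : R) : `|e| = 1/2 -> s / 2 <= `|a| + `|b + e|.
  move=> he; rewrite ha /s.
  have := ler_normB (b + e) e; rewrite addrK he hb.
  have m0 : 0 <= m%:R :> R by [].
  case: n hb {mn s s1 lx} => [|n] hb; last by rewrite -natr1; have := ler0n R n; lra.
  by move=> _; have := normr_ge0 (b + e); lra.
have lm : k * (s / 2) <= nm (toC a * z + toC b - 1/2).
  have -> : toC a * z + toC b - 1/2 = toC a * z + toC (b - 1/2).
    by rewrite rmorphB rmorphM rmorph1 fmorphV rmorph_nat addrA.
  apply: le_trans (hk _ _); rewrite ler_wpM2l ?(ltW k0)//; apply: half.
  by rewrite normrN ger0_norm.
have lp : k * (s / 2) <= nm (toC a * z + toC b + 1/2).
  have -> : toC a * z + toC b + 1/2 = toC a * z + toC (b + 1/2).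
    by rewrite rmorphD rmorphM rmorph1 fmorphV rmorph_nat addrA.
  apply: le_trans (hk _ _); rewrite ler_wpM2l ?(ltW k0)//; apply: half.
  by rewrite ger0_norm.
set x := toC a * z + toC b in lx lm lp *.
have ks : 0 < k * s by rewrite mulr_gt0//; lra.
have ks2 : 0 < k * (s / 2) by rewrite mulr_gt0//; lra.
have x0 : x != 0 by rewrite -nm_gt0 (lt_le_trans ks).
have xm : x - 1/2 != 0 by rewrite -nm_gt0 (lt_le_trans ks2).
have xp : x + 1/2 != 0 by rewrite -nm_gt0 (lt_le_trans ks2).
have -> : cc x = - (4^-1 * (x^-1 * x^-1 * ((x - 1/2)^-1 * (x + 1/2)^-1))).
  rewrite /cc /tele /invsq; move: x x0 xm xp {lx lm lp} => x x0 xm xp.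
  have cm : x * 2 - 1 != 0.
    have -> : x * 2 - 1 = (x - 1/2) * 2 by field.
    by rewrite mulf_neq0// pnatr_eq0.
  have cp : x * 2 + 1 != 0.
    have -> : x * 2 + 1 = (x + 1/2) * 2 by field.
    by rewrite mulf_neq0// pnatr_eq0.
  by field; rewrite cm cp x0.
rewrite nmN !nmM !nmV nm_nat.
have i1 : (nm x)^-1 <= (k * s)^-1 by rewrite lef_pV2 ?posrE ?nm_gt0.
have i2 : (nm (x - 1/2))^-1 <= (k * (s / 2))^-1 by rewrite lef_pV2 ?posrE ?nm_gt0.
have i3 : (nm (x + 1/2))^-1 <= (k * (s / 2))^-1 by rewrite lef_pV2 ?posrE ?nm_gt0.
have g0 y : 0 <= (nm y)^-1 by rewrite invr_ge0 nm_ge0.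
apply: (@le_trans _ _ ((k ^+ 4)^-1 * (s ^+ 4)^-1)).
  have -> : (k ^+ 4)^-1 * (s ^+ 4)^-1 = 4^-1 * ((k * s)^-1 * (k * s)^-1 *
     ((k * (s / 2))^-1 * (k * (s / 2))^-1)).
    by field; rewrite !gt_eqF//; lra.
  by rewrite ler_wpM2l// ler_pM// ?mulr_ge0// ler_pM.
have hs : (s ^+ 4)^-1 <= 36 * (@inv2 R m * @inv2 R n).
  have m0 : 0 <= m%:R :> R by [].
  have n0 : 0 <= n%:R :> R by [].
  rewrite /inv2 -invfM -[leLHS]mul1r ler_pdivrMr ?exprn_gt0//; last lra.
  rewrite mulrAC ler_pdivlMr ?mulr_gt0// mul1r.
  have fm (j : nat) : j%:R <= s -> 0 <= (j.+1%:R * j.+2%:R : R) <= 6 * s ^+ 2.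
    by have := ler0n R j; rewrite -(natr1 j.+1) -(natr1 j) => h h'; apply/andP; split; nra.
  have /andP[p1 p2] : 0 <= (m.+1%:R * m.+2%:R : R) <= 6 * s ^+ 2 by apply: fm; rewrite /s; lra.
  have /andP[p3 p4] : 0 <= (n.+1%:R * n.+2%:R : R) <= 6 * s ^+ 2 by apply: fm; rewrite /s; lra.
  have -> : 36 * s ^+ 4 = (6 * s ^+ 2) * (6 * s ^+ 2) by ring.
  by apply: ler_pM.
have q0 : 0 <= @inv2 R m * @inv2 R n by rewrite mulr_ge0// ltW// inv2_gt0.
apply: (@le_trans _ _ ((k ^+ 4)^-1 * (36 * (@inv2 R m * @inv2 R n)))).
  by rewrite ler_wpM2l// ltW.
by rewrite mulrCA mulrA /B ler_wpM2r//; lra.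
Qed.

End FixedPoint.
End STransform.

(** * Summation over the lattice in both orders *)

Section LatticeSums.
Variable R : realType.
Local Notation K := (C R).
Local Notation nm := (@ComplexField.Normc.normc R).
Local Notation E := (@qparam R).
Local Notation lam := (@lam R).
Implicit Types (w s : K) (f g : K -> K).

Lemma cvg_seriesD (a b : nat -> K) (l m : K) :
  series a @ \oo --> l -> series b @ \oo --> m ->
  series (fun j => a j + b j) @ \oo --> l + m.
Proof.
move=> ha hb.
have -> : series (fun j => a j + b j) = (fun n => series a n + series b n).
  by apply/funext => n; rewrite /series /= big_split.
exact: cvgD ha hb.
Qed.

Lemma bil0 s f j : bil s f 0 j =
  if j == 0%N then f 0 else f (j%:R * s) + f (- (j%:R * s)).
Proof. by rewrite /bil add0r sub0r. Qed.

Lemma bil10 f j : bil 1 f 0 j = if j == 0%N then f 0 else f j%:R + f (- j%:R).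
Proof. by rewrite bil0 mulr1. Qed.

Section FixedPoint.
Variable z : K.
Hypothesis z0 : 0 < complex.Im z.

Let zn0 : z != 0.
Proof. by apply: contraTneq z0 => ->; rewrite ltxx. Qed.

Lemma cc_double_bound : exists2 B : R, 0 < B & forall m n,
  nm (bil z (fun x => bil 1 (@cc R) x n) 0 m) <= B * (@inv2 R m * @inv2 R n).
Proof.
have [B B0 hB] := cc_bound z0; exists (4 * B); first by rewrite mulr_gt0.
move=> m n.
have arg (e1 e2 : R) : `|e1| = 1 -> `|e2| = 1 ->
    nm (cc (toC (e1 * m%:R) * z + toC (e2 * n%:R))) <= B * (@inv2 R m * @inv2 R n).
  move=> h1 h2; apply: hB; rewrite normrM (ger0_norm (ler0n _ _)) ?h1 ?h2 mul1r//.
have n1 : `|1 : R| = 1 := normr1 _.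
have n2 : `|-1 : R| = 1 by rewrite normrN1.
have a1 := arg _ _ n1 n1; have a2 := arg _ _ n1 n2.
have a3 := arg _ _ n2 n1; have a4 := arg _ _ n2 n2.
have e1 : toC (1 * m%:R) = m%:R :> K by rewrite mul1r rmorph_nat.
have e2 : toC (-1 * m%:R) = - m%:R :> K by rewrite mulN1r rmorphN rmorph_nat.
have e3 : toC (1 * n%:R) = n%:R :> K by rewrite mul1r rmorph_nat.
have e4 : toC (-1 * n%:R) = - n%:R :> K by rewrite mulN1r rmorphN rmorph_nat.
rewrite e1 e3 in a1; rewrite e1 e4 in a2; rewrite e2 e3 in a3; rewrite e2 e4 in a4.
have p0 : 0 <= B * (@inv2 R m * @inv2 R n) by exact: le_trans (nm_ge0 _) a1.
have -> : 4 * B * (@inv2 R m * @inv2 R n) = 4 * (B * (@inv2 R m * @inv2 R n)) by rewrite -mulrA.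
move: (B * (@inv2 R m * @inv2 R n)) p0 a1 a2 a3 a4 => Q p0 a1 a2 a3 a4.
rewrite mulNr in a3 a4.
rewrite /bil mulr1 !add0r.
case: eqP => m0; case: eqP => n0.
- by rewrite m0 n0 mul0r addr0 in a1; lra.
- rewrite m0 mul0r !add0r in a1 a2; by apply: le_trans (nmD _ _) _; lra.
- rewrite n0 addr0 in a1; rewrite n0 addr0 in a3.
  apply: (@le_trans _ _ (Q + Q)); last lra.
  by apply: le_trans (nmD _ _) _; exact: lerD.
apply: le_trans (nmD _ _) _.
apply: (@le_trans _ _ ((Q + Q) + (Q + Q))); last lra.
by apply: lerD; apply: le_trans (nmD _ _) _; exact: lerD.
Qed.

Lemma cc_row w : w = 0 \/ complex.Im w != 0 ->
  series (bil 1 (@cc R) w) @ \oo --> lam w.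
Proof.
move=> hw; have h1 := lam_expansion hw; have h2 := @tele_inv_cvg R w.
have := series_bilB h1 h2; rewrite subr0; exact.
Qed.

(** The symmetric sum of 1/(u + m z) over all integers m, for u / z not an integer. *)
Definition cz (u : K) : K := z^-1 * cotp (u / z).

Lemma czN u : cz (- u) = - cz u.
Proof. by rewrite /cz mulNr cotpN mulrN. Qed.

Lemma qparam_neq1_Im w : complex.Im w != 0 -> E w != 1.
Proof.
by rewrite neq_lt => /orP[h|h]; [exact: qparam_neq1N|exact: qparam_neq1].
Qed.

Lemma bil_dilate_series f h (c : K) w (l : K) :
  (forall x, f (z * x) = c * h x) ->
  series (bil 1 h (w / z)) @ \oo --> l -> series (bil z f w) @ \oo --> c * l.
Proof.
move=> fh hl.
have -> : series (bil z f w) = (fun n => c * series (bil 1 h (w / z)) n).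
  apply/funext => n; rewrite /series /= mulr_sumr; apply: eq_bigr => j _.
  exact: bil_dilate.
exact: cvg_mulc.
Qed.

(** Dilation by z reduces a sum over t + m z to one over t / z + m. Here the correction survives as
    a difference of two cotangents; the condition on t keeps t - 1/2 and t + 1/2 away from 0. *)
Lemma cc_col (t : R) : t = 0 \/ 1/2 < `|t| ->
  series (bil z (@cc R) (toC t)) @ \oo -->
  invsq z * lam (toC t / z) - tele cz (toC t).
Proof.
move=> ht.
have h1 : series (bil z invsq (toC t)) @ \oo --> invsq z * lam (toC t / z).
  apply: (bil_dilate_series (h := invsq)).
    by move=> x; rewrite /invsq invfM exprMn.
  apply: lam_expansion; have [->|t0] := eqVneq t 0.
    by left; rewrite rmorph0 mul0r.
  by right; exact: Im_real_div.
have hc (u : R) : u != 0 -> series (bil z (fun x => x^-1) (toC u)) @ \oo --> cz (toC u).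
  move=> u0; apply: (bil_dilate_series (h := fun x => x^-1)).
    by move=> x; rewrite invfM.
  by apply: cot_expansion; apply: qparam_neq1_Im; exact: Im_real_div.
have em : toC t - 1/2 = toC (t - 1/2).
  by rewrite rmorphB rmorphM rmorph1 fmorphV rmorph_nat.
have ep : toC t + 1/2 = toC (t + 1/2).
  by rewrite rmorphD rmorphM rmorph1 fmorphV rmorph_nat.
have h2 : series (bil z (tele (fun x => x^-1)) (toC t)) @ \oo --> tele cz (toC t).
  have -> : series (bil z (tele (fun x => x^-1)) (toC t)) =
    (fun n => series (bil z (fun x => x^-1) (toC t - 1/2)) n
            - series (bil z (fun x => x^-1) (toC t + 1/2)) n).
    apply/funext => n; rewrite /series /= -sumrB; apply: eq_bigr => j _.
    exact: bil_tele.
  rewrite /tele em ep.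
  have tm : t - 1/2 != 0.
    apply/eqP => h; have t12 : t = 1/2 by lra.
    by case: ht => [|]; rewrite t12 ?ger0_norm; lra.
  have tp : t + 1/2 != 0.
    apply/eqP => h; have t12 : t = - (1/2) by lra.
    by case: ht => [|]; rewrite t12 ?normrN ?ger0_norm; lra.
  exact: cvgB (hc _ tm) (hc _ tp).
exact: series_bilB h1 h2.
Qed.

(** The point (N + 1/2) / z goes to infinity in the lower half-plane, where |q| grows without bound
    and pi cot tends to pi i. *)
Lemma cvg_cz : (fun N => cz (N%:R + 1/2)) @ \oo --> z^-1 * (twopii R / 2).
Proof.
apply: cvg_mulc; pose t := - complex.Im z^-1.
have t0 : 0 < t by rewrite oppr_gt0; exact: Im_inv_lt0.
apply: (@cvgC_bound _ _ _ (fun N => 2 * pi * (t^-1 * N.+1%:R^-1))) => [N|]; last first.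
  rewrite -(mulr0 (2 * pi)); apply: cvgM; first exact: cvg_cst.
  by rewrite -(mulr0 t^-1); apply: cvgM; [exact: cvg_cst|exact: cvg_harmonic].
set w := (_ / z).
have Iw : complex.Im w = - (t * (N%:R + 1/2)).
  have -> : w = toC (N%:R + 1/2) / z.
    by rewrite rmorphD rmorphM rmorph1 fmorphV !rmorph_nat.
  by rewrite ImCM /= mul0r addr0 /t; ring.
have p2 := @pi_ge2 R; have n0 : 0 <= N%:R :> R := ler0n _ _.
have big : t * N.+1%:R <= nm (E w - 1).
  have := nm_leD (E w) (-1); rewrite nmN nm1 nm_qparam Iw.
  have := expR_ge1Dx (- (2 * pi * - (t * (N%:R + 1/2)))).
  have q : 4 * (t * (N%:R + 1/2)) <= 2 * pi * (t * (N%:R + 1/2)).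
    by rewrite ler_wpM2r//; [rewrite mulr_ge0 ?ltW//; lra|lra].
  have q2 : t * N.+1%:R <= 4 * (t * (N%:R + 1/2)).
    by rewrite -natr1; nra.
  rewrite mulrN opprK; lra.
have tN : 0 < t * N.+1%:R by rewrite mulr_gt0.
have E1 : E w - 1 != 0 by rewrite -nm_gt0 (lt_le_trans tN).
have -> : cotp w - twopii R / 2 = twopii R * (E w - 1)^-1.
  by rewrite /cotp; field.
by rewrite nmM nm_twopii -invfM ler_wpM2l ?mulr_ge0 ?pi_ge0// nmV_le.
Qed.

(** The rows of [cc] add up to [lam] at m z, the columns to z^-2 [lam] at n / z minus [tele cz] at
    n. Over |n| <= N the last terms telescope to -2 cz(N + 1/2), by oddness of [cz]; equating both
    orders of summation leaves 2 cz(N + 1/2), with limit 2 pi i / z. *)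
Lemma lam_S (G G' : K) :
  series (bil z lam 0) @ \oo --> G ->
  series (bil (- z^-1) lam 0) @ \oo --> G' ->
  G = invsq z * G' + twopii R / z.
Proof.
move=> hG hG'; have [B B0 hB] := cc_double_bound.
pose Sn n := bil 1 (fun y => invsq z * lam (y / z) - tele cz y) 0 n.
have i0 j : 0 <= @inv2 R j by rewrite ltW// inv2_gt0.
have [|||||||T hT hT'] := @fubini_series R
    (fun m n => bil z (fun x => bil 1 (@cc R) x n) 0 m)
    (fun m => B * @inv2 R m) (@inv2 R) (bil z lam 0) Sn.
- by move=> m n; rewrite -mulrA.
- by move=> m; rewrite mulr_ge0// ltW.
- exact: i0.
- exact: cvg_series_inv2.
- exact: cvg_inv2.
- move=> m; rewrite bil0; case: ifPn => m0.
    have -> : (fun n => bil z (fun x => bil 1 (@cc R) x n) 0 m) = bil 1 (@cc R) 0.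
      by apply/funext => n; rewrite bil0 m0.
    by apply: cc_row; left.
  have Im0 : complex.Im (m%:R * z) != 0.
    rewrite -(rmorph_nat (@toC R)) ImCM /= mul0r addr0 mulf_neq0 ?pnatr_eq0//.
    by rewrite gt_eqF.
  have -> : (fun n => bil z (fun x => bil 1 (@cc R) x n) 0 m) =
      (fun n => bil 1 (@cc R) (m%:R * z) n + bil 1 (@cc R) (- (m%:R * z)) n).
    by apply/funext => n; rewrite bil0 (negPf m0).
  apply: cvg_seriesD; apply: cc_row; right => //.
  by rewrite ImCN oppr_eq0.
- move=> n.
  have -> : (fun m => bil z (fun x => bil 1 (@cc R) x n) 0 m) =
      (fun m => bil 1 (fun y => bil z (@cc R) y m) 0 n).
    by apply/funext => m; exact: bil_swap.
  rewrite /Sn bil10; case: ifPn => n0.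
    have -> : (fun m => bil 1 (fun y => bil z (@cc R) y m) 0 n) = bil z (@cc R) 0.
      by apply/funext => m; rewrite bil10 n0.
    have := @cc_col 0 (or_introl erefl); rewrite rmorph0; exact.
  have -> : (fun m => bil 1 (fun y => bil z (@cc R) y m) 0 n) =
      (fun m => bil z (@cc R) n%:R m + bil z (@cc R) (- n%:R) m).
    by apply/funext => m; rewrite bil10 (negPf n0).
  have n1 : 1/2 < `|n%:R| :> R.
    have : 1 <= n%:R :> R by rewrite ler1n lt0n.
    by rewrite ger0_norm//; lra.
  have h1 : series (bil z (@cc R) n%:R) @ \oo -->
      invsq z * lam (n%:R / z) - tele cz n%:R.
    by have := @cc_col n%:R (or_intror n1); rewrite rmorph_nat.
  have h2 : series (bil z (@cc R) (- n%:R)) @ \oo -->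
      invsq z * lam (- n%:R / z) - tele cz (- n%:R).
    have := @cc_col (- n%:R); rewrite normrN rmorphN rmorph_nat => h.
    exact: h (or_intror n1).
  apply: cvg_seriesD. exact: h1. exact: h2.
have -> : G = T by exact: cvgC_uniq hG hT.
have c2 : (fun N => invsq z * series (bil (- z^-1) lam 0) N.+1 + 2 * cz (N%:R + 1/2)) @ \oo -->
    invsq z * G' + 2 * (z^-1 * (twopii R / 2)).
  have c1 : (fun N => invsq z * series (bil (- z^-1) lam 0) N.+1) @ \oo --> invsq z * G'.
    apply: cvg_mulc; exact: (cvg_shift_succ hG').
  have c3 : (fun N => 2 * cz (N%:R + 1/2)) @ \oo --> 2 * (z^-1 * (twopii R / 2)).
    apply: cvg_mulc; exact: cvg_cz.
  exact: cvgD c1 c3.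
have -> : twopii R / z = 2 * (z^-1 * (twopii R / 2)) by field.
suff : (fun N => invsq z * series (bil (- z^-1) lam 0) N.+1 + 2 * cz (N%:R + 1/2)) @ \oo --> T.
  by move=> c4; exact: (cvgC_uniq c4 c2).
have -> : (fun N => invsq z * series (bil (- z^-1) lam 0) N.+1 + 2 * cz (N%:R + 1/2)) =
   (fun N => series Sn N.+1); last exact: (cvg_shift_succ hT').
apply/funext => N.
have -> : series Sn N.+1 = series (bil 1 (fun y => invsq z * lam (y / z)) 0) N.+1
   - series (bil 1 (tele cz) 0) N.+1.
  by rewrite /series /= -sumrB; apply: eq_bigr => j _; exact: bilB.
rewrite bil_telescope sub0r add0r.
have -> : - N%:R - 1/2 = - (N%:R + 1/2) :> K by rewrite opprD.
rewrite czN -opprD opprK mulr_natl mulr2n; congr (_ + _).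
rewrite /series /= mulr_sumr; apply: eq_bigr => j _.
rewrite /bil !(add0r, sub0r, mulr1, mul0r); case: ifP => // _.
by rewrite mulrN opprK mulNr mulrDr [X in _ = X]addrC.
Qed.

End FixedPoint.
End LatticeSums.

(** * Modular forms from q-series *)

Section PolynomialGrowth.
Variable R : realType.

(** Each step of the induction on k absorbs one factor n + 1 into a larger ratio below 1, by
    Bernoulli's inequality. *)
Lemma poly_geometric_le (k : nat) (r : R) : 0 <= r -> r < 1 ->
  exists M r' : R, [/\ 0 <= M, 0 < r', r' < 1 &
    forall n, n.+1%:R ^+ k * r ^+ n <= M * r' ^+ n].
Proof.
move=> r0 r1; elim: k => [|k [M [r' [M0 r'0 r'1 h]]]].
  exists 1, ((1 + r) / 2); split; [by []|lra|lra|] => n.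
  by rewrite expr0 !mul1r lerXn2r ?nnegrE//; lra.
pose r2 := (1 + r') / 2; pose x := r2 / r'.
have x1 : 1 < x by rewrite /x ltr_pdivlMr// /r2; lra.
pose c := Num.min 1 (x - 1).
have c0 : 0 < c by rewrite lt_min ltr01 subr_gt0.
exists (M / c), r2; split; [by rewrite divr_ge0// ltW|rewrite /r2; lra|rewrite /r2; lra|] => n.
have bern : n.+1%:R * c <= x ^+ n.
  have : 1 + n%:R * (x - 1) <= x ^+ n.
    elim: n => [|n IH]; first by rewrite mul0r addr0 expr0.
    rewrite exprS -natr1.
    have : x * (1 + n%:R * (x - 1)) <= x * x ^+ n by rewrite ler_wpM2l//; lra.
    have := mulr_ge0 (ler0n R n) (sqr_ge0 (x - 1)); lra.
  have c1 : c <= 1 by rewrite ge_min lexx.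
  have c2 : c <= x - 1 by rewrite ge_min lexx orbT.
  have := ler_wpM2l (ler0n R n) c2; rewrite -natr1; lra.
rewrite exprS -mulrA.
apply: (@le_trans _ _ (n.+1%:R * (M * r' ^+ n))); first by rewrite ler_wpM2l.
have -> : M / c * r2 ^+ n = (x ^+ n / c) * (M * r' ^+ n).
  have -> : r2 ^+ n = x ^+ n * r' ^+ n by rewrite -exprMn divfK// gt_eqF.
  by ring.
by rewrite ler_wpM2r ?mulr_ge0// ?exprn_ge0 ?(ltW r'0)// ler_pdivlMr.
Qed.

Lemma cvg_poly_geometric (k : nat) (r : R) : 0 <= r -> r < 1 ->
  cvgn (series (fun n => n.+1%:R ^+ k * r ^+ n)).
Proof.
move=> r0 r1; have [M [r' [M0 r'0 r'1 h]]] := poly_geometric_le k r0 r1.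
apply: (@series_le_cvg _ _ (fun n => M * r' ^+ n)) => [n|n|n|].
- by rewrite mulr_ge0// exprn_ge0.
- by rewrite mulr_ge0// exprn_ge0// ltW.
- exact: h.
- by apply: is_cvg_geometric_series; rewrite ger0_norm// ltW.
Qed.

End PolynomialGrowth.

(** Polynomial growth gives convergence on |q| < 1 and is stable under sums, Cauchy products and D,
    so all series built from the [gser] are covered without further analysis. *)
Definition qgrowth (a : qseries) : Prop :=
  exists k (B : rat), 0 <= B /\ forall n, `|a n| <= B * n.+1%:R ^+ k.


Lemma qgrowthD a b : qgrowth a -> qgrowth b -> qgrowth (qadd a b).
Proof.
move=> [k [B [B0 h]]] [l [B' [B'0 h']]].
exists (k + l)%N, (B + B'); split=> [|n]; first exact: addr_ge0.
rewrite (le_trans (ler_normD _ _))// mulrDl lerD//.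
  rewrite (le_trans (h n))// ler_wpM2l// exprD ler_peMr ?exprn_ge0//.
  by rewrite exprn_ege1// ler1n.
rewrite (le_trans (h' n))// ler_wpM2l// exprD ler_peMl ?exprn_ge0//.
by rewrite exprn_ege1// ler1n.
Qed.

Lemma qgrowthZ c a : qgrowth a -> qgrowth (qscale c a).
Proof.
move=> [k [B [B0 h]]]; exists k, (`|c| * B); split=> [|n]; first by rewrite mulr_ge0.
by rewrite normrM -mulrA ler_wpM2l.
Qed.

Lemma qgrowth_qD a : qgrowth a -> qgrowth (qD a).
Proof.
move=> [k [B [B0 h]]]; exists k.+1, B; split=> [//|n].
rewrite normrM normr_nat exprS mulrCA ler_pM// ler_nat//.
Qed.

Lemma qgrowthM a b : qgrowth a -> qgrowth b -> qgrowth (qmul a b).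
Proof.
move=> [k [B [B0 h]]] [l [B' [B'0 h']]].
exists (k + l).+1, (B * B'); split=> [|n]; first exact: mulr_ge0.
rewrite (le_trans (ler_norm_sum _ _ _))//.
apply: (@le_trans _ _ (\sum_(i < n.+1) (B * n.+1%:R ^+ k) * (B' * n.+1%:R ^+ l))).
  apply: ler_sum => i _; rewrite normrM; apply: ler_pM => //.
    rewrite (le_trans (h i))// ler_wpM2l// lerXn2r ?nnegrE// ler_nat.
    by have := ltn_ord i; lia.
  rewrite (le_trans (h' _))// ler_wpM2l// lerXn2r ?nnegrE// ler_nat; lia.
rewrite sumr_const card_ord -mulr_natl exprS exprD.
by rewrite le_eqVlt; apply/orP; left; apply/eqP; ring.
Qed.

(** * Values of q-series in the unit disc *)

Section PowerSeries.
Variable R : realType.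
Local Notation K := (C R).
Local Notation nm := (@ComplexField.Normc.normc R).
Local Notation E := (@qparam R).
Implicit Types (q z w : K) (a b : qseries).

Definition qterm a q : nat -> K := fun n => ratr (a n) * q ^+ n.

Lemma nm_ratr (x : rat) : nm (ratr x) = ratr `|x| :> R.
Proof. by rewrite -(fmorph_rat (@toC R)) nmR ratr_norm. Qed.

Lemma qterm_dom a : qgrowth a -> exists k (B : R), 0 <= B /\
  forall q n, nm (qterm a q n) <= B * (n.+1%:R ^+ k * nm q ^+ n).
Proof.
move=> [k [B [B0 h]]]; exists k, (ratr B); split; first by rewrite ler0q.
move=> q n; rewrite /qterm nmM nmX nm_ratr mulrA ler_wpM2r ?exprn_ge0 ?nm_ge0//.
have := h n; rewrite -(ler_rat R) rmorphM rmorphXn /= ratr_nat; exact.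
Qed.

Lemma cvg_scaled (c : R) (u : nat -> R) : cvgn (series u) ->
  cvgn (series (fun n => c * u n)).
Proof.
move=> h; have -> : (fun n => c * u n) = c *: u by [].
by apply: is_cvg_seriesZ; exact: h.
Qed.

Lemma qterm_cvg a q : qgrowth a -> nm q < 1 ->
  exists s : K, series (qterm a q) @ \oo --> s.
Proof.
move=> /qterm_dom[k [B [B0 h]]] q1.
apply: (@abs_cvgC R _ (fun n => B * (n.+1%:R ^+ k * nm q ^+ n)) 0%N) => //.
by apply: cvg_scaled; apply: cvg_poly_geometric => //; exact: nm_ge0.
Qed.

Definition qval a q : K := limn (series (qterm a q)).

Lemma qvalP a q : qgrowth a -> nm q < 1 -> series (qterm a q) @ \oo --> qval a q.
Proof. by move=> ga /(qterm_cvg ga)[s hs]; apply/cvg_ex; exists s. Qed.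

Lemma qval_uniq a q (s : K) : series (qterm a q) @ \oo --> s -> qval a q = s.
Proof. by move=> h; apply/cvg_lim => //. Qed.

Lemma qvalD a b q : qgrowth a -> qgrowth b -> nm q < 1 ->
  qval (qadd a b) q = qval a q + qval b q.
Proof.
move=> ga gb q1; apply: qval_uniq.
have -> : qterm (qadd a b) q = (fun n => qterm a q n + qterm b q n).
  by apply/funext => n; rewrite /qterm /qadd rmorphD mulrDl.
exact: cvg_seriesD (qvalP ga q1) (qvalP gb q1).
Qed.

Lemma cvg_series_mulc (c : K) (u : nat -> K) (l : K) : series u @ \oo --> l ->
  series (fun n => c * u n) @ \oo --> c * l.
Proof.
move=> h; have -> : series (fun n => c * u n) = (fun n => c * series u n).
  by apply/funext => n; rewrite /series /= mulr_sumr.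
exact: cvg_mulc.
Qed.

Lemma qvalZ c a q : qgrowth a -> nm q < 1 ->
  qval (qscale c a) q = ratr c * qval a q.
Proof.
move=> ga q1; apply: qval_uniq.
have -> : qterm (qscale c a) q = (fun n => ratr c * qterm a q n).
  by apply/funext => n; rewrite /qterm /qscale rmorphM mulrA.
exact: cvg_series_mulc (qvalP ga q1).
Qed.

Lemma qvalM a b q : qgrowth a -> qgrowth b -> nm q < 1 ->
  qval (qmul a b) q = qval a q * qval b q.
Proof.
move=> ga gb q1; apply: qval_uniq.
pose c m n : K := if (m <= n)%N then qterm a q m * qterm b q (n - m)%N else 0.
have [k [B [B0 hB]]] := qterm_dom ga; have [l [B' [B'0 hB']]] := qterm_dom gb.
have n0 := nm_ge0 q.
(* For m <= n, |q|^m |q|^(n - m) = r^(2 n) <= r^m r^n: the square root yields the product majorant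
   that the interchange requires. *)
pose r := Num.sqrt (nm q).
have r0 : 0 <= r := sqrtr_ge0 _.
have r2 : r ^+ 2 = nm q by rewrite sqr_sqrtr.
have r1 : r < 1 by rewrite -sqrtr1 ltr_sqrt.
pose u m := B * (m.+1%:R ^+ k * r ^+ m).
pose v m := B' * (m.+1%:R ^+ l * r ^+ m).
have u0 m : 0 <= u m by rewrite !mulr_ge0// exprn_ge0.
have v0 m : 0 <= v m by rewrite !mulr_ge0// exprn_ge0.
have dom m n : nm (c m n) <= u m * v n.
  rewrite /c; case: leqP => mn; last by rewrite nm0 mulr_ge0.
  rewrite nmM (le_trans (ler_pM (nm_ge0 _) (nm_ge0 _) (hB q m) (hB' q (n - m)%N)))//.
  apply: (@le_trans _ _ (B * (m.+1%:R ^+ k * nm q ^+ m) * (B' * (n.+1%:R ^+ l * nm q ^+ (n - m))))).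
    rewrite ler_wpM2l ?mulr_ge0 ?exprn_ge0// ler_wpM2l// ler_wpM2r ?exprn_ge0//.
    by rewrite lerXn2r ?nnegrE// ler_nat ltnS leq_subr.
  have -> : B * (m.+1%:R ^+ k * nm q ^+ m) * (B' * (n.+1%:R ^+ l * nm q ^+ (n - m)))
     = B * B' * (m.+1%:R ^+ k * n.+1%:R ^+ l) * (nm q ^+ m * nm q ^+ (n - m)) by ring.
  have -> : u m * v n = B * B' * (m.+1%:R ^+ k * n.+1%:R ^+ l) * (r ^+ m * r ^+ n).
    by rewrite /u /v; ring.
  rewrite ler_wpM2l ?mulr_ge0 ?exprn_ge0// -!exprD subnKC// -r2 -exprM.
  by rewrite ler_wiXn2l// ?(ltW r1)//; lia.
have cu : cvgn (series u) by apply: cvg_scaled; exact: cvg_poly_geometric.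
have cv : cvgn (series v) by apply: cvg_scaled; exact: cvg_poly_geometric.
have hR m : series (c m) @ \oo --> qterm a q m * qval b q.
  rewrite -(cvg_shiftn m).
  have -> : (fun n => series (c m) (n + m)%N) = (fun n => qterm a q m * series (qterm b q) n).
    apply/funext => n; rewrite addnC series_shift /series /= big_nat big1 ?add0r; last first.
      by move=> i /andP[_ im]; rewrite /c leqNgt im.
    have -> : \sum_(m <= j < m + n) c m j = \sum_(0 <= j < n) c m (j + m)%N.
      by rewrite -{1}(add0n m) big_addn addKn.
    rewrite mulr_sumr; apply: eq_bigr => j _.
    by rewrite /c leq_addl addnK.
  apply: cvg_mulc; exact: (qvalP gb q1).
have hS n : series (c ^~ n) @ \oo --> qterm (qmul a b) q n.
  have -> : qterm (qmul a b) q n = series (c ^~ n) n.+1.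
    rewrite /qterm /qmul rmorph_sum mulr_suml /series /= big_mkord.
    apply: eq_bigr => i _; have im : (i <= n)%N by rewrite -ltnS.
    by rewrite /c im /qterm rmorphM [RHS]mulrACA -exprD subnKC.
  by apply: series_finite_support => j nj; rewrite /c leqNgt nj.
have [T hT hT'] := fubini_series dom u0 v0 cu cv hR hS.
suff <- : T = qval a q * qval b q by [].
apply: cvgC_uniq hT _; rewrite mulrC.
have -> : (fun m => qterm a q m * qval b q) = (fun m => qval b q * qterm a q m).
  by apply/funext => m; rewrite mulrC.
exact: cvg_series_mulc (qvalP ga q1).
Qed.

End PowerSeries.

(** * Complex derivatives of q-series *)

Lemma is_derive_comp_num (K : numFieldType) (f g : K -> K) (z df dg : K) :
  is_derive z 1 f df -> is_derive (f z) 1 g dg ->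
  is_derive z 1 (g \o f) (dg * df).
Proof.
move=> [/derivable1_diffP df1 <-] [/derivable1_diffP dg1 <-].
have dc : differentiable (g \o f) z by exact: differentiable_comp.
split; first exact/derivable1_diffP.
rewrite -!derive1E derive1E' // diff_comp // !derive1E' //= -[X in 'd  _ _ X = _]mulr1.
by rewrite [LHS]linearZ mulrC.
Qed.

Section ComplexDerivatives.
Variable R : realType.
Local Notation K := (C R).
Local Notation nm := (@ComplexField.Normc.normc R).
Local Notation E := (@qparam R).
Implicit Types (q z w : K) (a b : qseries).

(** An explicit quadratic remainder can be summed term by term; the exponential and the power series
    are both differentiated through it. *)
Lemma quad_is_derive (f : K -> K) (z l : K) (d M : R) : 0 < d ->
  (forall h, nm h <= d -> nm (f (z + h) - f z - h * l) <= M * nm h ^+ 2) ->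
  is_derive z (1 : K) f l.
Proof.
move=> d0 hq.
have M0 : 0 <= M.
  have := hq (toC d); rewrite nmR gtr0_norm// => /(_ (lexx _)) h.
  by have := le_trans (nm_ge0 _) h; rewrite pmulr_lge0// exprn_gt0.
have key : (fun h : K => h^-1 *: ((f \o shift z) (h *: (1 : K)) - f z)) @ 0^' --> l.
  apply/cvgrPdist_le => e e0.
  have re0 : 0 < complex.Re e by move: e0; case: (e) => x y; rewrite ltcE => /andP[].
  have eE : e = toC (complex.Re e).
    by move: e0; case: (e) => x y; rewrite ltcE /= => /andP[/eqP -> _].
  pose d' := Num.min d (complex.Re e / (M + 1)).
  have d'0 : 0 < d' by rewrite lt_min d0 divr_gt0//; lra.
  have d'C : 0 < toC d' by rewrite ltcR.
  near=> h.
  have hn0 : h != 0 by near: h; exact: nbhs_dnbhs_neq.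
  have hd : nm h < d'.
    by rewrite -ltcR -normCE; near: h; exact: dnbhs0_lt.
  rewrite normCE eE lecR /= -[h *: 1]/(h * 1) mulr1.
  have hd1 : nm h <= d by rewrite (le_trans (ltW hd))// ge_min lexx.
  have hd2 : nm h <= complex.Re e / (M + 1) by rewrite (le_trans (ltW hd))// ge_min lexx orbT.
  have := hq h hd1; rewrite (addrC z h).
  have -> : f (h + z) - f z - h * l = - (h * (l - h^-1 * (f (h + z) - f z))).
    by rewrite mulrBr mulrA divff// mul1r opprB.
  have nh : 0 < nm h by rewrite nm_gt0.
  rewrite nmN nmM expr2 mulrCA ler_pM2l// => h1.
  rewrite -[h^-1 *: _]/(h^-1 * _); apply: (le_trans h1).
  move: hd2; rewrite ler_pdivlMr; last lra.
  by have := mulr_ge0 M0 (ltW nh); lra.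
split; first by apply/cvg_ex; exists l.
exact: cvg_lim key.
Unshelve. all: by end_near. Qed.

Lemma is_derive_uniq (f : K -> K) (z d1 d2 : K) :
  is_derive z (1 : K) f d1 -> is_derive z (1 : K) f d2 -> d1 = d2.
Proof. by move=> [_ <-] [_ <-]. Qed.

Lemma is_derive_qparam z : is_derive z (1 : K) E (twopii R * E z).
Proof.
apply: (@quad_is_derive _ _ _ (1/16) (nm (E z) * 512)); first by lra.
by move=> h hh; exact: qparam_quad.
Qed.

(** The factor rho^2 on the left avoids the exponent n - 2, which is negative for n < 2. *)
Lemma expn_quad q k (rho : R) n : nm q + nm k <= rho ->
  rho ^+ 2 * nm ((q + k) ^+ n - q ^+ n - k * (n%:R * q ^+ n.-1))
  <= n%:R ^+ 2 * nm k ^+ 2 * rho ^+ n.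
Proof.
move=> hr; have q0 := nm_ge0 q; have k0 := nm_ge0 k.
have r0 : 0 <= rho by lra.
elim: n => [|n IH].
  by rewrite !expr0 subrr mul0r mulr0 subr0 nm0 mulr0 expr0n !mul0r.
have -> : (q + k) ^+ n.+1 - q ^+ n.+1 - k * (n.+1%:R * q ^+ n) =
   (q + k) * ((q + k) ^+ n - q ^+ n - k * (n%:R * q ^+ n.-1))
   + k ^+ 2 * (n%:R * q ^+ n.-1).
  rewrite -natr1; case: n {IH} => [|n] /=; first by rewrite !expr0 !expr1; ring.
  by rewrite !(exprS _ n.+1) (exprS q n); ring.
set e := _ - _ - _ in IH *.
apply: (@le_trans _ _ (rho ^+ 2 * (rho * nm e + nm k ^+ 2 * (n%:R * nm q ^+ n.-1)))).
  rewrite ler_wpM2l ?sqr_ge0// (le_trans (nmD _ _))// !nmM nm_nat !nmX lerD2r.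
  by rewrite ler_wpM2r ?nm_ge0// (le_trans (nmD _ _)).
have h1 : rho * (rho ^+ 2 * nm e) <= rho * (n%:R ^+ 2 * nm k ^+ 2 * rho ^+ n) by rewrite ler_wpM2l.
have h2 : rho ^+ 2 * (n%:R * nm q ^+ n.-1) <= n%:R * rho ^+ n.+1.
  case: (n) => [|m] /=; first by rewrite !mul0r mulr0.
  rewrite mulrCA ler_wpM2l// (exprS _ m.+1) (exprS _ m) mulrA -expr2 ler_wpM2l ?sqr_ge0//.
  by rewrite lerXn2r ?nnegrE//; lra.
have h3 : nm k ^+ 2 * (rho ^+ 2 * (n%:R * nm q ^+ n.-1)) <= nm k ^+ 2 * (n%:R * rho ^+ n.+1).
  by rewrite ler_wpM2l ?sqr_ge0.
apply: (@le_trans _ _ ((n%:R ^+ 2 + n%:R) * (nm k ^+ 2 * rho ^+ n.+1))).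
  by move: h1 h3; rewrite (exprS rho n); lra.
rewrite -mulrA ler_wpM2r ?mulr_ge0 ?exprn_ge0//.
by rewrite -natr1; have := ler0n R n; nra.
Qed.

(** Since D is q d/dq, the derivative is the value of D a divided by q. The remainder of q^n costs a
    factor n^2, which raises the growth exponent from k to k + 2. *)
Lemma is_derive_qval a q : qgrowth a -> q != 0 -> nm q < 1 ->
  is_derive q (1 : K) (@qval R a) (qval (qD a) q / q).
Proof.
move=> ga qn0 q1; have [k [B [B0 hB]]] := @qterm_dom R _ ga.
have gD := qgrowth_qD ga.
have n0 := nm_ge0 q.
pose rho := (1 + nm q) / 2; have r0 : 0 < rho by rewrite /rho; lra.
have r1 : rho < 1 by rewrite /rho; lra.
pose b n := B * (n.+1%:R ^+ k.+2 * rho ^+ n).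
have cb : cvgn (series b) by apply: cvg_scaled; apply: cvg_poly_geometric; lra.
apply: (@quad_is_derive _ _ _ ((1 - nm q) / 2) ((limn (series b)) / rho ^+ 2)); first lra.
move=> h hh.
have qh : nm q + nm h <= rho by rewrite /rho; lra.
have qh1 : nm (q + h) < 1 by have := nmD q h; lra.
pose e n := qterm a (q + h) n - qterm a q n - h / q * qterm (qD a) q n.
have he : series e @ \oo --> qval a (q + h) - qval a q - h * (qval (qD a) q / q).
  have -> : h * (qval (qD a) q / q) = h / q * qval (qD a) q by rewrite mulrCA mulrC.
  have -> : series e = (fun n => series (qterm a (q + h)) n - series (qterm a q) n
      - series (fun n => h / q * qterm (qD a) q n) n).
    by apply/funext => n; rewrite /series /= -!sumrB.
  have c3 := cvg_series_mulc (qvalP gD q1) (c := h / q).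
  exact: cvgB (cvgB (qvalP ga qh1) (qvalP ga q1)) c3.
pose b' n := b n * (nm h ^+ 2 / rho ^+ 2).
have eb n : (0 <= n)%N -> nm (e n) <= b' n.
  move=> _.
  have -> : e n = ratr (a n) * ((q + h) ^+ n - q ^+ n - h * (n%:R * q ^+ n.-1)).
    rewrite /e /qterm /qD rmorphM /= ratr_nat; case: n => [|n].
      by rewrite !expr0; ring.
    by rewrite (exprS q n); field.
  have h2 := @expn_quad q h rho n qh.
  have h1 : nm (ratr (a n)) <= B * n.+1%:R ^+ k.
    by have := hB 1 n; rewrite /qterm expr1n mulr1 nm1 expr1n mulr1.
  rewrite nmM /b' (mulrA (b n)) ler_pdivlMr ?exprn_gt0// -mulrA.
  rewrite [nm (_ - _) * _]mulrC.
  apply: (le_trans (ler_pM (nm_ge0 _) _ h1 h2)).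
    by rewrite mulr_ge0 ?nm_ge0// sqr_ge0.
  have -> : B * n.+1%:R ^+ k * (n%:R ^+ 2 * nm h ^+ 2 * rho ^+ n) =
    n%:R ^+ 2 * (B * n.+1%:R ^+ k * (nm h ^+ 2 * rho ^+ n)) by ring.
  have -> : b n * nm h ^+ 2 =
    n.+1%:R ^+ 2 * (B * n.+1%:R ^+ k * (nm h ^+ 2 * rho ^+ n)).
    by rewrite /b -addn2 exprD; ring.
  rewrite ler_wpM2r ?mulr_ge0 ?exprn_ge0 ?nm_ge0 ?(ltW r0)//.
  by rewrite lerXn2r ?nnegrE// ler_nat.
have cb' : series b' @ \oo --> limn (series b) * (nm h ^+ 2 / rho ^+ 2).
  have -> : series b' = (fun n => series b n * (nm h ^+ 2 / rho ^+ 2)).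
    by apply/funext => n; rewrite /series /= mulr_suml.
  exact: cvgM cb (cvg_cst _).
have cb1 : cvgn (series b') by apply/cvg_ex; eexists; exact: cb'.
have := series_tail eb cb1 he.
have z0 (V : zmodType) (c : nat -> V) : series c 0%N = 0 by rewrite /series /= big_geq.
rewrite !z0 !subr0 => h1; apply: (le_trans h1).
have -> : limn (series b') = limn (series b) * (nm h ^+ 2 / rho ^+ 2) by exact/cvg_lim.
by rewrite le_eqVlt; apply/orP; left; apply/eqP; ring.
Qed.

Definition qfun a z : K := qval a (E z).

Lemma nm_qparam_lt1 z : 0 < complex.Im z -> nm (E z) < 1.
Proof.
by move=> z0; rewrite nm_qparam expR_lt1 oppr_lt0 !mulr_gt0// pi_gt0.
Qed.

Lemma is_derive_qfun a z : qgrowth a -> 0 < complex.Im z ->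
  is_derive z (1 : K) (qfun a) (twopii R * qfun (qD a) z).
Proof.
move=> ga z0.
have := is_derive_comp_num (is_derive_qparam z)
  (is_derive_qval ga (qparam_neq0 z) (nm_qparam_lt1 z0)).
congr is_derive; rewrite /qfun mulrCA divfK//; exact: qparam_neq0.
Qed.

End ComplexDerivatives.

Lemma qgrowth_gser k : qgrowth (gser k).
Proof.
exists k.-1.+1, (`|gser k 0| + 1); split=> [|n]; first by rewrite addr_ge0.
case: n => [|n]; first by rewrite expr1n mulr1 lerDl.
rewrite /gser /= normr_nat.
apply: (@le_trans _ _ ((n.+2%:R) ^+ k.-1.+1)).
  by rewrite -natrX ler_nat (leq_trans (sigma_le _ _))// leq_exp2r.
by rewrite ler_peMl ?exprn_ge0// lerDr.
Qed.

(** * The Lambert series of G_2 *)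

Section Lambert.
Variable R : realType.
Local Notation K := (C R).
Local Notation nm := (@ComplexField.Normc.normc R).
Local Notation E := (@qparam R).
Implicit Types (q z w x : K).

Lemma sum_arith_geometric x k :
  (1 - x) ^+ 2 * \sum_(0 <= d < k) (d%:R * x ^+ d) =
  x * (1 - x ^+ k) - k%:R * x ^+ k * (1 - x).
Proof.
elim: k => [|k IH]; first by rewrite big_geq// expr0; ring.
by rewrite big_nat_recr//= mulrDr IH (exprS x k) -(natr1 k); ring.
Qed.

Lemma cvg_arith_geometric x : nm x < 1 ->
  series (fun d => d%:R * x ^+ d) @ \oo --> x / (1 - x) ^+ 2.
Proof.
move=> x1; have x10 : 1 - x != 0.
  by rewrite subr_eq0; apply: contraTneq x1 => <-; rewrite nm1 ltxx.
have cu : cvgn (series (fun n => n.+1%:R ^+ 1 * nm x ^+ n)).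
  by apply: cvg_poly_geometric => //; exact: nm_ge0.
have u0 := cvg_series_cvg_0 cu.
have l1 : (fun k => k%:R * x ^+ k) @ \oo --> (0 : K).
  apply: (cvgC_bound _ u0) => k; rewrite subr0 nmM nm_nat nmX expr1.
  by rewrite ler_wpM2r ?exprn_ge0 ?nm_ge0// ler_nat.
have l2 : (fun k => x ^+ k) @ \oo --> (0 : K).
  apply: (cvgC_bound _ u0) => k; rewrite subr0 nmX expr1 ler_peMl ?exprn_ge0 ?nm_ge0//.
  by rewrite ler1n.
have -> : series (fun d => d%:R * x ^+ d) = (fun k => ((1 - x) ^+ 2)^-1 *
    (x * (1 - x ^+ k) - k%:R * x ^+ k * (1 - x))).
  apply/funext => k; rewrite -sum_arith_geometric mulrA mulVf ?mul1r//.
  by rewrite expf_neq0.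
have -> : x / (1 - x) ^+ 2 = ((1 - x) ^+ 2)^-1 * (x * (1 - 0) - 0 * (1 - x)).
  by rewrite mul0r !subr0 mulr1 mulrC.
apply: cvg_mulc.
have l3 : (fun k => x * (1 - x ^+ k)) @ \oo --> x * (1 - 0).
  apply: cvg_mulc; exact: cvgB (cvg_cst _) l2.
have l4 : (fun k => k%:R * x ^+ k * (1 - x)) @ \oo --> 0 * (1 - x).
  exact: cvgM l1 (cvg_cst _).
exact: cvgB l3 l4.
Qed.

(** Expanding q^m/(1 - q^m)^2 as the sum of d q^(m d) and collecting n = m d produces sigma_1(n).
    The 1/24 removes the constant term -B_2/4 of G_2. *)
Lemma lambert q : nm q < 1 ->
  series (fun m => if m == 0%N then 0 else q ^+ m / (1 - q ^+ m) ^+ 2) @ \oo -->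
  qval (gser 2) q + ratr (1/24).
Proof.
move=> q1; have n0 := nm_ge0 q.
pose c m n : K := if [&& (0 < n)%N, (0 < m)%N & (m %| n)%N] then (n %/ m)%:R * q ^+ n else 0.
(* For m dividing n > 0, (m + 1)(m + 2) (n / m) <= 6 (n + 1)^3, so [inv2] can be split off in m. *)
pose v n := 6 * (n.+1%:R ^+ 3 * nm q ^+ n).
have i0 j : 0 <= @inv2 R j by rewrite ltW// inv2_gt0.
have v0 n : 0 <= v n by rewrite !mulr_ge0// exprn_ge0.
have cv : cvgn (series v) by apply: cvg_scaled; exact: cvg_poly_geometric.
have dom m n : nm (c m n) <= @inv2 R m * v n.
  rewrite /c; case: ifP => [/and3P[n1 m1 mn]|_]; last by rewrite nm0 mulr_ge0.
  rewrite nmM nm_nat nmX /v mulrA mulrA ler_wpM2r ?exprn_ge0//.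
  have mn' := dvdn_leq n1 mn.
  have m0 : (0 : R) < m.+1%:R * m.+2%:R by rewrite mulr_gt0.
  rewrite /inv2 [leRHS]mulrC ler_pdivlMr// -!natrM -natrX -natrM ler_nat.
  have : (n %/ m <= n)%N by exact: leq_div.
  move: (n %/ m)%N => d dn; rewrite !expnS expn0 muln1.
  have h1 : (m.+1 * m.+2 <= 6 * (n.+1 * n.+1))%N by nia.
  nia.
have hR m : series (c m) @ \oo --> (if m == 0%N then 0 else q ^+ m / (1 - q ^+ m) ^+ 2 : K).
  case: eqP => [->|/eqP m0].
    have -> : c 0%N = (fun _ => 0) by apply/funext => n; rewrite /c andbF.
    have -> : series (fun _ : nat => (0 : K)) = (fun _ => 0).
      by apply/funext => n; rewrite /series /= big1.
    exact: cvg_cst.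
  have m1 : (0 < m)%N by rewrite lt0n.
  have [s hs] : exists s : K, series (c m) @ \oo --> s.
    apply: (@abs_cvgC R _ (fun n => @inv2 R m * v n) 0%N) => //.
    exact: cvg_scaled.
  suff <- : s = q ^+ m / (1 - q ^+ m) ^+ 2 by [].
  have qm : nm (q ^+ m) < 1 by rewrite nmX exprn_ilt1//.
  apply: cvgC_uniq (cvg_arith_geometric qm).
  have -> : series (fun d => d%:R * (q ^+ m) ^+ d) = (fun k => series (c m) (m * k)%N).
    apply/funext => k; elim: k => [|k IH]; first by rewrite muln0 /series /= !big_geq.
    rewrite seriesSr IH mulnS addnC series_shift; congr (_ + _).
    rewrite big_ltn; last by rewrite -[X in (X < _)%N]addn0 ltn_add2l.
    rewrite big_nat big1 ?addr0 => [|j /andP[j1 j2]].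
      rewrite /c m1 dvdn_mulr//= andbT muln_gt0 m1 /= mulKn// exprM.
      by case: k {IH} => [|k]; rewrite ?mul0r.
    rewrite /c; case: ifP => // /and3P[_ _ /dvdnP[t tj]]; move: j1 j2.
    by rewrite {j}tj (addnC (m * k)%N) -mulnS (mulnC t) !ltn_pmul2l// ltnS ltnNge => /negPf ->.
  apply: (@cvg_comp _ _ _ (fun k => (m * k)%N) _ \oo) hs.
  apply/cvgnyPge => A; near=> k.
  by rewrite (@leq_trans k)//; [near: k; exact: nbhs_infty_ge|rewrite leq_pmull].
have hS n : series (c ^~ n) @ \oo -->
    (if n == 0%N then 0 else qterm (gser 2) q n : K).
  case: eqP => [->|/eqP n1].
    have -> : c ^~ 0%N = (fun _ => 0) by [].
    have -> : series (fun _ : nat => (0 : K)) = (fun _ => 0).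
      by apply/funext => N; rewrite /series /= big1.
    exact: cvg_cst.
  have n2 : (0 < n)%N by rewrite lt0n.
  have -> : qterm (gser 2) q n = series (c ^~ n) n.+1.
    rewrite /qterm /gser (negPf n1) ratr_nat /sigma /= -(sum_divisors_compl _ n2).
    rewrite -(sum_divisorsE _ n2 (leqnn n)) natr_sum mulr_suml /series /= big_mkcond/=.
    by apply: eq_bigr => m _; rewrite /c n2 expn1; case: ifP.
  apply: series_finite_support => m nm; rewrite /c; case: ifP => // /and3P[_ _ mn].
  by have := dvdn_leq n2 mn; rewrite leqNgt nm.
have [T hT hT'] := fubini_series dom i0 v0 (@cvg_inv2 R) cv hR hS.
suff <- : T = qval (gser 2) q + ratr (1/24) by [].
have h1 := qvalP (qgrowth_gser 2) q1.
apply: cvgC_uniq hT' _.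
have h0 : qterm (gser 2) q 0 + ratr (1/24) = 0.
  rewrite /qterm expr0 mulr1 -rmorphD /gser /= bernoulli2.
  by rewrite -(rmorph0 (@ratr K)); congr ratr; field.
apply: cvg_shift_pred.
have -> : (fun N => series (fun n => if n == 0%N then 0 else qterm (gser 2) q n) N.+1)
   = (fun N => series (qterm (gser 2) q) N.+1 + ratr (1/24)).
  apply/funext => N; rewrite /series /= !big_nat_recl// [RHS]addrAC h0 /=.
  by rewrite !add0r.
exact: cvgD (cvg_shift_succ h1) (cvg_cst _).
Unshelve. all: by end_near. Qed.
End Lambert.

(** * Weights under z |-> -1/z and the Serre derivative *)

Lemma is_derive_neg_inv (K : numFieldType) (z : K) : z != 0 ->
  is_derive z 1 (fun x => - x^-1) (z ^- 2).
Proof.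
move=> z0.
have h : is_derive z 1 (fun x : K => (id x)^-1) (- (z ^- 2) *: (1 : K)).
  apply: DeriveDef; first by apply: derivableV => //; exact: derivable_id.
  by rewrite deriveV// derive_id.
have := is_deriveN h; congr is_derive.
by rewrite scaleNr opprK -[_ *: _]/(_ * _) mulr1.
Qed.

Lemma is_derive_expn (K : numFieldType) (z : K) n :
  is_derive z 1 (fun x => x ^+ n) (n%:R * z ^+ n.-1).
Proof.
apply: DeriveDef; first exact: exprn_derivable.
by rewrite exp_derive -[_ *: _]/(_ * _) -[_ *: _]/(_ * _) mulr1.
Qed.

Lemma is_derive_mul (K : numFieldType) (f g : K -> K) (z df dg : K) :
  is_derive z 1 f df -> is_derive z 1 g dg ->
  is_derive z 1 (fun x => f x * g x) (f z * dg + g z * df).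
Proof. exact: is_deriveM. Qed.

Lemma is_derive_add_linear (K : numFieldType) (f : K -> K) (z df c : K) :
  is_derive z 1 f df -> is_derive z 1 (fun x => f x + c * x) (df + c).
Proof.
move=> hf; apply: is_deriveD.
have := is_derive_mul (is_derive_cst c z 1) (is_derive_id z 1).
by rewrite mulr0 addr0 mulr1.
Qed.

Section WeightClass.
Variable R : realType.
Local Notation K := (C R).
Local Notation nm := (@ComplexField.Normc.normc R).
Local Notation E := (@qparam R).
Local Notation tau := (twopii R).
Implicit Types (z : K) (w : nat) (a b : qseries).

Lemma upper_neq0 z : 0 < complex.Im z -> z != 0.
Proof. by move=> z0; apply: contraTneq z0 => ->; rewrite ltxx. Qed.

Lemma upper_neg_inv z : 0 < complex.Im z -> 0 < complex.Im (- z^-1).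
Proof. by move=> z0; rewrite ImCN oppr_gt0; exact: Im_inv_lt0. Qed.

(** The indices m and -m give equal terms, twice the Lambert term in q^m; the term [zeta2] at m = 0
    cancels the 1/24 of the Lambert series. *)
Lemma lam_sum z : 0 < complex.Im z ->
  series (bil z (@lam R) 0) @ \oo --> 2 * tau ^+ 2 * qfun (gser 2) z.
Proof.
move=> z0; have q1 := nm_qparam_lt1 z0.
have hl := lambert q1; set u := (fun m : nat => _) in hl.
have h1 := @cvg_series_mulc R (2 * tau ^+ 2) _ _ hl.
pose d (m : nat) : K := if m == 0%N then zeta2 R else 0.
have h2 : series d @ \oo --> zeta2 R.
  have -> : zeta2 R = series d 1%N by rewrite /series /= big_nat1.
  by apply: series_finite_support => -[].
have -> : bil z (@lam R) 0 = (fun m => 2 * tau ^+ 2 * u m + d m).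
  apply/funext => m; rewrite bil0 /u /d; case: eqP => m0.
    by rewrite mulr0 add0r /lam eqxx.
  rewrite addr0 lamN /lam mulf_eq0 pnatr_eq0 (negPf (upper_neq0 z0)) orbF.
  rewrite (introF eqP m0) /csc2 qparamMn -mulr2n -mulr_natl -!mulrA.
  by rewrite -[1 - _]opprB sqrrN mul1r mulr_natl.
have -> : 2 * tau ^+ 2 * qfun (gser 2) z =
  2 * tau ^+ 2 * (qval (gser 2) (E z) + ratr (1/24)) + zeta2 R.
  have -> : ratr (1/24) = 1/24 :> K by rewrite rmorphM rmorph1 fmorphV rmorph_nat.
  by rewrite /qfun /zeta2; field.
exact: (cvg_seriesD h1 h2).
Qed.

Lemma g2_S z : 0 < complex.Im z ->
  qfun (gser 2) (- z^-1) = z ^+ 2 * qfun (gser 2) z - z / (2 * tau).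
Proof.
move=> z0; have := lam_S z0 (lam_sum z0) (lam_sum (upper_neg_inv z0)).
have zn := upper_neq0 z0; have tn := twopii_neq0 R; rewrite /invsq.
move: (qfun _ z) (qfun _ (- z^-1)) => x y h.
have -> : y = z ^+ 2 / (2 * tau ^+ 2) *
   (z^-1 ^+ 2 * (2 * tau ^+ 2 * y) + tau / z - tau / z) by field; rewrite zn tn.
by rewrite -h; field; rewrite tn zn.
Qed.

(* the transformation law under the single generator z |-> -1/z; invariance
   under z |-> z + 1 is built into the q-expansion *)
Definition modS (w : nat) a : Prop :=
  qgrowth a /\ forall z, 0 < complex.Im z ->
    qfun a (- z^-1) = z ^+ w * qfun a z.

Lemma qfunD a b z : qgrowth a -> qgrowth b -> 0 < complex.Im z ->
  qfun (qadd a b) z = qfun a z + qfun b z.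
Proof. by move=> ga gb z0; apply: qvalD => //; exact: nm_qparam_lt1. Qed.

Lemma qfunZ c a z : qgrowth a -> 0 < complex.Im z ->
  qfun (qscale c a) z = ratr c * qfun a z.
Proof. by move=> ga z0; apply: qvalZ => //; exact: nm_qparam_lt1. Qed.

Lemma qfunM a b z : qgrowth a -> qgrowth b -> 0 < complex.Im z ->
  qfun (qmul a b) z = qfun a z * qfun b z.
Proof. by move=> ga gb z0; apply: qvalM => //; exact: nm_qparam_lt1. Qed.

Lemma modS_add w a b : modS w a -> modS w b -> modS w (qadd a b).
Proof.
move=> [ga ha] [gb hb]; split=> [|z z0]; first exact: qgrowthD.
by rewrite !qfunD ?upper_neg_inv// ha// hb// mulrDr.
Qed.

Lemma modS_scale w c a : modS w a -> modS w (qscale c a).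
Proof.
move=> [ga ha]; split=> [|z z0]; first exact: qgrowthZ.
by rewrite !qfunZ ?upper_neg_inv// ha// mulrCA.
Qed.

Lemma modS_mul w v a b : modS w a -> modS v b -> modS (w + v) (qmul a b).
Proof.
move=> [ga ha] [gb hb]; split=> [|z z0]; first exact: qgrowthM.
by rewrite !qfunM ?upper_neg_inv// ha// hb// exprD mulrACA.
Qed.

Lemma near_upper z : 0 < complex.Im z -> \forall x \near z, 0 < complex.Im x.
Proof.
move=> z0; have e0 : 0 < toC (complex.Im z) by rewrite ltcR.
near=> x.
have : `|z - x| < toC (complex.Im z).
  near: x; exact: cvgr_dist_lt.
rewrite normCE ltcR => h; have := le_lt_trans (Im_le_nm _) h.
rewrite ImCD ImCN ltr_norml => /andP[_]; lra.
Unshelve. all: by end_near. Qed.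

(* differentiating the transformation law of a under z |-> -1/z *)
Lemma qfun_qD_S a (phi : K -> K) (dphi z : K) : qgrowth a -> 0 < complex.Im z ->
  (forall x, 0 < complex.Im x -> qfun a (- x^-1) = phi x) ->
  is_derive z (1 : K) phi dphi ->
  tau * qfun (qD a) (- z^-1) = z ^+ 2 * dphi.
Proof.
move=> ga z0 h dp; have zn := upper_neq0 z0.
have d1 := is_derive_comp_num (is_derive_neg_inv zn) (is_derive_qfun ga (upper_neg_inv z0)).
have d2 : is_derive z (1 : K) (@qfun R a \o (fun x => - x^-1)) dphi.
  apply: near_eq_is_derive dp; near=> x; apply/esym/h.
  by near: x; exact: near_upper.
rewrite -(is_derive_uniq d1 d2); field; exact: zn.
Unshelve. all: by end_near. Qed.

Lemma qgrowth_g2 : qgrowth (gser 2). Proof. exact: qgrowth_gser. Qed.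

(** Differentiating the law of a leaves the extra term w z^(w+1) a / (2 pi i), which the anomaly
    -z/(4 pi i) of G_2, multiplied by 2 w, cancels. *)
Lemma modS_serre w a : modS w a ->
  modS w.+2 (qadd (qD a) (qscale (2 * w)%N%:R (qmul (gser 2) a))).
Proof.
move=> [ga ha]; have gD := qgrowth_qD ga; have gM := qgrowthM qgrowth_g2 ga.
split=> [|z z0]; first exact: (qgrowthD gD (qgrowthZ _ gM)).
have z0' := upper_neg_inv z0; have zn := upper_neq0 z0; have tn := twopii_neq0 R.
have gZ := qgrowthZ (2 * w)%N%:R gM; have g2 := qgrowth_g2.
rewrite !qfunD ?qfunZ ?qfunM//.
rewrite ha// g2_S// ratr_nat.
have := qfun_qD_S ga z0 ha (is_derive_mul (is_derive_expn z w) (is_derive_qfun ga z0)).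
move=> h; have -> : qfun (qD a) (- z^-1) = tau^-1 * (tau * qfun (qD a) (- z^-1)) by field.
rewrite h natrM; case: (w) => [|k].
  by rewrite !expr0 /=; field.
by rewrite (exprS z k.+2) (exprS z k.+1) (exprS z k) /=; field; exact: tn.
Qed.

(** The coefficient is 2 and not 2 w = 4, since both factors of G_2^2 carry the anomaly. Its square
    then cancels the derivative of the linear term in the law of G_2. *)
Lemma modS_g2 : modS 4 (qadd (qD (gser 2)) (qscale 2 (qmul (gser 2) (gser 2)))).
Proof.
have ga := qgrowth_g2; have gD := qgrowth_qD ga; have gM := qgrowthM ga ga.
split=> [|z z0]; first exact: (qgrowthD gD (qgrowthZ _ gM)).
have z0' := upper_neg_inv z0; have zn := upper_neq0 z0; have tn := twopii_neq0 R.
have gZ := qgrowthZ 2 gM.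
rewrite !qfunD ?qfunZ ?qfunM//.
have dphi : is_derive z (1 : K) (fun x => x ^+ 2 * qfun (gser 2) x + (- (2 * tau)^-1) * x)
   ((z ^+ 2 * (tau * qfun (qD (gser 2)) z) + qfun (gser 2) z * (2%:R * z ^+ 1)) + (- (2 * tau)^-1)).
  apply: is_derive_add_linear.
  exact: is_derive_mul (is_derive_expn z 2) (is_derive_qfun ga z0).
have h := qfun_qD_S ga z0 _ dphi.
have -> : qfun (qD (gser 2)) (- z^-1) = tau^-1 * (tau * qfun (qD (gser 2)) (- z^-1)) by field.
rewrite h; last by move=> x x0; rewrite g2_S//= mulNr [X in _ = _ - X]mulrC.
rewrite g2_S// ratr_nat.
by field; exact: tn.
Qed.

End WeightClass.

(** * From z |-> -1/z to the full modular group *)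

Lemma det_mx22 (A : 'M[int]_2) : \det A = A 0 0 * A 1 1 - A 0 1 * A 1 0.
Proof.
rewrite (expand_det_row _ 0) !big_ord_recl big_ord0 addr0 /cofactor !det_mx11.
rewrite !mxE /= expr0 expr1 mul1r mulN1r mulrN.
by congr (_ * A _ _ - A _ _ * A _ _); apply: val_inj.
Qed.

Section FullModularGroup.
Variable R : realType.
Local Notation K := (C R).
Local Notation nm := (@ComplexField.Normc.normc R).
Local Notation E := (@qparam R).
Implicit Types (z : K) (w : nat) (a : qseries) (g : 'M[int]_2).

Lemma qfun_int a z (m : int) : qfun a (z + m%:~R) = qfun a z.
Proof.
rewrite /qfun; case: m => n; first by rewrite -pmulrn qparamDn.
by rewrite NegzE mulrNz -pmulrn qparamBn.
Qed.

Lemma intr_toC (m : int) : m%:~R = toC m%:~R :> K.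
Proof. by rewrite rmorph_int. Qed.

Lemma Re_real_lin (m n : R) z :
  complex.Re (toC m * z + toC n) = m * complex.Re z + n.
Proof. by rewrite ReCD ReCM /=; ring. Qed.

Lemma Im_real_lin (m n : R) z :
  complex.Im (toC m * z + toC n) = m * complex.Im z.
Proof. by rewrite ImCD ImCM /=; ring. Qed.

Lemma automorphy_neq0 g z : \det g = 1 -> 0 < complex.Im z -> automorphy g z != 0.
Proof.
rewrite det_mx22 => dg z0; apply/eqP; rewrite /automorphy !intr_toC => h.
have := congr1 (@complex.Im R) h; rewrite Im_real_lin /= => /eqP.
rewrite mulf_eq0 (gt_eqF z0) orbF intr_eq0 => /eqP c0.
have := congr1 (@complex.Re R) h; rewrite Re_real_lin c0 mul0r add0r /= => /eqP.
rewrite intr_eq0 => /eqP d0; move: dg; rewrite c0 d0 !mulr0 subr0; lia.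
Qed.

Lemma Im_moebius g z : \det g = 1 -> 0 < complex.Im z -> 0 < complex.Im (moebius g z).
Proof.
move=> dg z0; have jn := automorphy_neq0 dg z0; rewrite /moebius.
move: jn; rewrite /automorphy !intr_toC; set v := _ + toC (g 1 1)%:~R => jn.
have v2 : 0 < nm v ^+ 2 by rewrite exprn_gt0// nm_gt0.
have iv : v^-1 = ((complex.Re v / nm v ^+ 2) -i* (complex.Im v / nm v ^+ 2))%C :> K.
  by rewrite sqr_nm; case: (v).
rewrite ImCM iv /= Re_real_lin Im_real_lin /v Re_real_lin Im_real_lin -/v.
have d1 : (g 0 0)%:~R * (g 1 1)%:~R - (g 0 1)%:~R * (g 1 0)%:~R = 1 :> R.
  by rewrite -!rmorphM -rmorphB -det_mx22 dg.
rewrite mulrN !mulrA -mulNr -mulrDl divr_gt0//.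
set A := (g 0 0)%:~R in d1 *; set B := (g 0 1)%:~R in d1 *.
set C0 := (g 1 0)%:~R in d1 *; set D := (g 1 1)%:~R in d1 *.
have -> : - ((A * complex.Re z + B) * C0 * complex.Im z) +
  A * complex.Im z * (C0 * complex.Re z + D) = (A * D - B * C0) * complex.Im z by ring.
by rewrite d1 mul1r.
Qed.

Lemma modS_transform w a : ~~ odd w -> modS R w a ->
  forall g, \det g = 1 -> forall z, 0 < complex.Im z ->
  qfun a (moebius g z) = automorphy g z ^+ w * qfun a z.
Proof.
move=> ew [ga ha] g; have [n] := ubnP (absz (g 1 0)); elim: n g => // n IH g.
rewrite ltnS => gn dg z z0.
have dg' := dg; rewrite det_mx22 in dg'.
have [c0|c0] := eqVneq (g 1 0) 0.
  rewrite c0 mulr0 subr0 in dg'.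
  (* A lower left entry 0 leaves a translation up to sign; the even weight takes care of the
     sign. *)
  have [[a1 d1]|[a1 d1]] : (g 0 0 = 1 /\ g 1 1 = 1) \/ (g 0 0 = -1 /\ g 1 1 = -1).
    move: (g 0 0) (g 1 1) dg' => x y xy.
    have /eqP : (absz x * absz y)%N = 1%N by rewrite -abszM xy.
    rewrite muln_eq1 => /andP[/eqP x1 /eqP y1].
    have [hx|hx] : x = 1 \/ x = -1 by lia.
      by left; move: xy; rewrite hx; lia.
    by right; move: xy; rewrite hx; lia.
  - rewrite /moebius /automorphy c0 a1 d1 mul0r add0r divr1 mul1r expr1n mul1r.
    exact: qfun_int.
  - rewrite /moebius /automorphy c0 a1 d1 mul0r add0r mulrN1z.
    rewrite -signr_odd (negPf ew) expr0 mul1r.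
    have -> : (-1 * z + (g 0 1)%:~R) / -1 = z + (- g 0 1)%:~R.
      by rewrite invrN invr1 mulrN1 opprD mulN1r opprK mulrNz.
    exact: qfun_int.
pose q := divz (g 0 0) (g 1 0).
(* One step of Euclid's algorithm: g1 = S T^(-q) g, whose lower left entry is the remainder of the
   division. With u = g z - q, the law at u relates g z to g1 z = -1/u. *)
pose g1 : 'M[int]_2 := \matrix_(i, j)
  if i == 0 then - g 1 j else g 0 j - q * g 1 j.
have e00 : g1 0 0 = - g 1 0 by rewrite mxE.
have e01 : g1 0 1 = - g 1 1 by rewrite mxE.
have e10 : g1 1 0 = g 0 0 - q * g 1 0 by rewrite mxE.
have e11 : g1 1 1 = g 0 1 - q * g 1 1 by rewrite mxE.
have dg1 : \det g1 = 1.
  by rewrite det_mx22 e00 e01 e10 e11 -dg'; ring.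
have small : (absz (g1 1 0)%R < n)%N.
  apply: leq_trans gn; rewrite e10.
  have -> : g 0 0 - q * g 1 0 = modz (g 0 0) (g 1 0) by rewrite /modz.
  have := ltz_mod (g 0 0) c0; have := modz_ge0 (g 0 0) c0; lia.
have jn := automorphy_neq0 dg z0; have j1n := automorphy_neq0 dg1 z0.
pose u := moebius g z - q%:~R.
have uE : u = automorphy g1 z / automorphy g z.
  rewrite /u /moebius; move: jn; rewrite /automorphy e10 e11 !rmorphB !rmorphM /= => jn.
  by field.
have u0 : 0 < complex.Im u.
  rewrite /u -mulrNz intr_toC ImCD /= addr0; exact: Im_moebius.
have fu : qfun a u = qfun a (moebius g z) by rewrite /u -mulrNz qfun_int.
have mu : - u^-1 = moebius g1 z.
  rewrite uE invf_div -mulNr /moebius e00 e01; congr (_ / _).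
  by rewrite /automorphy !mulrNz; ring.
have := ha u u0; rewrite mu (IH g1 small dg1 z z0) fu uE expr_div_n.
move=> h; have jw : automorphy g z ^+ w != 0 by rewrite expf_neq0.
have j1w : automorphy g1 z ^+ w != 0 by rewrite expf_neq0.
move: h jw j1w; move: (automorphy g z ^+ w) (automorphy g1 z ^+ w) (qfun a z) (qfun a (moebius g z)) => x y f F h x0 y0.
have -> : F = x / y * (y / x * F) by field; rewrite x0 y0.
by rewrite -h; field.
Qed.

(** For boundedness at the cusp, Im z >= 1 gives |q| <= exp(-2 pi), and one convergent majorant
    serves for all such z. *)
Lemma modS_Mspace w a : ~~ odd w -> modS R w a -> Mspace R w a.
Proof.
move=> ew ma; have [ga ha] := ma.
exists (@qfun R a); last first.
  by move=> z z0; exact: (qvalP ga (nm_qparam_lt1 z0)).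
split.
- by move=> z z0; have [] := is_derive_qfun ga z0.
- by move=> g dg z z0; exact: modS_transform.
have [k [B [B0 hB]]] := @qterm_dom R _ ga.
pose r : R := expR (- (2 * pi)).
have r0 : 0 <= r by exact: expR_ge0.
have r1 : r < 1 by rewrite expR_lt1 oppr_lt0 mulr_gt0// pi_gt0.
pose b n := B * (n.+1%:R ^+ k * r ^+ n).
have cb : cvgn (series b) by apply: cvg_scaled; exact: cvg_poly_geometric.
exists (limn (series b)), 1 => z z0 z1.
have qr : nm (E z) <= r.
  by rewrite nm_qparam ler_expR lerN2 ler_peMr// mulr_ge0// pi_ge0.
rewrite normCE lecR.
have dom n : (0 <= n)%N -> nm (qterm a (E z) n) <= b n.
  move=> _; rewrite (le_trans (hB _ _))// ler_wpM2l// ler_wpM2l ?exprn_ge0//.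
  by rewrite lerXn2r ?nnegrE ?nm_ge0.
have := series_tail dom cb (qvalP ga (nm_qparam_lt1 z0)).
have s0 (V : zmodType) (c : nat -> V) : series c 0%N = 0 by rewrite /series /= big_geq.
by rewrite !s0 !subr0.
Qed.

End FullModularGroup.

(** * Modularity of the Eisenstein series of weight at least 4 *)

Section EisensteinModular.
Variable R : realType.
Implicit Types (w m : nat) (a : qseries).

Lemma gser_rec m : ~~ odd m -> (0 < m)%N ->
  gser m.+2 = qscale (2 * m.+1%:R / (m + 3)%N%:R) (qadd (qD (gser m))
    (\sum_(i < m.+1 | odd i) qscale 'C(m, i)%:R (qmul (gser (m - i).+1) (gser i.+1)) : fps)).
Proof.
move=> em m0; apply/funext => n; rewrite /qscale /qadd /qD fps_sum eisenstein_convolution//.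
have m1 : m.+1%:R != 0 :> rat by rewrite pnatr_eq0.
have m3 : (m + 3)%N%:R != 0 :> rat by rewrite pnatr_eq0 addnS.
move: m1 m3; move: (m.+1%:R) ((m + 3)%N%:R) => x y x0 y0.
by field; do ?[apply/andP; split].
Qed.

Lemma modS_sum w (I : Type) (r : seq I) (P : pred I) (F : I -> qseries) a : modS R w a ->
  (forall i, P i -> modS R w (F i)) -> modS R w (qadd a (\sum_(i <- r | P i) F i : fps)).
Proof.
move=> ma hF; elim/big_rec: _ => [|i b Pi IH].
  by have -> : qadd a (0 : fps) = a by apply: (addr0 (a : fps)).
have -> : qadd a (F i + b : fps) = qadd (F i) (qadd a b).
  by apply: (addrCA (a : fps) (F i : fps) (b : fps)).
by apply: modS_add => //; exact: hF.
Qed.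

(** In the convolution the terms i = 1 and i = m - 1 contain G_2; their coefficients add up to 2 m,
    which is the one of the Serre derivative of G_m. All other factors have weights between 4 and m
    - 2. For m = 2 the two indices coincide, hence the separate treatment of G_2^2. *)
Lemma modS_gser k : ~~ odd k -> (4 <= k)%N -> modS R k (gser k).
Proof.
have [N] := ubnP k; elim: N k => // N IH [|[|m]]//.
rewrite !ltnS => kN; rewrite /= negbK => em m2.
rewrite gser_rec ?(ltnW m2)//; apply: modS_scale.
case: (leqP 4 m) => m4; last first.
  have -> : m = 2%N by move: em; case: m m2 m4 {kN} => [|[|[|[|]]]].
  rewrite big_mkcond !big_ord_recl big_ord0 /= add0r add0r addr0.
  exact: modS_g2.
have i1 : (1 < m.+1)%N by lia.
have im : (m.-1 < m.+1)%N by lia.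
rewrite (bigD1 (Ordinal i1))//= (bigD1 (Ordinal im)) /=; last first.
  by apply/andP; split; [case: (m) em m4 => //= j; rewrite negbK|apply/eqP => /(congr1 val) /=; lia].
set S := \sum_(_ < _ | _) _.
have -> : qadd (qD (gser m)) (qscale 'C(m, 1)%:R (qmul (gser (m - 1).+1) (gser 2)) +
     (qscale 'C(m, m.-1)%:R (qmul (gser (m - m.-1).+1) (gser m.-1.+1)) + S) : fps) =
   qadd (qadd (qD (gser m)) (qscale (2 * m)%N%:R (qmul (gser 2) (gser m)))) S.
  have -> : (m - 1).+1 = m by lia.
  have -> : (m - m.-1).+1 = 2%N by lia.
  have -> : m.-1.+1 = m by lia.
  have -> : 'C(m, m.-1) = m by rewrite -subn1 bin_sub ?bin1//; lia.
  rewrite bin1; apply/funext => n.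
  rewrite /qadd !fpsE /qscale natrM -[qmul (gser m) _]/((gser m : fps) * (gser 2 : fps)).
  by rewrite -[qmul (gser 2) _]/((gser 2 : fps) * (gser m : fps)) [_ * (gser 2 : fps)]mulrC; ring.
apply: modS_sum.
  by apply: modS_serre; apply: IH => //; lia.
move=> i /andP[/andP[oi i_1 i_m]]; apply: modS_scale.
have n1 : (i : nat) != 1%N by apply: contraNneq i_1 => h; apply/eqP/val_inj.
have nm : (i : nat) != m.-1 by apply: contraNneq i_m => h; apply/eqP/val_inj.
have im1 : (i < m.+1)%N := ltn_ord i.
have -> : m.+2 = ((m - i).+1 + i.+1)%N by lia.
by apply: modS_mul; apply: IH; lia.
Qed.

End EisensteinModular.

(** * Congruences *)

Section LocalRing.
Variables (p : nat).
Hypothesis p_pr : prime p.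
Local Notation pint := (p_integral p).
Implicit Types (x y : rat) (f g h : fps) (m k n : nat).

Lemma p_integralP x :
  reflect (exists a : int, exists2 b : nat, ~~ (p %| b)%N & x * b%:R = a%:~R) (pint x).
Proof.
apply: (iffP idP) => [px|[a [b pb xab]]].
  exists (numq x), `|denq x|%N => //.
  by rewrite [X in X * _](esym (divq_num_den x)) natr_absz normr_denq divfK ?intr_eq0 ?denq_neq0.
rewrite /p_integral; apply: contra pb => pd; apply: (dvdn_trans pd).
have e : numq x * b%:Z = a * denq x.
  have d0 : (denq x)%:~R != 0 :> rat by rewrite intr_eq0 denq_neq0.
  apply: (@intr_inj rat); rewrite !rmorphM /= -xab -[X in X * _](divfK d0).
  by rewrite divq_num_den mulrAC.
have : (denq x %| numq x * b%:Z)%Z by rewrite e dvdz_mull.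
by rewrite Gauss_dvdzr ?dvdzE// /coprimez /gcdz gcdnC; exact: coprime_num_den.
Qed.

Lemma p_integral_int (a : int) : pint a%:~R.
Proof.
by apply/p_integralP; exists a, 1%N; rewrite ?mulr1// dvdn1 neq_ltn prime_gt1// orbT.
Qed.

Lemma p_integral_nat n : pint n%:R.
Proof. by have := p_integral_int n; rewrite -pmulrn. Qed.

Lemma p_integralD x y : pint x -> pint y -> pint (x + y).
Proof.
move=> /p_integralP[a [b pb ab]] /p_integralP[c [d pd cd]]; apply/p_integralP.
exists (a * d%:Z + c * b%:Z), (b * d)%N; first by rewrite Euclid_dvdM// negb_or pb.
by rewrite rmorphD !rmorphM /= -ab -cd -!pmulrn ?natrM; ring.
Qed.

Lemma p_integralM x y : pint x -> pint y -> pint (x * y).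
Proof.
move=> /p_integralP[a [b pb ab]] /p_integralP[c [d pd cd]]; apply/p_integralP.
exists (a * c), (b * d)%N; first by rewrite Euclid_dvdM// negb_or pb.
by rewrite natrM rmorphM /= -ab -cd; ring.
Qed.

Lemma p_integralN x : pint x -> pint (- x).
Proof. by move=> px; rewrite -mulN1r p_integralM// (p_integral_int (-1)). Qed.

Lemma p_integralB x y : pint x -> pint y -> pint (x - y).
Proof. by move=> px py; rewrite p_integralD// p_integralN. Qed.

Lemma p_integral_sum (I : Type) (r : seq I) (P : pred I) (F : I -> rat) :
  (forall i, P i -> pint (F i)) -> pint (\sum_(i <- r | P i) F i).
Proof.
move=> h; elim/big_ind: _ => //; first exact: (p_integral_nat 0).
exact: p_integralD.
Qed.

(** Membership in p^m Z_(p). A congruence becomes a statement on a difference, and exponents add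
    under products. *)
Definition pdvd m x : Prop := exists2 c, pint c & x = p%:R ^+ m * c.

Lemma pdvd0P x : pdvd 0 x <-> pint x.
Proof.
split=> [[c pc ->]|px]; first by rewrite expr0 mul1r.
by exists x; rewrite ?expr0 ?mul1r.
Qed.

Lemma pdvdD m x y : pdvd m x -> pdvd m y -> pdvd m (x + y).
Proof.
by move=> [c pc ->] [d pd ->]; exists (c + d); rewrite ?p_integralD ?mulrDr.
Qed.

Lemma pdvdM m k x y : pdvd m x -> pdvd k y -> pdvd (m + k) (x * y).
Proof.
move=> [c pc ->] [d pd ->]; exists (c * d); first exact: p_integralM.
by rewrite exprD mulrACA.
Qed.

Lemma pdvd_mull m x y : pint x -> pdvd m y -> pdvd m (x * y).
Proof. by move=> /pdvd0P px py; exact: (pdvdM px py). Qed.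

Lemma pdvd_mulr m x y : pdvd m x -> pint y -> pdvd m (x * y).
Proof. by move=> px py; rewrite mulrC; exact: pdvd_mull. Qed.

Lemma pdvdN m x : pdvd m x -> pdvd m (- x).
Proof. by move=> hx; rewrite -mulN1r; apply: pdvd_mull => //; exact: (p_integral_int (-1)). Qed.

Lemma pdvdB m x y : pdvd m x -> pdvd m y -> pdvd m (x - y).
Proof. by move=> hx /pdvdN; exact: pdvdD. Qed.

Lemma pdvd0 m : pdvd m 0.
Proof. by exists 0; rewrite ?mulr0//; exact: (p_integral_nat 0). Qed.

Lemma pdvd_sum m (I : Type) (r : seq I) (P : pred I) (F : I -> rat) :
  (forall i, P i -> pdvd m (F i)) -> pdvd m (\sum_(i <- r | P i) F i).
Proof. move=> h; elim/big_ind: _ => //; [exact: pdvd0|exact: pdvdD]. Qed.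

Lemma pdvd_p x : pint x -> pdvd 1 (p%:R * x).
Proof. by move=> px; exists x; rewrite ?expr1. Qed.

Lemma pdvd_nat n : (p %| n)%N -> pdvd 1 n%:R.
Proof.
by move=> /dvdnP[d ->]; rewrite mulnC natrM; apply: pdvd_p; exact: p_integral_nat.
Qed.

Lemma pdvd_integral m x : pdvd m x -> pint x.
Proof.
by move=> [c pc ->]; rewrite -natrX; apply: p_integralM => //; exact: p_integral_nat.
Qed.

Lemma p_integralV x : pint x -> ~ pdvd 1 x -> pint x^-1.
Proof.
move=> /p_integralP[a [b pb ab]] nx; apply/p_integralP.
have pa : ~~ (p %| `|a|)%N.
  apply/negP => pa; apply: nx.
  have /dvdzP[c ac] : (p%:Z %| a)%Z by rewrite dvdzE.
  have b0 : b%:R != 0 :> rat by rewrite pnatr_eq0; apply: contraNneq pb => ->.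
  exists (c%:~R / b%:R).
    by apply/p_integralP; exists c, b; rewrite ?divfK.
  by rewrite expr1 -[x](mulfK b0) ab ac rmorphM /= -pmulrn mulrCA mulrA.
have x0 : x != 0 by apply/eqP => x0; apply: nx; rewrite x0; exact: pdvd0.
exists (Num.sg a * b%:Z), `|a|%N => //.
rewrite natr_absz normrEsg rmorphM /= rmorphM /= -ab -pmulrn.
by field.
Qed.

Lemma pdvdV_congr x y : pint x -> ~ pdvd 1 x -> y != 0 -> pint y^-1 ->
  pdvd 1 (x - y) -> pdvd 1 (x^-1 - y^-1).
Proof.
move=> px nx y0 py h; have x0 : x != 0 by apply/eqP => x0; apply: nx; rewrite x0; exact: pdvd0.
have -> : x^-1 - y^-1 = - (x^-1 * y^-1) * (x - y) by field; rewrite x0 y0.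
by apply: pdvd_mull => //; rewrite p_integralN// p_integralM// p_integralV.
Qed.

Lemma p_integral_natV n : ~~ (p %| n)%N -> pint n%:R^-1.
Proof.
move=> pn; apply/p_integralP; exists 1, n => //.
by rewrite mulVf// pnatr_eq0; apply: contraNneq pn => ->.
Qed.

Definition qdvd m f : Prop := forall n, pdvd m (f n).

Lemma qdvd0P f : qdvd 0 f <-> qp_integral p f.
Proof. by split=> h n; apply/pdvd0P. Qed.

Lemma qdvdD m f g : qdvd m f -> qdvd m g -> qdvd m (f + g).
Proof. by move=> hf hg n; exact: pdvdD. Qed.

Lemma qdvdN m f : qdvd m f -> qdvd m (- f).
Proof. by move=> hf n; exact: pdvdN. Qed.

Lemma qdvdB m f g : qdvd m f -> qdvd m g -> qdvd m (f - g).
Proof. by move=> hf /qdvdN; exact: qdvdD. Qed.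

Lemma qdvdM m k f g : qdvd m f -> qdvd k g -> qdvd (m + k) (f * g).
Proof. by move=> hf hg n; rewrite fpsM; apply: pdvd_sum => i _; exact: pdvdM. Qed.

Lemma qdvd_mull m f g : qp_integral p f -> qdvd m g -> qdvd m (f * g).
Proof. by move=> /qdvd0P hf hg; exact: (qdvdM hf hg). Qed.

Lemma qdvd_integral m f : qdvd m f -> qp_integral p f.
Proof. by move=> hf n; exact: pdvd_integral (hf n). Qed.

Lemma qp_integral1 : qp_integral p (1 : fps).
Proof. by move=> n; rewrite fps1; exact: p_integral_nat. Qed.

Lemma qp_integralX f k : qp_integral p f -> qp_integral p (f ^+ k : fps).
Proof.
move=> hf; elim: k => [|k /qdvd0P IH]; first exact: qp_integral1.
by rewrite exprS; apply/qdvd0P; apply: qdvd_mull.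
Qed.

Lemma qdvdX_sub f g k : qp_integral p f -> qp_integral p g ->
  qdvd 1 (f - g) -> qdvd 1 (f ^+ k - g ^+ k).
Proof.
move=> hf hg h; rewrite subrXX mulrC; apply: qdvd_mull => // n.
rewrite fps_sum; apply: p_integral_sum => i _.
by have /qdvd0P := qdvd_mull (qp_integralX (k.-1 - i) hf) (iffRL (qdvd0P _) (qp_integralX i hg)); exact.
Qed.

(** In f^p - 1 = (f - 1)(1 + f + ... + f^(p-1)) the second factor is a sum of p terms congruent to
    1, hence 0 mod p. *)
Lemma qdvdX_p f : qp_integral p f -> qdvd 1 (f - 1) -> qdvd 2 (f ^+ p - 1).
Proof.
move=> hf h; rewrite subrX1; apply: (@qdvdM 1 1) => //.
have -> : \sum_(i < p) f ^+ i = \sum_(i < p) (f ^+ i - 1) + p%:R.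
  by rewrite sumrB sumr_const card_ord subrK.
apply: qdvdD.
  move=> n; rewrite fps_sum; apply: pdvd_sum => i _.
  by have := qdvdX_sub i hf qp_integral1 h; rewrite expr1n; exact.
move=> n; have -> : (p%:R : fps) = fpsC p%:R.
  apply/funext => j; rewrite -[p%:R]mulr1; elim: (p) => [|k IH].
    by rewrite mul0r /fpsC; case: ifP.
  by rewrite -natr1 mulrDl fpsE IH mul1r fps1 /fpsC -natr1; case: (j == 0%N); rewrite ?addr0.
by rewrite /fpsC; case: ifP => _; [exact: pdvd_nat|exact: pdvd0].
Qed.

End LocalRing.

(** * Congruences for B_(p-1) and B_(p+1) *)

Section BernoulliCongruences.
Variables (p : nat).
Hypotheses (p_pr : prime p) (p_ge5 : (5 <= p)%N).
Local Notation pint := (p_integral p).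

Lemma p_ndvd n : (0 < n < p)%N -> ~~ (p %| n)%N.
Proof. by case/andP => n0 np; rewrite gtnNdvd. Qed.

(** The recurrence for B_j divides by j + 1 only, which is less than p. *)
Lemma p_integral_bernoulli j : (j < p.-1)%N -> pint (bernoulli j).
Proof.
elim/ltn_ind: j => j IH jp; rewrite bernoulliE; apply: p_integralM => //.
  apply: p_integralB => //; first exact: p_integral_nat.
  apply: p_integral_sum => // k _; apply: p_integralM => //; first exact: p_integral_nat.
  by apply: IH => //; exact: ltn_trans jp.
by apply: p_integral_natV => //; apply: p_ndvd; lia.
Qed.

(** A case of von Staudt-Clausen: for 0 < k < p - 1 the binomial C(p, k) is divisible by p and B_k
    is integral, so mod p the recurrence keeps k = 0 and k = p - 1 only. *)
Lemma bernoulli_pred_p : pdvd p 1 (p%:R * bernoulli p.-1 + 1).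
Proof.
have p0 : (0 < p)%N by lia.
have pn0 : p%:R != 0 :> rat by rewrite pnatr_eq0 -lt0n.
have -> : p%:R * bernoulli p.-1 = - \sum_(k < p.-1) 'C(p, k)%:R * bernoulli k.
  rewrite bernoulliE prednK// [X in X - _](_ : _ = 0) ?sub0r; last by case: eqP => //; lia.
  by rewrite mulrC divfK.
have -> : p.-1 = p.-2.+1 by lia.
rewrite big_ord_recl bin0 bernoulli0 mul1r opprD addrAC addNr add0r.
apply: pdvdN => //; apply: pdvd_sum => // i _; apply: pdvd_mulr => //.
  by apply: pdvd_nat => //; rewrite prime_dvd_bin//= /bump /=; have := ltn_ord i; lia.
by apply: p_integral_bernoulli; rewrite /= /bump /=; have := ltn_ord i; lia.
Qed.

Lemma pdvd_unit x : x != 0 -> pint x^-1 -> ~ pdvd p 1 x.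
Proof.
move=> x0 xi h; have := pdvd_mulr p_pr h xi; rewrite mulfV// => -[c].
move=> /p_integralP[a [b pb ab]]; rewrite expr1 => h1.
case/negP: pb; have : b%:Z = p%:Z * a.
  by apply: (@intr_inj rat); rewrite rmorphM /= -ab -!pmulrn mulrA -h1 mul1r.
by move=> e; have : (p%:Z %| b%:Z)%Z by rewrite e dvdz_mulr.
Qed.

Lemma pdvd_unit_congr x y : ~ pdvd p 1 x -> pdvd p 1 (y - x) -> ~ pdvd p 1 y.
Proof.
by move=> nx h hy; apply: nx; rewrite -[x](subKr y); exact: pdvdB.
Qed.

Lemma bin_p2_dvd k : (3 <= k < p)%N -> (p %| 'C(p.+2, k))%N.
Proof.
case: k => [|[|k]]// /andP[k1 kp]; rewrite !binS.
by rewrite !dvdn_add// prime_dvd_bin//; lia.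
Qed.

Let odd_p : odd p.
Proof. by case: (even_prime p_pr) => // p2; move: p_ge5; rewrite p2. Qed.

Lemma p_integral12 : pint 12^-1.
Proof.
have -> : 12^-1 = 2%:R^-1 * (2%:R^-1 * 3%:R^-1) :> rat by [].
by apply: p_integralM => //; [|apply: p_integralM => //]; apply: p_integral_natV => //; apply: p_ndvd; lia.
Qed.

(** Kummer's congruence between B_(p+1) and B_2, from the recurrence with binomials C(p + 2, k).
    These vanish mod p for 3 <= k < p, but at k = p - 1 the factor p is spent on the pole of
    B_(p-1). What remains mod p is 1 - 1 + 1/6 - 1/3 + 2 B_(p+1) = 0. *)
Lemma bernoulli_succ_p_aux : pdvd p 1 (p.+2%:R * (bernoulli p.+1 - 12^-1)).
Proof.
have := bernoulli_rec p.+1.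
have [q pq] : exists q, p = q.+4 by exists (p - 4)%N; lia.
have c3 : 'C(p.+2, p.-1)%:R = (p%:R + 2) * (p%:R + 1) * p%:R / 6 :> rat.
  rewrite -[p.-1](_ : (p.+2 - 3)%N = _) ?bin_sub; try lia.
  have h2 := mul_bin_diag p.+1 1; have h3 := mul_bin_diag p.+2 2.
  move: h2 h3 => /= /(congr1 (fun x => x%:R : rat)) h2 /(congr1 (fun x => x%:R : rat)).
  move: h2; rewrite !natrM bin1 -(natr1 p.+1) -!(natr1 p) => h2 h3.
  by move: h2 h3; move: ('C(p.+1, 2)%:R : rat) ('C(p.+2, 3)%:R : rat) => x y; nra.
have c2 : 'C(p.+2, 2)%:R = (p%:R + 2) * (p%:R + 1) / 2 :> rat.
  have h2 := mul_bin_diag p.+2 1.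
  move: h2 => /= /(congr1 (fun x => x%:R : rat)).
  rewrite !natrM bin1 -(natr1 p.+1) -!(natr1 p).
  by move: ('C(p.+2, 2)%:R : rat) => x; nra.
have bp : bernoulli p = 0 by rewrite bernoulli_odd//; lia.
have peel (F : nat -> rat) : \sum_(k < p.+2) F k =
    F 0%N + F 1%N + F 2%N + \sum_(i < p - 4) F i.+3 + F p.-1 + F p + F p.+1.
  have -> : (p - 4)%N = q by lia.
  by rewrite pq 3!big_ord_recr /= 3!big_ord_recl /= !addrA.
have -> : \sum_(k < p.+2) 'C(p.+2, k)%:R * bernoulli k =
   1 - (p%:R + 2) / 2 + (p%:R + 2) * (p%:R + 1) / 12
   + \sum_(i < p - 4) 'C(p.+2, i.+3)%:R * bernoulli i.+3
   + (p%:R + 2) * (p%:R + 1) / 6 * (p%:R * bernoulli p.-1) + p.+2%:R * bernoulli p.+1.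
  rewrite (peel (fun k => 'C(p.+2, k)%:R * bernoulli k)) c3 c2 bp mulr0 addr0 bin0 bin1.
  rewrite binSn bernoulli0 bernoulli1 bernoulli2.
  rewrite -!(natr1 p.+1) -!(natr1 p); by field.
have {c2 c3 bp peel q pq} hS : pdvd p 1 (\sum_(i < p - 4) 'C(p.+2, i.+3)%:R * bernoulli i.+3).
  apply: pdvd_sum => // i _; have ip := ltn_ord i; apply: pdvd_mulr => //.
    by apply: pdvd_nat => //; apply: bin_p2_dvd; lia.
  by apply: p_integral_bernoulli; lia.
have [c pc] := bernoulli_pred_p; rewrite expr1 => hc.
have -> : p%:R * bernoulli p.-1 = -1 + p%:R * c by rewrite -hc; ring.
move: hS; set S := \sum_(_ < _) _; rewrite -(natr1 p.+1) -!(natr1 p).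
have p1 : (1 < p)%N by lia.
have -> : (p.+1 == 0)%N = false by [].
move: (bernoulli p.+1) => b hS h.
have -> : (p%:R + 1 + 1) * (b - 12^-1) = - S + p%:R * (12^-1 * (8 + p%:R)
   - 12^-1 * 2 * (p%:R + 2) * (p%:R + 1) * c) by move: h; rewrite mulr0n; nra.
apply: pdvdD => //; first exact: pdvdN.
have i12 := p_integral12; have pn := p_integral_nat p_pr; have ip := pn p.
apply: pdvd_p; apply: (p_integralB p_pr); first exact: (p_integralM p_pr i12 (p_integralD p_pr (pn 8) ip)).
have i2 := p_integralM p_pr (p_integralM p_pr i12 (pn 2)) (p_integralD p_pr ip (pn 2)).
exact: (p_integralM p_pr (p_integralM p_pr i2 (p_integralD p_pr ip (pn 1))) pc).
Qed.

Lemma bernoulli_succ_p : pdvd p 1 (bernoulli p.+1 - 12^-1).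
Proof.
have pp : ~~ (p %| p.+2)%N by rewrite -addn2 dvdn_addr//; apply: p_ndvd; lia.
have p0 : p.+2%:R != 0 :> rat by rewrite pnatr_eq0.
rewrite -[_ - _](mulKf p0); apply: pdvd_mull => //; last exact: bernoulli_succ_p_aux.
exact: p_integral_natV.
Qed.

End BernoulliCongruences.

(** * Frobenius and Fermat modulo p *)

Section Frobenius.
Variable p : nat.
Hypothesis p_pr : prime p.
Implicit Types (f : fps) (n : nat).

(** Over F_p the p-th power is additive and fixes the constants, so Q^p = Q(X^p). *)
Lemma frobenius_poly_Fp (Q : {poly int}) n :
  (p %| ((Q ^+ p)`_n - if (p %| n)%N then Q`_(n %/ p) else 0))%Z.
Proof.
have chF := pchar_Fp p_pr.
have chP : p \in [pchar {poly 'F_p}] by rewrite pchar_poly.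
rewrite (dvdz_pcharf chF) rmorphB /= subr_eq0.
have -> : ((if (p %| n)%N then Q`_(n %/ p) else 0)%:~R : 'F_p) =
    (map_poly intr Q \Po 'X^p)`_n.
  rewrite coef_comp_poly_Xn ?prime_gt0//; case: ifP => _; last exact: mulr0z.
  by rewrite coef_map.
rewrite -coef_map rmorphXn /= -(pFrobenius_autE chP).
set P := map_poly _ _; suff -> : pFrobenius_aut chP P = P \Po 'X^p by [].
rewrite -{1}[P]coefK poly_def rmorph_sum comp_polyE; apply: eq_bigr => i _.
rewrite /= pFrobenius_autE exprZn coef_map /= -(pFrobenius_autE chF) pFrobenius_aut_int.
by rewrite -!exprM mulnC.
Qed.

Lemma fpsX_trunc f k n N : (n < N)%N -> (f ^+ k) n = ((trunc N f) ^+ k)`_n.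
Proof.
elim: k n => [|k IH] n nN; first by rewrite !expr0 fps1 coef1.
rewrite !exprS fpsM coefM; apply: eq_bigr => i _; have iN := ltn_ord i.
by rewrite coef_trunc ?IH//; lia.
Qed.

Lemma fps_frobenius f (e : nat -> int) n : (forall n, f n = (e n)%:~R) ->
  pdvd p 1 ((f ^+ p) n - if (p %| n)%N then f (n %/ p)%N else 0).
Proof.
move=> fe; pose Q : {poly int} := \poly_(i < n.+1) e i.
have -> : (f ^+ p) n = ((Q ^+ p)`_n)%:~R.
  rewrite (@fpsX_trunc _ _ _ n.+1)// -(coef_map (intr : int -> rat)) rmorphXn /=.
  suff -> : trunc n.+1 f = map_poly intr Q by [].
  apply/polyP => i; rewrite coef_map !coef_poly /=.
  by case: ifP => // _; rewrite fe.
have -> : (if (p %| n)%N then f (n %/ p)%N else 0) =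
    (if (p %| n)%N then Q`_(n %/ p) else 0)%:~R :> rat.
  by case: ifP => // _; rewrite coef_poly ltnS leq_div fe.
rewrite -rmorphB; have /dvdzP[c ->] := frobenius_poly_Fp Q n.
by rewrite rmorphM mulrC; apply: pdvd_p; exact: p_integral_int.
Qed.

Lemma pdvd_nat_modn (a b : nat) : a = b %[mod p] -> pdvd p 1 (a%:R - b%:R).
Proof.
wlog ab : a b / (b <= a)%N => [h e|/eqP e].
  case/orP: (leq_total b a) => ab; first exact: h.
  by rewrite -opprB; apply: pdvdN => //; exact: h.
by rewrite -natrB//; apply: pdvd_nat => //; rewrite -eqn_mod_dvd.
Qed.

Lemma sigma_fermat n : pdvd p 1 ((sigma p n)%:R - (sigma 1 n)%:R).
Proof.
rewrite /sigma !natr_sum -sumrB; apply: pdvd_sum => // d _.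
by apply: pdvd_nat_modn; rewrite expn1 fermat_little.
Qed.

Lemma perm_divisors_mul n : (0 < n)%N ->
  perm_eq [seq d <- divisors (p * n) | (p %| d)%N] [seq (p * d)%N | d <- divisors n].
Proof.
move=> n0; have p0 := prime_gt0 p_pr; have pn0 : (0 < p * n)%N by rewrite muln_gt0 p0.
apply: uniq_perm.
- by rewrite filter_uniq// divisors_uniq.
- rewrite map_inj_uniq ?divisors_uniq// => a b /eqP; rewrite eqn_pmul2l//.
  by move/eqP.
move=> d; rewrite mem_filter -dvdn_divisors//; apply/andP/mapP => [[/dvdnP[e ->]]|[e]].
  by rewrite mulnC dvdn_pmul2l// => en; exists e; rewrite -?dvdn_divisors.
by rewrite -dvdn_divisors// => en ->; rewrite dvdn_mulr// dvdn_pmul2l.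
Qed.

(** Writing d = p e turns n / d into the divisor of n / p complementary to e. *)
Lemma sum_divisors_p n : (0 < n)%N ->
  (\sum_(d <- divisors n | p %| d) n %/ d)%N = if (p %| n)%N then sigma 1 (n %/ p) else 0%N.
Proof.
move=> n0; have p0 := prime_gt0 p_pr; case: ifP => pn; last first.
  rewrite big_seq_cond big1// => d /andP[]; rewrite -dvdn_divisors// => dn pd.
  by move: pn; rewrite (dvdn_trans pd dn).
have k0 : (0 < n %/ p)%N by rewrite divn_gt0// dvdn_leq.
rewrite -{1 2}(divnK pn) [(_ * p)%N]mulnC; move: (n %/ p)%N k0 => k k0.
rewrite -big_filter (perm_big _ (perm_divisors_mul k0)) big_map.
under eq_bigr do rewrite divnMl//.
by rewrite (sum_divisors_compl (fun d => d) k0); apply: eq_bigr => d _; rewrite expn1.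
Qed.

(* [n d^(p-2) = (n/d) d^(p-1)], and [d^(p-1)] is 0 or 1 modulo p *)
Lemma nsigma_fermat n : (1 < p)%N -> (0 < n)%N ->
  pdvd p 1 (n%:R * (sigma p.-2 n)%:R - (sigma 1 n)%:R
     + (if (p %| n)%N then sigma 1 (n %/ p) else 0%N)%:R).
Proof.
move=> p1 n0; rewrite -sum_divisors_p// natr_sum [X in _ + X]big_mkcond.
rewrite {2}/sigma (eq_bigr id) ?(esym (sum_divisors_compl id n0)); last by move=> d _; rewrite expn1.
rewrite /sigma !natr_sum mulr_sumr -sumrB -big_split big_seq /=.
apply: pdvd_sum => // d; rewrite -dvdn_divisors// => dn.
have -> : n%:R * (d ^ p.-2)%N%:R = (n %/ d)%N%:R * (d ^ p.-1)%N%:R :> rat.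
  rewrite -!natrM -{1}(divnK dn) -mulnA -expnS; congr (_ * _ ^ _)%N%:R.
  by case: (p) p1 => [|[|]].
case: ifP => pd.
  rewrite subrK; apply: pdvd_mull => //; first exact: p_integral_nat.
  apply: pdvd_nat => //; rewrite Euclid_dvdX// pd /=; lia.
rewrite addr0 -{2}[(n %/ d)%N%:R]mulr1 -mulrBr; apply: pdvd_mull => //; first exact: p_integral_nat.
have d0 : d%:R != 0 :> rat by rewrite pnatr_eq0; apply: contraFneq pd => ->.
have -> : (d ^ p.-1)%N%:R - 1 = d%:R^-1 * ((d ^ p)%N%:R - d%:R) :> rat.
  by rewrite -[in (d ^ p)%N](prednK (ltnW p1)) expnS natrM -{3}[d%:R]mulr1 -mulrBr mulKf.
apply: pdvd_mull => //; first by apply: p_integral_natV; rewrite ?pd.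
by apply: pdvd_nat_modn; rewrite fermat_little.
Qed.

End Frobenius.

(** * The form f and the two congruences *)

Lemma eisenstein_gser w : (0 < w)%N -> bernoulli w != 0 ->
  eisenstein w = qscale (- ((2 * w)%N%:R / bernoulli w)) (gser w).
Proof.
move=> w0 b0; apply/funext => n; rewrite /qscale /eisenstein /gser.
case: eqP => // _; have w2 : (2 * w)%N%:R != 0 :> rat by rewrite pnatr_eq0; lia.
by move: w2; move: ((2 * w)%N%:R) => y y0; field; rewrite y0 b0.
Qed.

Section Main.
Variables (p : nat).
Hypotheses (p_pr : prime p) (p_ge5 : (5 <= p)%N).
Local Notation pint := (p_integral p).
Let pn := p_integral_nat p_pr.

(** With u = p B_(p-1) the sum is p (1/u + 1): one factor p is explicit, so the congruence u = -1
    mod p yields precision p^2. *)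
Lemma bernoulli_pred_p_inv : bernoulli p.-1 != 0 /\ pdvd p 2 ((bernoulli p.-1)^-1 + p%:R).
Proof.
have p0 : p%:R != 0 :> rat by rewrite pnatr_eq0; lia.
have h := bernoulli_pred_p p_pr p_ge5; set u := p%:R * _ in h.
have n1 : pint (-1) := p_integral_int p_pr (-1).
have nu : ~ pdvd p 1 u.
  apply: (@pdvd_unit_congr p p_pr (-1)); last by rewrite opprK.
  by apply: pdvd_unit => //; rewrite ?invrN ?invr1 ?oppr_eq0 ?oner_eq0.
have u0 : u != 0 by apply/eqP => u0; apply: nu; rewrite u0; exact: pdvd0.
have b0 : bernoulli p.-1 != 0 by apply: contraNneq u0 => b0; rewrite /u b0 mulr0.
split=> //.
have -> : (bernoulli p.-1)^-1 + p%:R = p%:R * (u^-1 - (-1)^-1).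
  by rewrite /u; field; rewrite b0 p0.
apply: (@pdvdM p p_pr 1 1); first exact: pdvd_nat.
apply: pdvdV_congr => //; rewrite ?oppr_eq0 ?oner_eq0 ?invrN ?invr1//.
- rewrite -[u](addrK 1); exact: (p_integralB p_pr (pdvd_integral p_pr h) (pn 1)).
Qed.

Lemma bernoulli_succ_p_inv : [/\ bernoulli p.+1 != 0, pint (bernoulli p.+1)^-1 &
  pdvd p 1 ((2 * p.+1)%N%:R / bernoulli p.+1 - 24)].
Proof.
have h := bernoulli_succ_p p_pr p_ge5; set b := bernoulli _ in h *.
have nb : ~ pdvd p 1 b.
  apply: (pdvd_unit_congr p_pr _ h); apply: pdvd_unit => //; rewrite invrK.
  exact: (pn 12).
have b0 : b != 0 by apply/eqP => b0; apply: nb; rewrite b0; exact: pdvd0.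
have i12 := p_integral12 p_pr p_ge5.
have bi : pint b by rewrite -[b](subrK 12^-1); exact: (p_integralD p_pr (pdvd_integral p_pr h) i12).
have bV := p_integralV p_pr bi nb; split=> //.
have -> : (2 * p.+1)%N%:R / b - 24 = b^-1 * (2 * p%:R - 24 * (b - 12^-1)).
  by rewrite natrM -(natr1 p); field.
apply: pdvd_mull => //; apply: pdvdB => //.
  by rewrite mulrC; apply: pdvd_p; exact: (pn 2).
by apply: pdvd_mull => //; exact: (pn 24).
Qed.

Lemma eisenstein2E n : eisenstein 2 n =
  (if n == 0%N then 1 else - (24 * sigma 1 n)%N%:Z)%:~R.
Proof.
rewrite /eisenstein bernoulli2; case: eqP => // _.
have -> : (2 * 2)%N%:R / (1 / 6) = 24%:R :> rat by apply/eqP.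
by rewrite mulrNz -pmulrn natrM mulNr.
Qed.

Lemma eisenstein2_integral : qp_integral p (eisenstein 2).
Proof. by move=> n; rewrite eisenstein2E; exact: p_integral_int. Qed.

(** The normalising factors agree mod p by Kummer's congruence, and sigma_p agrees with sigma_1 by
    Fermat. *)
Lemma eisenstein_succ_congr : qdvd p 1 ((eisenstein p.+1 : fps) - (eisenstein 2 : fps)).
Proof.
have [b0 bV hb] := bernoulli_succ_p_inv => n; rewrite fpsE fpsN eisenstein2E /eisenstein.
case: eqP => _; first by rewrite subrr; exact: pdvd0.
rewrite /= mulrNz opprK -pmulrn (natrM _ 24 (sigma 1 n)).
set x := _ / _; rewrite -/x in hb.
have -> : - x * (sigma p n)%:R + 24 * (sigma 1 n)%:R =
   - ((x - 24) * (sigma p n)%:R + 24 * ((sigma p n)%:R - (sigma 1 n)%:R)) by ring.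
apply: pdvdN => //; apply: pdvdD => //; first by apply: pdvd_mulr => //; exact: pn.
exact: (pdvd_mull p_pr (pn 24) (sigma_fermat p_pr n)).
Qed.

Lemma eisenstein_succ_integral : qp_integral p (eisenstein p.+1).
Proof.
have /qdvd0P h := eisenstein2_integral; apply/qdvd0P.
have -> : eisenstein p.+1 = (eisenstein p.+1 : fps) - (eisenstein 2 : fps) + (eisenstein 2 : fps) :> fps.
  by rewrite subrK.
apply: qdvdD => //; apply/qdvd0P; exact: qdvd_integral eisenstein_succ_congr.
Qed.

Lemma eisenstein_pred_congr : qdvd p 1 ((eisenstein p.-1 : fps) - 1).
Proof.
have [b0 hb] := bernoulli_pred_p_inv => n; rewrite fpsE fpsN fps1 /eisenstein.
case: eqP => _; first by rewrite subrr; exact: pdvd0.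
rewrite subr0 mulNr; apply: pdvdN => //; apply: pdvd_mulr => //.
apply: pdvd_mull => //.
rewrite -[_^-1](addrK p%:R); apply: pdvdB => //; last exact: pdvd_nat.
case: hb => c pc ->; rewrite exprS expr1 -mulrA; apply: pdvd_p.
exact: (p_integralM p_pr (pn p) pc).
Qed.

Lemma eisenstein_pred_integral : qp_integral p (eisenstein p.-1).
Proof.
have h := eisenstein_pred_congr; apply/qdvd0P.
have -> : eisenstein p.-1 = (eisenstein p.-1 : fps) - 1 + 1 :> fps by rewrite subrK.
by apply: qdvdD => //; apply/qdvd0P => //; [exact: qdvd_integral h|exact: qp_integral1].
Qed.

(** [fps_frobenius] asks for integer coefficients: E_2 has them, while E_(p+1) is known to be
    p-integral and is first replaced by E_2. *)
Lemma eisenstein_succ_frobenius n : pdvd p 1 (eisenstein p.+1 n - ((eisenstein p.+1 : fps) ^+ p) n -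
  (eisenstein 2 n - if (p %| n)%N then eisenstein 2 (n %/ p)%N else 0)).
Proof.
have hE := eisenstein_succ_congr n; rewrite fpsE fpsN in hE.
have hX := qdvdX_sub p_pr p eisenstein_succ_integral eisenstein2_integral eisenstein_succ_congr n.
rewrite fpsE fpsN in hX.
have hF := fps_frobenius p_pr n eisenstein2E.
have := pdvdB p_pr (pdvdB p_pr hE hX) hF; congr (pdvd p 1 _).
move: (if _ then _ else _) => z.
move: (((eisenstein p.+1 : fps) ^+ p) n) (((eisenstein 2 : fps) ^+ p) n) => x y.
by ring.
Qed.

Let E2 : fps := eisenstein 2.
Let Em : fps := eisenstein p.-1.
Let Ep : fps := eisenstein p.+1.

Definition fform : fps :=
  E2 * Em - fpsC (12 / p.-1%:R) * (qD Em : fps) - fpsC p%:R * Ep.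

Lemma fform_congr : qdvd p 2 (E2 * Em - (fform + fpsC p%:R * Ep ^+ p)).
Proof.
move=> n; have -> : E2 * Em - (fform + fpsC p%:R * Ep ^+ p) =
  fpsC (12 / p.-1%:R) * (qD Em : fps) + fpsC p%:R * (Ep - Ep ^+ p) by rewrite /fform; ring.
rewrite fpsE !fpsCM fpsE fpsN; have hn := eisenstein_succ_frobenius n; rewrite -/Ep in hn.
set x := Ep n - _ in hn *.
have [n0|n0] := posnP n.
  rewrite n0 /qD mul0r mulr0 add0r; apply: (@pdvdM p p_pr 1 1); first exact: pdvd_nat.
  by move: hn; rewrite n0 div0n dvdn0 subrr subr0.
have [b0 hb] := bernoulli_pred_p_inv; set r := _^-1 + _ in hb.
have nsig := nsigma_fermat p_pr (prime_gt1 p_pr) n0.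
set s := (sigma p.-2 n)%:R in nsig; set s1 := (sigma 1 n)%:R in nsig; set t := (if _ then _ else _)%:R in nsig.
(* 1/B_(p-1) is written as r - p, where p^2 divides r; the weight p - 1 in the coefficient of
   E_(p-1) cancels the denominator of 12/(p - 1). *)
have -> : 12 / p.-1%:R * qD Em n + p%:R * x =
    p%:R * (24 * s * n%:R + x) - 24 * s * n%:R * r.
  rewrite /qD /Em /eisenstein gtn_eqF// -[sigma p.-1.-1 n]/(sigma p.-2 n) -/s /r.
  have pm : p.-1%:R != 0 :> rat by rewrite pnatr_eq0; lia.
  by rewrite natrM; move: pm b0; move: (p.-1%:R : rat) => y y0 b0; field; rewrite y0 b0.
apply: (pdvdB p_pr); last first.
  exact: (pdvd_mull p_pr (p_integralM p_pr (p_integralM p_pr (pn 24) (pn _)) (pn _)) hb).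
apply: (@pdvdM p p_pr 1 1); first exact: (pdvd_nat p_pr (dvdnn p)).
(* 24 t - 24 s1 is the coefficient of E_2 - E_2(q^p), to which x is congruent; the other bracket is
   the Fermat congruence for n sigma_(p-2)(n). *)
have -> : 24 * s * n%:R + x = 24 * (n%:R * s - s1 + t) + (x - (24 * t - 24 * s1)) by ring.
apply: (pdvdD p_pr); first exact: (pdvd_mull p_pr (pn 24) nsig).
move: hn; congr (pdvd p 1 (_ - _)); rewrite !eisenstein2E gtn_eqF// mulrNz -pmulrn (natrM _ 24).
rewrite /t; case: ifP => pdn; last by rewrite /s1; ring.
have k0 : (0 < n %/ p)%N by rewrite divn_gt0 ?(prime_gt0 p_pr)// (dvdn_leq n0 pdn).
rewrite (gtn_eqF k0) mulrNz.
rewrite -[X in _ - - X]pmulrn.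
rewrite (natrM _ 24 (sigma 1 (n %/ p))).
by rewrite /s1 opprK addrC.
Qed.

(** Read off from the congruence: up to a multiple of p^2, f is a combination of p-integral
    series. *)
Lemma fform_integral : qp_integral p fform.
Proof.
have h := fform_congr; apply/qdvd0P.
have -> : fform = E2 * Em - (E2 * Em - (fform + fpsC p%:R * Ep ^+ p)) - fpsC p%:R * Ep ^+ p.
  by ring.
have iC : qp_integral p (fpsC p%:R).
  by move=> n; rewrite /fpsC; case: ifP => // _; exact: (pn 0).
apply: qdvdB => //; first apply: qdvdB => //.
- apply: (@qdvdM p p_pr 0 0); apply/qdvd0P; [exact: eisenstein2_integral|exact: eisenstein_pred_integral].
- by apply/qdvd0P; exact: qdvd_integral h.
- apply: (@qdvdM p p_pr 0 0); apply/qdvd0P => //.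
  by apply: qp_integralX => //; exact: eisenstein_succ_integral.
Qed.

Lemma fform_Mspace (R : realType) : Mspace R p.+1 fform.
Proof.
have op : odd p by case: (even_prime p_pr) => // p2; move: p_ge5; rewrite p2.
have [bm _] := bernoulli_pred_p_inv; have [bp _ _] := bernoulli_succ_p_inv.
apply: modS_Mspace; first by rewrite /= op.
have mm : modS R p.-1 Em.
  rewrite /Em eisenstein_gser//; last by lia.
  by apply: modS_scale; apply: modS_gser; lia.
have mp : modS R p.+1 Ep.
  by rewrite /Ep eisenstein_gser//; apply: modS_scale; apply: modS_gser; lia.
have pp : p.-1.+2 = p.+1 by lia.
have := modS_scale (- (12 / p.-1%:R)) (modS_serre mm); rewrite pp => hs.
have := modS_add hs (modS_scale (- p%:R) mp); congr (modS R _ _).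
rewrite !qscaleE; pose G : fps := gser 2.
have pm : p.-1%:R != 0 :> rat by rewrite pnatr_eq0; lia.
have e2 : E2 = fpsC (- (12 / p.-1%:R)) * fpsC (2 * p.-1)%N%:R * G.
  rewrite /E2 eisenstein_gser// ?bernoulli2// qscaleE; congr (_ * _).
  apply/funext => n; rewrite fpsCM /fpsC; case: ifP => _; last by rewrite mulr0.
  have -> : (2 * 2)%N%:R / (1 / 6) = 24%:R :> rat by apply/eqP.
  by rewrite natrM; move: pm; move: (p.-1%:R : rat) => y y0; field.
have eN c : fpsC (- c) = - fpsC c.
  by apply/funext => n; rewrite fpsN /fpsC; case: ifP => // _; rewrite oppr0.
suff : fpsC (- (12 / p.-1%:R)) * ((qD Em : fps) + fpsC (2 * p.-1)%N%:R * (G * Em))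
   + fpsC (- p%:R) * Ep = fform by exact.
rewrite /fform e2 !eN.
move: (qD Em) => D; move: (fpsC _) (fpsC _) (fpsC _) => a b c.
by ring.
Qed.

(** One direction multiplies by E_(p-1)^(p-1), the other by E_(p-1). The term p E_(p+1)^p is thereby
    multiplied by a series that is 1 mod p, which changes it by a multiple of p^2. *)
Lemma equiv_congr (f : fps) : qp_integral p f ->
  qdvd p 2 (E2 * Em - (f + fpsC p%:R * Ep ^+ p)) <->
  qdvd p 2 (E2 - (Em ^+ p.-1 * f + fpsC p%:R * Ep ^+ p)).
Proof.
move=> fi; have hm := eisenstein_pred_congr; have mi := eisenstein_pred_integral.
rewrite -/Em in hm mi.
have hX := qdvdX_p p_pr mi hm.
have hX1 : qdvd p 1 (Em ^+ p.-1 - 1).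
  by have := qdvdX_sub p_pr p.-1 mi (qp_integral1 p_pr) hm; rewrite expr1n.
have pC : qdvd p 1 (fpsC p%:R).
  by move=> n; rewrite /fpsC; case: ifP => _; [exact: pdvd_nat|exact: pdvd0].
have pi := qp_integralX p_pr p eisenstein_succ_integral; rewrite -/Ep in pi.
have EmX : Em ^+ p = Em * Em ^+ p.-1 by rewrite -exprS prednK// prime_gt0.
have pE (g : fps) : qdvd p 1 g -> qdvd p 2 (fpsC p%:R * Ep ^+ p * g).
  by move=> hg; rewrite mulrAC mulrC; apply: qdvd_mull => //; exact: (qdvdM p_pr pC hg).
split=> h.
  have -> : E2 - (Em ^+ p.-1 * f + fpsC p%:R * Ep ^+ p) =
    Em ^+ p.-1 * (E2 * Em - (f + fpsC p%:R * Ep ^+ p)) - E2 * (Em ^+ p - 1)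
    + fpsC p%:R * Ep ^+ p * (Em ^+ p.-1 - 1) by rewrite EmX; ring.
  apply: qdvdD => //; last exact: pE.
  apply: qdvdB => //; apply: qdvd_mull => //; first exact: qp_integralX.
  exact: eisenstein2_integral.
have -> : E2 * Em - (f + fpsC p%:R * Ep ^+ p) =
    Em * (E2 - (Em ^+ p.-1 * f + fpsC p%:R * Ep ^+ p)) + f * (Em ^+ p - 1)
    + fpsC p%:R * Ep ^+ p * (Em - 1) by rewrite EmX; ring.
apply: qdvdD => //; last exact: pE.
by apply: qdvdD => //; apply: qdvd_mull.
Qed.

End Main.

Theorem theorem1p2 (R : realType) (p : nat) (p_prime : prime p)
    (p_ge5 : (5 <= p)%N) :
  (exists f : qseries,
     [/\ Mspace R p.+1 f, qp_integral p f &
         qcongr p 2 (qmul (eisenstein 2) (eisenstein p.-1))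
           (qadd f (qscale p%:R (qpow (eisenstein p.+1) p)))])
  /\
  (forall f : qseries, Mspace R p.+1 f -> qp_integral p f ->
     (qcongr p 2 (qmul (eisenstein 2) (eisenstein p.-1))
        (qadd f (qscale p%:R (qpow (eisenstein p.+1) p)))
      <->
      qcongr p 2 (eisenstein 2)
        (qadd (qmul (qpow (eisenstein p.-1) p.-1) f)
              (qscale p%:R (qpow (eisenstein p.+1) p))))).
Proof.
rewrite qscaleE !qpowE; split; last first.
  by move=> f _ fi; exact: (equiv_congr p_prime p_ge5 fi).
exists (fform p); split; [exact: fform_Mspace|exact: fform_integral|exact: fform_congr].
Qed.
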